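(* Let $\mathcal{T}$ be the radial spanning tree of a homogeneous Poisson point process on $\mathbb{R}^2$ of intensity $1$ with the origin added. Then almost surely all of the following hold: (1) every semi-infinite path of $\mathcal{T}$ has an asymptotic direction; (2) for every $u\in S^1$ there exists at least one semi-infinite path of $\mathcal{T}$ with asymptotic direction $u$; (3) the set of $u\in S^1$ such that there is more than one semi-infinite path of $\mathcal{T}$ with asymptotic direction $u$ is dense in $S^1$.
   Context: $|\cdot|$ is the Euclidean norm on $\mathbb{R}^2$, $O$ the origin, $B(X,r)$ the open ball of center $X$ and radius $r$, $S^1$ the unit circle. $N$ denotes the union of $\{O\}$ and a homogeneous Poisson point process of intensity $1$ on $\mathbb{R}^2$. Almost surely $N$ is locally finite and nonequidistant (there are no $X,Y,Z,T\in N$ with $\{X,Y\}\neq\{Z,T\}$ and $|X-Y|=|Z-T|$). The radial spanning tree (RST) $\mathcal{T}$ is the graph with vertex set $N$ in which each $X\in N\setminus\{O\}$ has an edge to its ancestor $\mathcal{A}(X)$, defined as the point of $N\cap B(O,|X|)$ closest to $X$. Equivalently, for $X,Y\in N$ with $|Y|<|X|$, $(X,Y)$ is an edge iff $N\cap B(O,|X|)\cap B(X,|X-Y|)=\varnothing$. $\mathcal{T}$ is a tree. A semi-infinite path is an infinite self-avoiding path $(O=Y_0,Y_1,Y_2,\dots)$ in $\mathcal{T}$ starting from the origin; two such paths are considered the same if they share an infinite sub-path. It has asymptotic direction $u\in S^1$ if $Y_n/|Y_n|\to u$ as $n\to\infty$. *)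

(* Defs.v *)
From HB Require Import structures.
From mathcomp Require Import all_boot all_order all_algebra.
From mathcomp Require Import all_classical all_reals all_analysis.
From mathcomp Require Import measurable_realfun.
Import Order.TTheory GRing.Theory Num.Theory.
Import numFieldNormedType.Exports.

Set Implicit Arguments.
Unset Strict Implicit.
Unset Printing Implicit Defensive.

Local Open Scope classical_set_scope.
Local Open Scope ring_scope.

Notation plane R := (R * R)%type.

Section Plane.
Context {R : realType}.
Implicit Types (p c : plane R) (r : R).

Definition origin : plane R := (0, 0).

(* The norm that the library puts on a product is the sup norm. *)
Definition enorm p : R := Num.sqrt (p.1 ^+ 2 + p.2 ^+ 2).

Definition eball c r : set (plane R) := [set p | enorm (p - c) < r].

Definition unit_circle : set (plane R) := [set u | enorm u = 1].

Definition lebesgue_plane : set (plane R) -> \bar R :=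
  (@lebesgue_measure R \x @lebesgue_measure R)%E.

End Plane.

Section PointProcess.
Context {R : realType} d (T : measurableType d) (P : probability T R).

(* Since some of the B i may be taken to be setT, this contains the product
   rule for every subfamily. *)
Definition mutually_independent d' (U : measurableType d') (n : nat)
    (X : 'I_n -> T -> U) : Prop :=
  forall B : 'I_n -> set U, (forall i, measurable (B i)) ->
    P (\bigcap_(i in [set: 'I_n]) (X i @^-1` B i)) =
    (\prod_(i < n) P (X i @^-1` B i))%E.

Definition point_count (Phi : T -> set (plane R)) (A : set (plane R)) (w : T)
    : \bar R :=
  counting (Phi w `&` A).

(* Borel sets of the plane are those of the product sigma-algebra on R * R.
   The nat argument 0 of poisson_prob is a dummy one.  The law is not stated
   with poisson_pmf because poisson_pmf 0 k = 1 for all k, whereas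
   poisson_prob 0 is the Dirac mass at 0, as needed for Lebesgue-null sets. *)
Definition homogeneous_poisson (lambda : R) (Phi : T -> set (plane R)) : Prop :=
  [/\ forall A : set (plane R), measurable A -> measurable_fun [set: T] (point_count Phi A),
      forall A : set (plane R), measurable A -> (lebesgue_plane A < +oo)%E ->
        forall k : nat,
          P [set w | point_count Phi A w = k%:R%:E] =
          poisson_prob (lambda * fine (lebesgue_plane A)) 0%N [set k]
    & forall (n : nat) (A : 'I_n -> set (plane R)),
        (forall i, measurable (A i)) -> trivIset setT A ->
        mutually_independent (fun i => point_count Phi (A i))].

End PointProcess.

Section RadialSpanningTree.
Context {R : realType}.
Implicit Types (N S : set (plane R)) (X Y : plane R) (y z : nat -> plane R).

Definition closest_point S X Y : Prop :=
  S Y /\ forall Z, S Z -> enorm (X - Y) <= enorm (X - Z).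

(* A relation: the closest point is unique when N is nonequidistant. *)
Definition ancestor N X Y : Prop :=
  [/\ N X, X <> origin & closest_point (N `&` eball origin (enorm X)) X Y].

Definition rst_edge N X Y : Prop := ancestor N X Y \/ ancestor N Y X.

Definition semi_infinite_path N y : Prop :=
  [/\ y 0%N = origin, injective y & forall n, rst_edge N (y n) (y n.+1)].

Definition same_path y z : Prop :=
  exists m n : nat, forall k : nat, y (m + k)%N = z (n + k)%N.

Definition asymptotic_direction y (u : plane R) : Prop :=
  (fun n => ((y n).1 / enorm (y n), (y n).2 / enorm (y n))) @ \oo --> u.

End RadialSpanningTree.

(* Main.v *)
(* Ancestors are nearest neighbours among the points of smaller norm, so two paths of the tree
   cannot cross.  Cut the annulus n^21 <= |z| < (n + 1)^21 into thin rings and, on each circle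
   between two rings, start auxiliary paths at equally spaced angles.  Across one ring the
   angular displacement of such a path depends on the points of that ring only and has a law
   invariant under reflection, so that displacements in different rings are independent, bounded
   and centred.  By planarity every path of the tree is trapped between two chains of auxiliary
   paths, restarted on each circle at a neighbouring starting angle, and the Chernoff bound and
   the Borel-Cantelli lemma show that in the n-th annulus directions vary by O(n^-2) only.

   To compute with laws on finite spaces, the rings are divided into polar cells and a path is
   compared with a walk through the centres of the occupied cells.  They agree unless two
   distances nearly tie, which has probability O(mesh).

   As the variations are summable, every infinite path has an asymptotic direction, and König's
   lemma produces a path in every direction.  If on some arc the path with a given direction were
   unique, its k-th vertex would be a locally constant function of the direction, so that all
   directions of the arc would share one path, which is absurd. *)
From HB Require Import structures.
Require Import Defs.
From mathcomp Require Import all_boot all_order all_algebra.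
From mathcomp Require Import all_classical all_reals all_analysis.
From mathcomp Require Import measurable_realfun.
From mathcomp Require Import zify ring lra.
Import Order.TTheory GRing.Theory Num.Theory.
Import numFieldNormedType.Exports.

Set Implicit Arguments.
Unset Strict Implicit.
Unset Printing Implicit Defensive.

Local Open Scope classical_set_scope.
Local Open Scope ring_scope.

(** * Plane geometry *)

Section PlaneGeometry.
Context {R : realType}.
Implicit Types (p q v a b : plane R) (r s t : R).

(** A path of the tree remembers the region that it has explored, so its successive steps are not
    independent; a path restarted at a deterministic point of a circle and followed through one ring
    forgets the past. Reflection centres its displacement without any knowledge of the law. Two
    costs do not cancel but add up over the rings: rounding to the grid of starting angles, and the
    last stretch of a ring, where the ancestor may lie in the next ring. Thin rings give many
    independent terms, yet the sum of these costs must stay below an angular tolerance that is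
    summable over the annuli; annuli with polynomial radii leave room for this.

    An edge may dip below the circle through its lower end and climb back. Paths are therefore
    followed by level, planarity compares positions of equal norm, and the jumps along a circle need
    their own argument.

    In a fixed annulus the estimate for discrete walks is uniform in the mesh, so the mesh is chosen
    last, fine enough to make near ties as unlikely as desired. Tree events are bounded through
    measurable supersets, chiefly events on the occupation of cells and squares. *)

Definition dot p q : R := p.1 * q.1 + p.2 * q.2.
Definition cross p q : R := p.1 * q.2 - p.2 * q.1.
Definition polar r t : plane R := (r * cos t, r * sin t).
Definition direction p : plane R := (p.1 / enorm p, p.2 / enorm p).

Lemma enorm_ge0 p : 0 <= enorm p. Proof. exact: sqrtr_ge0. Qed.

Lemma sqr_enorm p : enorm p ^+ 2 = dot p p.
Proof. by rewrite sqr_sqrtr ?addr_ge0 ?sqr_ge0// !expr2. Qed.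

Lemma dotxx_ge0 p : 0 <= dot p p. Proof. by rewrite -sqr_enorm sqr_ge0. Qed.

Lemma enorm0 : enorm origin = 0 :> R.
Proof. by rewrite /enorm/= expr2 mul0r addr0 sqrtr0. Qed.

Lemma enorm_eq0 p : enorm p = 0 -> p = origin.
Proof.
move=> /(congr1 (fun x => x ^+ 2)); rewrite sqr_enorm expr0n /dot/=.
case: p => x y /= /eqP; rewrite paddr_eq0 -?expr2 ?sqr_ge0// !sqrf_eq0.
by move=> /andP[/eqP -> /eqP ->].
Qed.

Lemma enorm_gt0 p : p <> origin -> 0 < enorm p.
Proof.
move=> p0; rewrite lt_neqAle enorm_ge0 andbT eq_sym.
by apply/eqP => /enorm_eq0.
Qed.

Lemma ler_enorm p q : (enorm p <= enorm q) = (dot p p <= dot q q).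
Proof. by rewrite -!sqr_enorm ler_pXn2r// nnegrE enorm_ge0. Qed.

Lemma ltr_enorm p q : (enorm p < enorm q) = (dot p p < dot q q).
Proof. by rewrite -!sqr_enorm ltr_pXn2r// nnegrE enorm_ge0. Qed.

Lemma enormN p q : enorm (p - q) = enorm (q - p).
Proof. by rewrite /enorm; congr Num.sqrt => /=; ring. Qed.

Lemma enorm_sub0 p : enorm (p - origin) = enorm p.
Proof. by rewrite /enorm; congr Num.sqrt => /=; ring. Qed.

Lemma enorm_0sub p : enorm (origin - p) = enorm p.
Proof. by rewrite enormN enorm_sub0. Qed.

Lemma enormZ r p : enorm (r * p.1, r * p.2) = `|r| * enorm p.
Proof. by rewrite /enorm/= !exprMn -mulrDr sqrtrM ?sqr_ge0// sqrtr_sqr. Qed.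

Lemma enorm_subxx p : enorm (p - p) = 0.
Proof. by rewrite subrr; exact: enorm0. Qed.

Lemma enorm_sub_eq0 p q : enorm (p - q) = 0 -> p = q.
Proof.
case: p q => [x y] [x' y'] /enorm_eq0[] /eqP; rewrite subr_eq0 => /eqP -> /eqP.
by rewrite subr_eq0 => /eqP ->.
Qed.

Lemma dot_le p q : dot p q <= enorm p * enorm q.
Proof.
rewrite (le_trans (ler_norm _))// -(@ler_pXn2r _ 2)// ?nnegrE ?mulr_ge0 ?enorm_ge0//.
rewrite exprMn !sqr_enorm real_normK ?num_real// /dot.
have := sqr_ge0 (cross p q); rewrite /cross; nra.
Qed.

Lemma norm_cross_le p q : `|cross p q| <= enorm p * enorm q.
Proof.
rewrite -(@ler_pXn2r _ 2)// ?nnegrE ?mulr_ge0 ?enorm_ge0//.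
rewrite exprMn !sqr_enorm real_normK ?num_real//.
have := sqr_ge0 (dot p q); rewrite /cross /dot; nra.
Qed.

Lemma enormD_le p q : enorm (p + q) <= enorm p + enorm q.
Proof.
rewrite -(@ler_pXn2r _ 2)// ?nnegrE ?addr_ge0 ?enorm_ge0//.
have := dot_le p q; rewrite sqrrD !sqr_enorm /dot/=; nra.
Qed.

Lemma enorm_triangle v p q : enorm (p - q) <= enorm (p - v) + enorm (v - q).
Proof.
apply: le_trans (enormD_le _ _); rewrite le_eqVlt; apply/orP; left.
by apply/eqP; congr enorm; ring.
Qed.

Lemma enorm_le_sub p q : enorm p <= enorm q + enorm (p - q).
Proof.
by have := enorm_triangle q p origin; rewrite !enorm_sub0 addrC.
Qed.

Lemma enorm_polar r t : 0 <= r -> enorm (polar r t) = r.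
Proof.
move=> r0; rewrite /enorm /polar/= !exprMn -mulrDr cos2Dsin2 mulr1.
by rewrite sqrtr_sqr ger0_norm.
Qed.

Lemma dot_polar r s t t' : dot (polar r t) (polar s t') = r * s * cos (t' - t).
Proof. by rewrite /dot/= cosB; ring. Qed.

Lemma cross_polar r s t t' : cross (polar r t) (polar s t') = r * s * sin (t' - t).
Proof. by rewrite /cross/= sinB; ring. Qed.

Lemma direction_polar r t : 0 < r -> direction (polar r t) = polar 1 t.
Proof.
move=> r0; rewrite /direction enorm_polar ?ltW//= /polar !mul1r.
by rewrite !(mulrC r) !mulfK ?gt_eqF.
Qed.

Lemma enorm_direction p : p <> origin -> enorm (direction p) = 1.
Proof.
move=> /enorm_gt0 p0; apply/eqP; rewrite -(@eqrXn2 _ 2)// ?enorm_ge0//.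
rewrite sqr_enorm expr1n /dot/= !mulf_div -mulrDl -!expr2.
have := sqr_enorm p; rewrite /dot -!expr2 => <-.
by rewrite divff// expf_eq0/= gt_eqF.
Qed.

Lemma sin_le_id t : 0 <= t -> sin t <= t.
Proof.
move=> t0; have [->|tn0] := eqVneq t 0; first by rewrite sin0.
have tp : 0 < t by rewrite lt_neqAle eq_sym tn0.
have [c _] := @MVT R sin cos 0 t tp (fun x _ => is_derive_sin x)
  (continuous_subspaceT (@continuous_sin R)).
rewrite sin0 !subr0 => ->; rewrite -[leRHS]mul1r ler_wpM2r//; exact: cos_le1.
Qed.

Lemma norm_sin_le t : `|sin t| <= `|t|.
Proof.
have aux s : 0 <= s -> `|sin s| <= s.
  move=> s0; rewrite ler_norml sin_le_id// andbT.
  have [s1|s1] := leP 1 s; first by rewrite (le_trans _ (sin_geN1 s))// lerN2.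
  rewrite (le_trans (_ : _ <= 0)) ?oppr_le0// sin_ge0_pi// s0/=.
  by rewrite (le_trans (ltW s1))// (le_trans _ (pi_ge2 R))// ler1n.
have [t0|t0] := leP 0 t; first by rewrite (ger0_norm t0); exact: aux.
rewrite -(normrN (sin t)) -sinN -(normrN t) (@ger0_norm _ (- t)).
  by apply: aux; rewrite oppr_ge0 ltW.
by rewrite oppr_ge0 ltW.
Qed.

(** The chord is twice the sine of half the angle. *)
Lemma enorm_polar_sub t t' : enorm (polar 1 t - polar 1 t') <= `|t - t'|.
Proof.
rewrite -(@ler_pXn2r _ 2)// ?nnegrE ?enorm_ge0// real_normK ?num_real// sqr_enorm.
have -> : dot (polar 1 t - polar 1 t') (polar 1 t - polar 1 t') = 2 - 2 * cos (t - t').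
  rewrite /dot/= !mul1r cosB; have := cos2Dsin2 t; have := cos2Dsin2 t'; nra.
set s := (t - t') / 2; have -> : t - t' = s *+ 2 by rewrite /s -mulr_natr; field.
rewrite cos_mulr2n; have := cos2Dsin2 s.
have : sin s ^+ 2 <= s ^+ 2.
  rewrite -(real_normK (num_real (sin s))) -(real_normK (num_real s)).
  by rewrite ler_pXn2r// ?nnegrE// norm_sin_le.
rewrite -mulr_natl; nra.
Qed.

(* Mean value theorem: sin t = t cos c with c <= t, and cos decreases. *)
Lemma id_mul_cos_le_sin t : 0 <= t <= pi -> t * cos t <= sin t.
Proof.
move=> /andP[t0 tpi]; have [->|tn0] := eqVneq t 0; first by rewrite sin0 mul0r.
have tp : 0 < t by rewrite lt_neqAle eq_sym tn0.
have [c] := @MVT R sin cos 0 t tp (fun x _ => is_derive_sin x)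
  (continuous_subspaceT (@continuous_sin R)).
rewrite in_itv/= => /andP[c0 ct]; rewrite sin0 !subr0 => ->.
rewrite mulrC ler_wpM2r// ltW// ltr_cos// in_itv/= ?t0//.
by rewrite (ltW c0) (le_trans (ltW ct)).
Qed.

Lemma polar_exists_acos p : exists t, p = polar (enorm p) t.
Proof.
have [->|/eqP p0] := eqVneq p origin.
  by exists 0; rewrite enorm0 /polar !mul0r.
have np := enorm_gt0 p0.
have e1 := enorm_direction p0.
have d1 : (direction p).1 ^+ 2 + (direction p).2 ^+ 2 = 1.
  by have := sqr_enorm (direction p); rewrite e1 expr1n /dot -!expr2.
have pE : p = (enorm p * (direction p).1, enorm p * (direction p).2).
  by rewrite /direction/= !mulrA !(mulrC (enorm p)) !mulfK ?gt_eqF//; case: (p).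
have c1 : -1 <= (direction p).1 <= 1.
  by apply/andP; split; nra.
have s1 : sin (acos (direction p).1) = Num.sqrt (1 - (direction p).1 ^+ 2).
  by rewrite sin_acos.
have [h|h] := leP 0 (direction p).2.
  exists (acos (direction p).1); rewrite {1}pE /polar acosK// s1.
  have -> : 1 - (direction p).1 ^+ 2 = (direction p).2 ^+ 2 by rewrite -d1; ring.
  by rewrite sqrtr_sqr ger0_norm.
exists (- acos (direction p).1); rewrite {1}pE /polar cosN sinN acosK// s1.
have -> : 1 - (direction p).1 ^+ 2 = (direction p).2 ^+ 2 by rewrite -d1; ring.
by rewrite sqrtr_sqr ltr0_norm// opprK.
Qed.

Lemma polarDz r t (k : int) : polar r (t + 2 * pi * k%:~R) = polar r t.
Proof.
have aux s (n : nat) : polar r (s + 2 * pi * n%:R) = polar r s.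
  rewrite /polar.
  have -> : s + 2 * pi * n%:R = s + (pi *+ 2) *+ n by rewrite -mulr_natr -(mulr_natr pi); ring.
  by elim: n => [|n IH]; rewrite ?mulr0n ?addr0// mulrSr addrA cosD2pi sinD2pi.
case: (intP k) => [|n|n]; rewrite ?mulr0 ?addr0//; first by rewrite (aux t n.+1).
by rewrite -(aux _ n.+1); congr polar; rewrite mulrNz mulrN subrK.
Qed.

Lemma polar_exists p s : exists2 t, p = polar (enorm p) t & s <= t < s + 2 * pi.
Proof.
have [t pt] := polar_exists_acos p.
have pi0 := pi_gt0 R.
have pi20 : 0 < 2 * pi :> R by rewrite mulr_gt0.
pose k := Num.floor ((t - s) / (2 * pi)).
exists (t + 2 * pi * (- k)%:~R); first by rewrite polarDz.
have := floor_itv ((t - s) / (2 * pi)).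
rewrite -/k ler_pdivlMr// ltr_pdivrMr// intrD mulrDl mul1r mulrNz.
move=> /andP[h1 h2]; apply/andP; split; lra.
Qed.

Lemma polar_near r s v d : 0 < r -> enorm (v - polar r s) <= d -> d <= r / 4 ->
  exists2 t, v = polar (enorm v) t & `|t - s| <= 4 * d / r.
Proof.
move=> r0 vd dr; have pi0 := pi_gt0 R.
have d0 : 0 <= d by rewrite (le_trans _ vd) ?enorm_ge0.
have [t vt /andP[t1 t2]] := polar_exists v (s - pi).
have hr : enorm (polar r s) = r by rewrite enorm_polar// ltW.
have nv : r * (3 / 4) <= enorm v.
  by have := enorm_le_sub (polar r s) v; rewrite enormN hr; lra.
have vgt0 : 0 < enorm v by lra.
exists t => //.
have cr : `|enorm v * sin (t - s)| <= d.
  have : `|cross (polar r s) (v - polar r s)| <= r * d.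
    by rewrite (le_trans (norm_cross_le _ _))// hr ler_pM2l.
  have -> : cross (polar r s) (v - polar r s) = cross (polar r s) v.
    by rewrite /cross/=; ring.
  by rewrite {1}vt cross_polar -mulrA normrM gtr0_norm// ler_pM2l.
have cs : 0 < cos (t - s).
  have : - (r * d) <= dot (polar r s) (v - polar r s).
    rewrite lerNl; have -> : - dot (polar r s) (v - polar r s) =
      dot (polar r s) (polar r s - v) by rewrite /dot/=; ring.
    by rewrite (le_trans (dot_le _ _))// hr enormN ler_pM2l.
  have -> : dot (polar r s) (v - polar r s) = dot (polar r s) v - r ^+ 2.
    by rewrite -{4}hr sqr_enorm /dot/=; ring.
  rewrite {1}vt dot_polar => h.
  rewrite -(pmulr_rgt0 _ (mulr_gt0 r0 vgt0)); nra.
have sn : `|sin (t - s)| <= d * 4 / 3 / r.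
  rewrite ler_pdivlMr// mulrC; move: cr; rewrite normrM gtr0_norm//.
  have := normr_ge0 (sin (t - s)); nra.
have sn2 : `|sin (t - s)| <= 1 / 3.
  by rewrite (le_trans sn)// ler_pdivrMr//; lra.
have c2 : 9 / 10 <= cos (t - s).
  have := cos2Dsin2 (t - s); have : sin (t - s) ^+ 2 <= 1 / 9.
    rewrite -(real_normK (num_real (sin _))) expr2.
    have := normr_ge0 (sin (t - s)); nra.
  move=> h1 h2; rewrite leNgt; apply/negP => h3; nra.
have main (u : R) : 0 <= u <= pi -> cos u = cos (t - s) -> `|sin u| = `|sin (t - s)| ->
    u <= 4 * d / r.
  move=> u0 cu su; have := id_mul_cos_le_sin u0; rewrite cu => h.
  have := le_trans h (ler_norm _); rewrite su => {}h.
  have u1 : u * (9 / 10) <= d * 4 / 3 / r.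
    rewrite (le_trans _ sn)// (le_trans _ h)// ler_wpM2l//; by case/andP: u0.
  have dr0 : 0 <= d / r by rewrite divr_ge0// ltW.
  move: u1; have -> : d * 4 / 3 / r = 4 / 3 * (d / r) by ring.
  have -> : 4 * d / r = 4 * (d / r) by ring.
  by lra.
have [ts|ts] := leP 0 (t - s).
  by rewrite ger0_norm//; apply: main => //; rewrite ts/=; lra.
by rewrite ltr0_norm//; apply: main; rewrite ?cosN ?sinN ?normrN//; lra.
Qed.

End PlaneGeometry.

(** * Planarity of nearest-neighbour paths *)

Section Flow.
Context {R : realType}.
Implicit Types (N : set (plane R)) (p q a b u z : plane R) (r s t : R).

(** The point p is arbitrary, so that a path may start off [N] or be cut in the middle of an
    edge. *)
Definition snear N p a := [/\ N a, enorm a < enorm p &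
  forall z, N z -> enorm z < enorm p -> z <> a -> enorm (p - a) < enorm (p - z)].

Lemma snear_inj N p a b : snear N p a -> snear N p b -> a = b.
Proof.
move=> [Na ap ha] [Nb bp hb]; apply: contrapT => ab.
have := ha b Nb bp (fun e => ab (esym e)).
by have := hb a Na ap ab; move=> h1 /(lt_trans h1); rewrite ltxx.
Qed.

Definition seg p a t : plane R := (a.1 + t * (p.1 - a.1), a.2 + t * (p.2 - a.2)).

Lemma seg1 p a : seg p a 1 = p.
Proof. by rewrite [RHS]surjective_pairing /seg; congr pair; ring. Qed.

Lemma dot_seg p a t : dot (seg p a t) (seg p a t) =
  dot a a + t * (2 * dot a (p - a)) + t ^+ 2 * dot (p - a) (p - a).
Proof. by rewrite /dot/=; ring. Qed.

(* |p - a| < |p - z| as a half-plane condition on p, affine in p. *)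
Lemma ltr_enorm_sub p a z : (enorm (p - a) < enorm (p - z)) =
  (dot a a - dot z z < 2 * dot p (a - z)).
Proof.
rewrite ltr_enorm -subr_gt0 -[RHS]subr_gt0; congr (0 < _).
by rewrite /dot/=; ring.
Qed.

(** The points closer to a than to z form a half-plane, which is convex and contains a. *)
Lemma ltr_enorm_sub_seg p a z t : 0 <= t <= 1 -> z <> a ->
  enorm (p - a) < enorm (p - z) ->
  enorm (seg p a t - a) < enorm (seg p a t - z).
Proof.
move=> /andP[t0 t1] za; rewrite !ltr_enorm_sub => h.
have d0 : 0 < dot (a - z) (a - z).
  rewrite -sqr_enorm exprn_gt0// lt_neqAle enorm_ge0 andbT eq_sym.
  by apply/eqP => /enorm_sub_eq0 /esym.
have -> : 2 * dot (seg p a t) (a - z) = t * (2 * dot p (a - z))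
    + (1 - t) * (dot a a - dot z z + dot (a - z) (a - z)).
  by rewrite /dot/=; ring.
have [->|tn0] := eqVneq t 0; first by rewrite mul0r subr0; lra.
have t_gt0 : 0 < t by rewrite lt_neqAle eq_sym tn0.
have : 0 < t * (2 * dot p (a - z) - (dot a a - dot z z)) by rewrite mulr_gt0 ?subr_gt0.
have : 0 <= (1 - t) * dot (a - z) (a - z) by rewrite mulr_ge0 ?subr_ge0// ltW.
lra.
Qed.

Lemma enorm_seg_le p a t : 0 <= t <= 1 -> enorm a <= enorm p ->
  enorm (seg p a t) <= enorm p.
Proof.
move=> /andP[t0 t1]; rewrite !ler_enorm => h; rewrite dot_seg.
have e : dot p p = dot a a + 2 * dot a (p - a) + dot (p - a) (p - a).
  by rewrite /dot/=; ring.
have := dotxx_ge0 (p - a); have := mulr_ge0 t0 (_ : 0 <= 1 - t).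
rewrite subr_ge0 => /(_ t1); nra.
Qed.

(** Sliding p along its edge keeps a nearest and only shrinks the set of competitors, as norms on
    the edge do not exceed that of p. *)
Lemma snear_seg N p a t : snear N p a -> 0 <= t <= 1 -> enorm a < enorm (seg p a t) ->
  snear N (seg p a t) a.
Proof.
move=> [Na ap h] t01 at1; split => // z Nz zt za.
apply: ltr_enorm_sub_seg => //; apply: h => //.
by rewrite (lt_le_trans zt)// enorm_seg_le// ltW.
Qed.

(** The larger root t of |a + t (p - a)|^2 = s^2. Coming down from p at t = 1, it is the first point
    of the edge at norm s. *)
Definition tau p a s : R :=
  (- dot a (p - a) + Num.sqrt (dot a (p - a) ^+ 2
     + dot (p - a) (p - a) * (s ^+ 2 - dot a a))) / dot (p - a) (p - a).

Definition pos p a s := seg p a (tau p a s).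

Section tau.
Variables (p a : plane R).
Hypothesis ap : enorm a < enorm p.

Let D_gt0 : 0 < dot (p - a) (p - a).
Proof.
rewrite -sqr_enorm exprn_gt0// lt_neqAle enorm_ge0 andbT eq_sym.
by apply/eqP => /enorm_sub_eq0 e; move: ap; rewrite e ltxx.
Qed.

Let D_ge0 := ltW D_gt0.

Let sqr_sub_ge0 s : enorm a <= s -> 0 <= s ^+ 2 - dot a a.
Proof.
move=> as_; rewrite subr_ge0 -sqr_enorm ler_pXn2r// nnegrE ?enorm_ge0//.
by rewrite (le_trans _ as_) ?enorm_ge0.
Qed.

Lemma enorm_pos s : enorm a <= s -> enorm (pos p a s) = s.
Proof.
move=> as_; have s0 : 0 <= s by rewrite (le_trans _ as_) ?enorm_ge0.
apply/eqP; rewrite -(@eqrXn2 _ 2)// ?enorm_ge0// sqr_enorm dot_seg /tau.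
have := sqr_sub_ge0 as_; move: D_gt0.
move: (dot a (p - a)) (dot (p - a) (p - a)) (dot a a) => B D C D0 sC.
have hq : 0 <= B ^+ 2 + D * (s ^+ 2 - C).
  by rewrite addr_ge0 ?sqr_ge0// mulr_ge0// ltW.
set S := Num.sqrt _; have hS : S ^+ 2 = B ^+ 2 + D * (s ^+ 2 - C).
  by rewrite sqr_sqrtr.
have -> : C + (- B + S) / D * (2 * B) + ((- B + S) / D) ^+ 2 * D =
   C + (S ^+ 2 - B ^+ 2) / D by field; rewrite gt_eqF.
by apply/eqP; rewrite hS; field; rewrite gt_eqF.
Qed.

Lemma tau_ge0 s : enorm a <= s -> 0 <= tau p a s.
Proof.
move=> as_; rewrite /tau divr_ge0// addrC subr_ge0 (le_trans (ler_norm _))//.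
rewrite -sqrtr_sqr ler_wsqrtr// lerDl mulr_ge0//; exact: sqr_sub_ge0.
Qed.

Lemma tau_unique t s : enorm a < s -> 0 <= t -> enorm (seg p a t) = s -> t = tau p a s.
Proof.
move=> as_ t0 ts; have h0 := tau_ge0 (ltW as_); have := enorm_pos (ltW as_).
rewrite -ts => /(congr1 (fun x => x ^+ 2)); rewrite !sqr_enorm !dot_seg.
rewrite ts -/(tau p a s).
have : dot a a < s ^+ 2 by rewrite -sqr_enorm ltr_pXn2r// nnegrE (enorm_ge0, ltW (le_lt_trans (enorm_ge0 _) as_)).
have /(congr1 (fun x => x ^+ 2)) := ts; rewrite sqr_enorm dot_seg.
move: h0 D_gt0.
move: (tau p a s) (2 * dot a (p - a)) (dot (p - a) (p - a)) (dot a a) => T B D C h0 D0 h1 h2 h3.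
(* Difference of the two quadratic equations. The second factor cannot vanish: t times it is s^2 -
   |a|^2 > 0 plus a nonnegative term. *)
have h4 : (t - T) * (B + (t + T) * D) = 0 by rewrite mulrDr; nra.
move/eqP: h4; rewrite mulf_eq0 subr_eq0 => /orP[/eqP //|/eqP h5].
have h6 : t * B + t ^+ 2 * D > 0 by lra.
have h7 : t * B + t ^+ 2 * D + t * T * D = 0.
  by have := congr1 (fun x => t * x) h5; rewrite mulr0 => <-; ring.
have : 0 <= t * T * D by rewrite !mulr_ge0 ?(ltW D0).
lra.
Qed.

Lemma tau1 : tau p a (enorm p) = 1.
Proof. by rewrite -(@tau_unique 1)// seg1. Qed.

Lemma pos_top : pos p a (enorm p) = p.
Proof. by rewrite /pos tau1 seg1. Qed.

Lemma tau_le1 s : enorm a <= s <= enorm p -> tau p a s <= 1.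
Proof.
move=> /andP[as_ sp]; rewrite -tau1 /tau ler_wpM2r ?invr_ge0// lerD2l.
rewrite ler_wsqrtr// lerD2l ler_wpM2l// lerD2r.
by rewrite ler_pXn2r// nnegrE ?enorm_ge0// (le_trans _ as_)// enorm_ge0.
Qed.

Lemma tau_itv s : enorm a <= s <= enorm p -> 0 <= tau p a s <= 1.
Proof. by move=> h; rewrite tau_le1// andbT tau_ge0//; case/andP: h. Qed.

Lemma continuous_tau : continuous (tau p a).
Proof.
move=> s; rewrite /continuous_at; apply: cvgM; last exact: cvg_cst.
apply: cvgD; first exact: cvg_cst.
apply: (@continuous_comp _ _ _ (fun s => _) Num.sqrt); last exact: sqrt_continuous.
apply: cvgD; first exact: cvg_cst.
apply: cvgM; first exact: cvg_cst.
by apply: cvgB; [exact: exprn_continuous | exact: cvg_cst].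
Qed.

End tau.

(** The open cone of half-angle pi / 4 around u. It is convex, and two of its points make an angle
    less than pi / 2, so inside it the sign of [cross] is the angular order. *)
Definition cone u z := `|cross u z| < dot u z.

Lemma cone_dot u z z' : cone u z -> cone u z' -> 0 < dot z z'.
Proof.
rewrite /cone !ltr_norml => /andP[h1 h2] /andP[h3 h4].
have h0 : 0 < dot u z by lra.
have h0' : 0 < dot u z' by lra.
have e : dot u u * dot z z' = dot u z * dot u z' + cross u z * cross u z'.
  by rewrite /dot /cross; ring.
have : 0 < dot u u * dot z z' by rewrite e; nra.
by have := dotxx_ge0 u; nra.
Qed.

Lemma cone_seg u p a t : 0 <= t <= 1 -> cone u p -> cone u a -> cone u (seg p a t).
Proof.
move=> /andP[t0 t1]; rewrite /cone !ltr_norml => /andP[h1 h2] /andP[h3 h4].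
have -> : cross u (seg p a t) = t * cross u p + (1 - t) * cross u a.
  by rewrite /cross/=; ring.
have -> : dot u (seg p a t) = t * dot u p + (1 - t) * dot u a.
  by rewrite /dot/=; ring.
have s0 : 0 <= 1 - t by rewrite subr_ge0.
have [->|tn] := eqVneq t 0; first by rewrite !mul0r !add0r !subr0 !mul1r h3.
have t_gt0 : 0 < t by rewrite lt_neqAle eq_sym tn.
apply/andP; split; nra.
Qed.

Lemma collinear_eq z z' : cross z z' = 0 -> 0 < dot z z' -> enorm z = enorm z' -> z = z'.
Proof.
move=> c d e; apply: enorm_sub_eq0; apply/eqP; rewrite -sqrf_eq0 sqr_enorm.
have /(congr1 (fun x => x ^+ 2)) := e; rewrite !sqr_enorm => {}e.
have h : dot z z' ^+ 2 = dot z z ^+ 2.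
  have : dot z z' ^+ 2 + cross z z' ^+ 2 = dot z z * dot z' z' by rewrite /dot /cross; ring.
  by rewrite c -e expr0n addr0 expr2.
have {}h : dot z z' = dot z z.
  by apply/eqP; rewrite -(@eqrXn2 _ 2)// ?h// ?dotxx_ge0// ltW.
have -> : dot (z - z') (z - z') = dot z z + dot z' z' - 2 * dot z z' by rewrite /dot/=; ring.
by rewrite h -e; apply/eqP; ring.
Qed.

(** If the order were reversed at level s, the intermediate value theorem would give a higher level
    at which the two positions coincide. A common position has a single nearest point, so a = b and
    both paths continue on the same segment. *)
Lemma cross_pos_ge0 N u p q a b s :
  snear N p a -> snear N q b -> enorm p = enorm q ->
  cone u p -> cone u a -> cone u q -> cone u b ->
  enorm a <= s -> enorm b <= s -> s <= enorm p -> (a = b -> enorm a < s) ->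
  0 <= cross p q -> 0 <= cross (pos p a s) (pos q b s).
Proof.
move=> npa nqb pq up ua uq ub as_ bs sp abs cpq.
have ap : enorm a < enorm p by case: npa.
have bq : enorm b < enorm q by case: nqb.
rewrite leNgt; apply/negP => cs.
pose F x := cross (pos p a x) (pos q b x).
have cF : continuous F.
  have ca := @continuous_tau p a; have cb := @continuous_tau q b.
  by move=> x; apply: cvgB; apply: cvgM => /=; apply: cvgD; try exact: cvg_cst;
    apply: cvgM; try exact: cvg_cst; [exact: ca|exact: cb|exact: ca|exact: cb].
have Fp : 0 <= F (enorm p) by rewrite /F {2}pq !pos_top.
have [] := @IVT R F s (enorm p) 0 sp (continuous_subspaceT cF).
  by rewrite ge_min le_max (ltW cs) Fp orbT.
move=> x; rewrite in_itv/= => /andP[sx xp] Fx.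
have sx' : s < x.
  by rewrite lt_neqAle sx andbT; apply/eqP => e; move: cs; rewrite e -/(F x) Fx ltxx.
have ax : enorm a < x by rewrite (le_lt_trans as_).
have bx : enorm b < x by rewrite (le_lt_trans bs).
have ta : 0 <= tau p a x <= 1 by rewrite tau_itv// xp ltW.
have tb : 0 <= tau q b x <= 1 by rewrite tau_itv// -pq xp ltW.
have zz : pos p a x = pos q b x.
  apply: collinear_eq => //; last by rewrite !enorm_pos// ltW.
  by apply: (@cone_dot u); apply: cone_seg.
have n1 : snear N (pos p a x) a by apply: snear_seg => //; rewrite -/(pos p a x) enorm_pos// ltW.
have n2 : snear N (pos q b x) b by apply: snear_seg => //; rewrite -/(pos q b x) enorm_pos// ltW.
have ab : a = b by apply: snear_inj n1 _; rewrite zz.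
have {}as_ : enorm a < s by apply: abs.
(* beyond the common point the two segments lie on one ray from a *)
have key o y : enorm a < enorm o -> y = pos o a x -> pos o a s = pos y a s.
  move=> ao ye; have ny : enorm y = x by rewrite ye enorm_pos// ltW.
  have ay : enorm a < enorm y by rewrite ny.
  have tx : 0 < tau o a x.
    rewrite lt_neqAle tau_ge0 ?(ltW ax)// andbT; apply/eqP => e.
    by move: ax; rewrite -ny ye /pos -e /seg !mul0r !addr0 -surjective_pairing ltxx.
  have tso : 0 <= tau o a s by rewrite tau_ge0// ltW.
  have e : seg y a (tau o a s / tau o a x) = pos o a s.
    by rewrite ye /pos /seg/=; congr pair; field; rewrite gt_eqF.
  rewrite -e; congr seg; apply: tau_unique => //; last by rewrite e enorm_pos// ltW.
  by rewrite divr_ge0// ltW.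
move: cs; rewrite -ab (key p (pos p a x))// (key q (pos p a x))// ?zz -?ab//; last first.
  by rewrite ab.
by rewrite /cross mulrC subrr ltxx.
Qed.

Lemma cone_combination e z z' y : 0 <= e * cross z y -> 0 < e * cross y z' ->
  0 < dot z y -> 0 < dot y z' -> enorm z = enorm y -> enorm z' = enorm y ->
  exists al be, [/\ 0 <= al, 0 <= be, 1 <= al + be &
    y = (al * z.1 + be * z'.1, al * z.2 + be * z'.2)].
Proof.
move=> c1 c2 d1 d2 e1 e2.
have y0 : 0 < dot y y.
  rewrite -sqr_enorm exprn_gt0// lt_neqAle enorm_ge0 andbT eq_sym.
  apply/eqP => /enorm_eq0 y0; move: d1; rewrite y0 /dot/= !mulr0 addr0 ltxx//.
have c3 : 0 < e * cross z z'.
  have h : e * cross z z' * dot y y =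
      e * cross z y * dot y z' + dot z y * (e * cross y z').
    by rewrite /cross /dot; ring.
  rewrite -(pmulr_lgt0 _ y0) h; apply: ltr_wpDl; last exact: mulr_gt0.
  by apply: mulr_ge0 => //; exact: ltW.
pose al := e * cross y z' / (e * cross z z'); pose be := e * cross z y / (e * cross z z').
have yE : y = (al * z.1 + be * z'.1, al * z.2 + be * z'.2).
  have : e * cross z z' != 0 by rewrite gt_eqF.
  rewrite mulf_eq0 negb_or => /andP[en0 n0].
  have alE : al * cross z z' = cross y z' by rewrite /al; field; rewrite n0.
  have beE : be * cross z z' = cross z y by rewrite /be; field; rewrite n0.
  rewrite [LHS]surjective_pairing; congr pair; apply: (mulIf n0);
    rewrite mulrDl (mulrAC al) alE (mulrAC be) beE /cross; ring.
have al0 : 0 <= al by rewrite divr_ge0 ?ltW.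
have be0 : 0 <= be by apply: divr_ge0 => //; exact: ltW.
exists al, be; split => //.
have ey0 : 0 < enorm y by rewrite lt_neqAle enorm_ge0 andbT eq_sym -sqrf_eq0 sqr_enorm gt_eqF.
rewrite -(@ler_pM2r _ (enorm y))// mul1r {1}yE mulrDl -{1}e1 -{1}e2.
apply: le_trans (enormD_le (al * z.1, al * z.2) (be * z'.1, be * z'.2)) _.
have nZ (c : R) (x : plane R) : 0 <= c -> enorm (c * x.1, c * x.2) = c * enorm x.
  by move=> c0; rewrite enormZ ger0_norm.
by rewrite (nZ al z)// (nZ be z').
Qed.

(** The edge from p to a may pass below the circle through a, in which case the path jumps along
    that circle from z to a. If the other path were at a point y strictly in between, y would be a
    combination of z and a with coefficients of sum at least 1. The affine inequality that puts z on
    the side of a rather than b, together with |b| < |a|, would then carry over to y, whose nearest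
    point is b. *)
Lemma cross_jump_ge0 e N u p q a b : snear N p a -> snear N q b -> enorm p = enorm q ->
  cone u p -> cone u a -> cone u q -> cone u b -> enorm b < enorm a ->
  0 <= e * cross (pos p a (enorm a)) (pos q b (enorm a)) ->
  0 <= e * cross a (pos q b (enorm a)).
Proof.
move=> [Na ap ha] [Nb bq hb] pq up ua uq ub ba c1.
set y := pos q b (enorm a) in c1 *; set z := pos p a (enorm a) in c1.
rewrite leNgt; apply/negP => c2.
have nba : b <> a by move=> h; rewrite h ltxx in ba.
have nab : a <> b by move=> h; apply: nba.
have tz : 0 <= tau p a (enorm a) <= 1 by rewrite tau_ge0// tau_le1// lexx ltW.
have ty : 0 <= tau q b (enorm a) <= 1 by rewrite tau_ge0 ?tau_le1// -?pq ?ltW//= !ltW.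
have uz : cone u z by apply: cone_seg.
have uy : cone u y by apply: cone_seg.
have [||||||al [be [al0 be0 ab1 yE]]] := @cone_combination e z a y => //.
- by have -> : e * cross y a = - (e * cross a y);
    [rewrite /cross; ring|rewrite oppr_gt0].
- exact: cone_dot uz uy.
- exact: cone_dot uy ua.
- by rewrite !enorm_pos// ltW.
- by rewrite enorm_pos// ltW.
have hz : enorm (z - a) < enorm (z - b).
  by apply: ltr_enorm_sub_seg => //; apply: ha => //; rewrite pq.
have hy : enorm (y - b) < enorm (y - a).
  by apply: ltr_enorm_sub_seg => //; apply: hb => //; rewrite -pq.
move: hz hy ba; rewrite !ltr_enorm_sub ltr_enorm => hz hy ba.
have h : 2 * dot y (b - a) = - (al * (2 * dot z (a - b)) + be *
    (dot a a - dot b b + dot (a - b) (a - b))) by rewrite yE /dot/=; ring.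
have d0 := dotxx_ge0 (a - b); rewrite h in hy.
have h1 : 0 <= al * (2 * dot z (a - b) - (dot a a - dot b b)).
  by rewrite mulr_ge0// subr_ge0 ltW.
have h2 : 0 <= be * dot (a - b) (a - b) by rewrite mulr_ge0.
have h3 : 0 <= (al + be - 1) * (dot a a - dot b b).
  by rewrite mulr_ge0 ?subr_ge0// ltW.
lra.
Qed.

(** The descent of a path from p to its position on the circle of radius r; the index is the number
    of vertices met on the way, for inductions. Every edge used has both ends in the cone of u. *)
Inductive flow N u r : nat -> plane R -> plane R -> Prop :=
| flow_stop p a : snear N p a -> enorm a < r -> r <= enorm p -> cone u p -> cone u a ->
    flow N u r 0 p (pos p a r)
| flow_step n p a q : snear N p a -> r <= enorm a -> cone u p -> cone u a ->
    flow N u r n a q -> flow N u r n.+1 p q.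

Lemma flow_inj N u r n n' p q q' : flow N u r n p q -> flow N u r n' p q' -> q = q'.
Proof.
move=> h; elim: h n' q' => {n p q} [p a npa ar rp _ _|n p a q npa ra _ _ _ IH] n' q' h'.
  case: n' p q' / h' npa rp => [p b npb br _ _ _|n' p b q' npb rb _ _ _] npa _.
    by rewrite (snear_inj npa npb).
  by move: rb; rewrite -(snear_inj npa npb) leNgt ar.
case: n' p q' / h' npa => [p b npb br _ _ _|n' p b q' npb rb _ _ h] npa.
  by move: br; rewrite -(snear_inj npa npb) ltNge ra.
by apply: (IH n'); rewrite (snear_inj npa npb).
Qed.

Lemma pos_pos p a s r : enorm a < r -> r <= s -> s <= enorm p ->
  pos (pos p a s) a r = pos p a r.
Proof.
move=> ar rs sp; have as_ := lt_le_trans ar rs; have ap := lt_le_trans as_ sp.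
have ax : enorm a < enorm (pos p a s) by rewrite enorm_pos// ltW.
have tx : 0 < tau p a s.
  rewrite lt_neqAle tau_ge0 ?ltW// andbT; apply/eqP => e.
  by move: ax; rewrite /pos -e /seg !mul0r !addr0 -surjective_pairing ltxx.
have tso : 0 <= tau p a r by rewrite tau_ge0// ltW.
have e : seg (pos p a s) a (tau p a r / tau p a s) = pos p a r.
  by rewrite /pos /seg/=; congr pair; field; rewrite gt_eqF.
rewrite -e; congr seg; apply/esym; apply: tau_unique => //; last by rewrite e enorm_pos// ltW.
by rewrite divr_ge0// ltW.
Qed.

(* The position may be moved down its current edge without changing the flow. *)
Lemma flow_pos N u r n p b q s : flow N u r n p q -> snear N p b -> enorm b < s ->
  r <= s -> s <= enorm p -> cone u (pos p b s) -> flow N u r n (pos p b s) q.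
Proof.
move=> h npb bs rs sp us.
have bp : enorm b < enorm p by case: npb.
have nb : snear N (pos p b s) b.
  apply: snear_seg => //; first by rewrite tau_ge0 ?tau_le1 ?sp ?andbT// ltW.
  by rewrite -/(pos p b s) enorm_pos// ltW.
case: n p q / h npb bs sp us bp nb => [p a npa ar rp up ua|n p a q npa ra up ua h]
  npb bs sp us bp nb.
  have e := snear_inj npa npb; rewrite -{}e in bs us bp nb *.
  rewrite -(pos_pos ar rs sp); apply: flow_stop => //.
  by rewrite enorm_pos// ltW.
have e := snear_inj npa npb; rewrite -{}e in bs us bp nb *.
by apply: flow_step h.
Qed.

(* Planarity: two paths of the tree do not cross. *)
Theorem flow_cross_ge0 N u r (Ninj : forall z z', N z -> N z' -> enorm z = enorm z' -> z = z')
  n m p q p' q' : flow N u r n p p' -> flow N u r m q q' ->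
  enorm p = enorm q -> 0 <= cross p q -> 0 <= cross p' q'.
Proof.
(* Induction on the total number of vertices. The path whose next vertex is higher moves to that
   vertex and the other one is cut at the same level: [cross_pos_ge0] treats the descent and
   [cross_jump_ge0] the jump. *)
have [k] := ubnP (n + m)%N; elim: k n m p q p' q' => // k IH n m p q p' q' + hp hq.
case: n p p' / hp => [p a npa ar rp up ua|n p a p' npa ra up ua hp];
  case: m q q' / hq => [q b nqb br rq uq ub|m q b q' nqb rb uq ub hq] km pq cpq.
- apply: (cross_pos_ge0 npa nqb pq up ua uq ub) => //; exact: ltW.
- have ab : enorm a < enorm b by rewrite (lt_le_trans ar).
  have bq : enorm b < enorm q by case: nqb.
  have bp : enorm b <= enorm p by rewrite pq ltW.
  have ap : enorm a < enorm p by case: npa.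
  have us : cone u (pos p a (enorm b)).
    by apply: cone_seg => //; rewrite tau_itv// bp ltW.
  apply: (IH 0 m (pos p a (enorm b)) b _ q') => //.
  + by apply: flow_pos => //; exact: flow_stop.
  + by rewrite enorm_pos// ltW.
  have -> : cross (pos p a (enorm b)) b = -1 * cross b (pos p a (enorm b)).
    by rewrite /cross; ring.
  apply: (cross_jump_ge0 nqb npa (esym pq) uq ub up ua ab).
  have -> x y : -1 * cross x y = cross y x by rewrite /cross; ring.
  apply: (cross_pos_ge0 npa nqb pq up ua uq ub) => //; first exact: ltW.
- have ba : enorm b < enorm a by rewrite (lt_le_trans br).
  have ap : enorm a < enorm p by case: npa.
  have aq : enorm a <= enorm q by rewrite -pq ltW.
  have bq : enorm b < enorm q by case: nqb.
  have us : cone u (pos q b (enorm a)).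
    by apply: cone_seg => //; rewrite tau_itv// aq ltW.
  apply: (IH n 0 a (pos q b (enorm a)) p') => //.
  + by apply: flow_pos => //; exact: flow_stop.
  + by rewrite enorm_pos// ltW.
  rewrite -[cross _ _]mul1r; apply: (cross_jump_ge0 npa nqb pq up ua uq ub ba).
  rewrite mul1r; apply: (cross_pos_ge0 npa nqb pq up ua uq ub) => //; try exact: ltW.
  by move=> e; move: ba; rewrite e ltxx.
have ap : enorm a < enorm p by case: npa.
have bq : enorm b < enorm q by case: nqb.
have [ab|ba|ab] := ltgtP (enorm a) (enorm b).
- have us : cone u (pos p a (enorm b)).
    by apply: cone_seg => //; rewrite tau_itv// pq !ltW.
  apply: (IH n.+1 m (pos p a (enorm b)) b p' q') => //.
  + by move: km; rewrite addnS ltnS.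
  + by apply: flow_pos => //; [exact: flow_step hp|rewrite pq ltW].
  + by rewrite enorm_pos// ltW.
  have -> : cross (pos p a (enorm b)) b = -1 * cross b (pos p a (enorm b)).
    by rewrite /cross; ring.
  apply: (cross_jump_ge0 nqb npa (esym pq) uq ub up ua ab).
  have -> x y : -1 * cross x y = cross y x by rewrite /cross; ring.
  apply: (cross_pos_ge0 npa nqb pq up ua uq ub) => //; rewrite ?pq; try exact: ltW.
- have us : cone u (pos q b (enorm a)).
    by apply: cone_seg => //; rewrite tau_itv// -pq !ltW.
  apply: (IH n m.+1 a (pos q b (enorm a)) p' q') => //.
  + by apply: flow_pos => //; [exact: flow_step hq|rewrite -pq ltW].
  + by rewrite enorm_pos// ltW.
  rewrite -[cross _ _]mul1r; apply: (cross_jump_ge0 npa nqb pq up ua uq ub ba).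
  rewrite mul1r; apply: (cross_pos_ge0 npa nqb pq up ua uq ub) => //; try exact: ltW.
  by move=> e; move: ba; rewrite e ltxx.
(* Two vertices reached at the same level are equal since norms are distinct, and from there on the
   two flows are one. *)
have {}ab : a = b by apply: Ninj => //; [case: npa|case: nqb].
rewrite ab in hp; rewrite (flow_inj hp hq) /cross mulrC subrr//.
Qed.

End Flow.

(** * From straight paths to asymptotic directions *)

Section Tree.
Context {R : realType}.
Implicit Types (X Y Z p v : plane R).
Variable N : set (plane R).

(** By the default value the origin is its own ancestor, so iterates are total and remain at the
    origin. *)
Definition anc X : plane R := xget origin (snear N X).

Lemma anc_snear X Y : snear N X Y -> anc X = Y.
Proof. by move=> h; apply: xget_unique => // Z /snear_inj; exact. Qed.

Lemma anc_origin : anc origin = origin.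
Proof.
rewrite /anc; case: xgetP => // Y _ [_]; rewrite enorm0 => h.
by have := enorm_ge0 Y; rewrite leNgt h.
Qed.

Hypothesis N0 : N origin.
Hypothesis Nfin : forall r : R, finite_set (N `&` [set z | enorm z < r]).

Definition unique_nearest p := forall Y Z, N Y -> N Z -> enorm Y < enorm p ->
  enorm Z < enorm p -> enorm (p - Y) = enorm (p - Z) -> Y = Z.

Lemma seq_argmin (f : plane R -> R) (s : seq (plane R)) (x0 : plane R) : x0 \in s ->
  exists2 x, x \in s & forall y, y \in s -> f x <= f y.
Proof.
elim: s x0 => // a s IH x0 _; have [->|[b bs]] : s = [::] \/ exists b, b \in s.
- by case: (s) => [|b s']; [left|right; exists b; rewrite mem_head].
- by exists a; rewrite ?mem_head// => y; rewrite inE => /eqP ->.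
have [x xs hx] := IH b bs; have [h|h] := leP (f a) (f x).
- exists a; rewrite ?mem_head// => y; rewrite inE => /orP[/eqP -> //|/hx].
  exact: le_trans.
- exists x; rewrite ?inE ?xs ?orbT// => y; rewrite inE => /orP[/eqP ->|/hx//].
  exact: ltW.
Qed.

Lemma snear_anc p : p <> origin -> unique_nearest p -> snear N p (anc p).
Proof.
move=> p0 up; have np := enorm_gt0 p0.
have /finite_seqP[s sE] := Nfin (enorm p).
have mem z : (z \in s) <-> (N z /\ enorm z < enorm p).
  have -> : (z \in s) <-> [set` s] z by [].
  by rewrite -sE.
have os : origin \in s by apply/mem; rewrite enorm0.
have [A As hA] := seq_argmin (fun z => enorm (p - z)) os.
have [NA Ap] := (mem A).1 As.
suff h : snear N p A by rewrite (anc_snear h).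
split=> // z Nz zp zA; rewrite lt_neqAle hA ?andbT; last exact/mem.
by apply/eqP => e; apply: zA; apply/esym/up.
Qed.

Hypothesis Nuniq : forall X, N X -> X <> origin -> unique_nearest X.

Lemma snear_ancN X : N X -> X <> origin -> snear N X (anc X).
Proof. by move=> NX X0; apply: snear_anc => //; exact: Nuniq. Qed.

Lemma N_anc X : N X -> N (anc X).
Proof.
move=> NX; have [->|/eqP X0] := eqVneq X origin; first by rewrite anc_origin.
by case: (snear_ancN NX X0).
Qed.

Lemma N_iter_anc k X : N X -> N (iter k anc X).
Proof. by move=> NX; elim: k => //= k; exact: N_anc. Qed.

Lemma enorm_anc_lt X : N X -> X <> origin -> enorm (anc X) < enorm X.
Proof. by move=> NX X0; case: (snear_ancN NX X0). Qed.

Lemma enorm_anc_le X : N X -> enorm (anc X) <= enorm X.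
Proof.
move=> NX; have [->|/eqP X0] := eqVneq X origin; first by rewrite anc_origin.
exact/ltW/enorm_anc_lt.
Qed.

Lemma enorm_iter_anc_le k X : N X -> enorm (iter k anc X) <= enorm X.
Proof.
move=> NX; elim: k => //= k; apply: le_trans.
by apply: enorm_anc_le; exact: N_iter_anc.
Qed.

Lemma ancestor_anc X Y : ancestor N X Y <-> [/\ N X, X <> origin & anc X = Y].
Proof.
split=> [[NX X0 [[NY +] hY]]|[NX X0 <-]].
  rewrite /eball/= enorm_sub0 => YX; split => //.
  apply: anc_snear; split => // z Nz zX zY; rewrite lt_neqAle hY ?andbT; last first.
    by split => //; rewrite /eball/= enorm_sub0.
  by apply/eqP => e; apply: zY; apply/esym/(@Nuniq X).
have [NA AX hA] := snear_ancN NX X0; split => //; split.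
  by split => //; rewrite /eball/= enorm_sub0.
move=> Z [NZ]; rewrite /eball/= enorm_sub0 => ZX.
by have [->|/eqP ZA] := eqVneq Z (anc X); [exact: lexx|exact/ltW/hA].
Qed.

Lemma finite_bound (s : seq (plane R)) (P : plane R -> nat -> Prop) :
  (forall x, x \in s -> exists m, forall l, (m <= l)%N -> P x l) ->
  exists m, forall x l, x \in s -> (m <= l)%N -> P x l.
Proof.
elim: s => [|a s IH] h; first by exists 0%N.
have [|m hm] := IH; first by move=> x xs; apply: h; rewrite inE xs orbT.
have [m' hm'] := h a (mem_head _ _).
exists (maxn m m') => x l; rewrite inE geq_max => /orP[/eqP ->|xs] /andP[h1 h2].
- exact: hm'.
- exact: hm.
Qed.

Lemma iter_anc_origin X : N X -> exists k, iter k anc X = origin.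
Proof.
move=> NX; have /finite_seqP[s sE] := Nfin (enorm X).
apply: contrapT => hk.
have k0 k : iter k anc X <> origin by move=> e; apply: hk; exists k.
have dec i j : (i < j)%N -> enorm (iter j anc X) < enorm (iter i anc X).
  elim: j => // j IH; rewrite ltnS leq_eqVlt => /orP[/eqP ->|/IH].
    by rewrite iterS enorm_anc_lt//; exact: N_iter_anc.
  by apply: lt_trans; rewrite iterS enorm_anc_lt//; exact: N_iter_anc.
have inj : injective (fun k => iter k.+1 anc X).
  move=> i j e; case: (ltngtP i j) => // h.
  - by have := @dec i.+1 j.+1 h; rewrite e ltxx.
  - by have := @dec j.+1 i.+1 h; rewrite e ltxx.
have sub : {subset [seq iter k.+1 anc X | k <- iota 0 (size s).+1] <= s}.
  move=> _ /mapP[k _ ->]; have -> : (iter k.+1 anc X \in s) = ([set` s] (iter k.+1 anc X)) :> Prop by [].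
  by rewrite -sE; split; [exact: N_iter_anc|exact: (@dec 0)].
have := uniq_leq_size _ sub; rewrite size_map size_iota ltnn => h.
by have := h _; rewrite map_inj_uniq// iota_uniq => /(_ isT).
Qed.

Definition tree_path (y : nat -> plane R) := y 0%N = origin /\
  forall n, [/\ N (y n.+1), y n.+1 <> origin & anc (y n.+1) = y n].

(** The origin has no ancestor, so the first edge goes up. A later edge going down would lead from y
    (n + 1) to its only ancestor y n, against injectivity. *)
Lemma semi_infinite_tree_path y : semi_infinite_path N y -> tree_path y.
Proof.
move=> [y0 yinj ye]; split => //; elim=> [|n IH].
  have [] := ye 0%N; first by rewrite y0 => -[].
  by move=> /ancestor_anc.
have [|/ancestor_anc//] := ye n.+1.
move=> /ancestor_anc[_ _ e]; case: IH => _ _; rewrite e => /yinj/eqP.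
by rewrite -[n.+2]addn2 -[X in _ == X]addn0 eqn_add2l.
Qed.

Section tree_path.
Variable y : nat -> plane R.
Hypothesis ty : tree_path y.

Lemma tree_path_N n : N (y n).
Proof. by case: n => [|n]; [rewrite ty.1|case: (ty.2 n)]. Qed.

Lemma tree_path_lt n : enorm (y n) < enorm (y n.+1).
Proof. by have [Ny yo <-] := ty.2 n; exact: enorm_anc_lt. Qed.

Lemma tree_path_homo : {homo y : i j / (i < j)%N >-> enorm i < enorm j}.
Proof. by apply: homo_ltn => [a b c|n]; [exact: lt_trans|exact: tree_path_lt]. Qed.

Lemma tree_path_inj : injective y.
Proof.
by move=> i j e; case: (ltngtP i j) => // /tree_path_homo; rewrite e ltxx.
Qed.

Lemma tree_path_semi_infinite : semi_infinite_path N y.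
Proof.
split; [exact: ty.1|exact: tree_path_inj|move=> n; right].
by apply/ancestor_anc; exact: ty.2.
Qed.

Lemma tree_path_iter j n : iter j anc (y (j + n)) = y n.
Proof. by elim: j => // j IH; rewrite iterSr addSn; case: (ty.2 (j + n)%N) => _ _ ->. Qed.

Lemma tree_path_unbounded (r : R) : exists m, forall n, (m <= n)%N -> r <= enorm (y n).
Proof.
apply: contrapT => h.
have small n : enorm (y n) < r.
  rewrite ltNge; apply/negP => rn; apply: h; exists n => m nm; apply: le_trans rn _.
  by move: nm; rewrite leq_eqVlt => /orP[/eqP -> //|/tree_path_homo/ltW].
have /finite_seqP[s sE] := Nfin r.
have sub : {subset [seq y k | k <- iota 0 (size s).+1] <= s}.
  move=> _ /mapP[k _ ->]; have -> : (y k \in s) = ([set` s] (y k)) :> Prop by [].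
  by rewrite -sE; split; [exact: tree_path_N|exact: small].
have := uniq_leq_size _ sub; rewrite size_map size_iota ltnn => h'.
have := h' _; rewrite map_inj_uniq ?iota_uniq => [/(_ isT)//|]; exact: tree_path_inj.
Qed.

End tree_path.

(** The index of a vertex is its number of generations from the origin, whatever the path. Hence two
    paths with a common sub-path share it at equal indices, and taking ancestors identifies them
    entirely. *)
Lemma tree_path_depth y z a b : tree_path y -> tree_path z -> y a = z b -> a = b.
Proof.
move=> ty tz; elim: a b => [|a IH] [|b] // e.
- by case: (tz.2 b) => _ + _; rewrite -e ty.1.
- by case: (ty.2 a) => _ + _; rewrite e tz.1.
congr S; apply: IH; have [_ _ <-] := ty.2 a; have [_ _ <-] := tz.2 b.
by rewrite e.
Qed.

Lemma same_tree_path y z : tree_path y -> tree_path z -> same_path y z -> y =1 z.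
Proof.
move=> ty tz [m [n h]].
have mn : m = n by apply: (tree_path_depth ty tz); have := h 0%N; rewrite !addn0.
move=> k; rewrite -(tree_path_iter ty m k) -(tree_path_iter tz m k).
by rewrite h mn.
Qed.

Definition converges_to (f : nat -> plane R) u := forall e : R, 0 < e ->
  exists m, forall n, (m <= n)%N -> enorm (f n - u) <= e.

Lemma asymptotic_directionP y u :
  asymptotic_direction y u <-> converges_to (fun n => direction (y n)) u.
Proof.
split=> [h e e0|h].
- have e2 : 0 < e / 2 by rewrite divr_gt0.
  have /= := h _ (nbhsx_ballx u (e / 2) e2).
  move=> [m _ hm]; exists m => n mn; have [/= h1 h2] := hm n mn.
  rewrite -/(direction (y n)) in h1 h2.
  have : enorm (direction (y n) - u) <= `|(direction (y n) - u).1| + `|(direction (y n) - u).2|.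
    rewrite -(@ler_pXn2r _ 2)// ?nnegrE ?enorm_ge0 ?addr_ge0//.
    rewrite sqr_enorm /dot -!expr2 -(real_normK (num_real (direction (y n) - u).1)).
    rewrite -(real_normK (num_real (direction (y n) - u).2)) sqrrD.
    by rewrite lerD2r lerDl mulrn_wge0// mulr_ge0.
  move: h1 h2; rewrite /ball/= /ball_/= => h1 h2; rewrite !(distrC _ (_ / _)) in h1 h2.
  move=> /le_trans; apply; lra.
- move=> A /nbhs_ballP[e /= e0 eA]; have [m hm] := h (e / 2) (divr_gt0 e0 (ltr0n _ 2)).
  exists m => // n /= mn; apply: eA; have {}hm := hm n mn.
  have lt2 : e / 2 < e by lra.
  have hx : `|(direction (y n) - u).1| <= enorm (direction (y n) - u).
    rewrite -(@ler_pXn2r _ 2)// ?nnegrE ?enorm_ge0// real_normK ?num_real//.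
    by rewrite sqr_enorm /dot -!expr2 lerDl sqr_ge0.
  have hy : `|(direction (y n) - u).2| <= enorm (direction (y n) - u).
    rewrite -(@ler_pXn2r _ 2)// ?nnegrE ?enorm_ge0// real_normK ?num_real//.
    by rewrite sqr_enorm /dot -!expr2 lerDr sqr_ge0.
  split; rewrite /ball/= /ball_/= distrC.
  + exact: le_lt_trans (le_trans hx hm) lt2.
  + exact: le_lt_trans (le_trans hy hm) lt2.
Qed.

Lemma converges_to_unique f u v : converges_to f u -> converges_to f v -> u = v.
Proof.
move=> hu hv; apply: enorm_sub_eq0; apply/eqP; rewrite eq_le enorm_ge0 andbT.
apply/ler_addgt0Pl => e e0; rewrite addr0.
have [m hm] := hu (e / 2) (divr_gt0 e0 (ltr0n _ 2)).
have [m' hm'] := hv (e / 2) (divr_gt0 e0 (ltr0n _ 2)).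
have h1 := hm (maxn m m') (leq_maxl _ _); have h2 := hm' (maxn m m') (leq_maxr _ _).
have := enorm_triangle (f (maxn m m')) u v; rewrite (enormN _ (f _)) => h3.
lra.
Qed.

(* The descendants of a far away vertex lie in a narrow cone around it. *)
Hypothesis straight : forall e : R, 0 < e -> exists rho, forall X k, N X ->
  rho <= enorm (iter k anc X) -> enorm (direction X - direction (iter k anc X)) <= e.
Hypothesis finite_children : forall X, N X ->
  finite_set [set Y | [/\ N Y, Y <> origin & anc Y = X]].
Hypothesis dense_directions : forall u, unit_circle u -> exists Z : nat -> plane R,
  [/\ forall l, N (Z l), forall l, l%:R <= enorm (Z l) &
      converges_to (fun l => direction (Z l)) u].

Lemma tree_path_direction y : tree_path y ->
  exists2 u, unit_circle u & converges_to (fun n => direction (y n)) u.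
Proof.
move=> ty.
have cau e : 0 < e -> exists m, forall n, (m <= n)%N ->
    enorm (direction (y n) - direction (y m)) <= e.
  move=> e0; have [rho hrho] := straight e0; have [m hm] := tree_path_unbounded ty rho.
  exists m => n mn; have := hrho (y n) (n - m)%N (tree_path_N ty n).
  have -> : iter (n - m) anc (y n) = y m by rewrite -{2}(subnK mn) tree_path_iter.
  by apply; exact: hm.
have coord (pr : plane R -> R) : (forall p, `|pr p| <= enorm p) ->
    (forall p v, pr (p - v) = pr p - pr v) -> cvgn (fun n => pr (direction (y n))).
  move=> prle prB; apply/cauchy_cvgP/cauchy_exP => e e0.
  have [m hm] := cau (e / 2) (divr_gt0 e0 (ltr0n _ 2)).
  exists (pr (direction (y m))); exists m => // n /= mn.
  rewrite /ball/= distrC -prB (le_lt_trans (prle _))// (le_lt_trans (hm n mn))//; lra.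
have hx p : `|p.1| <= enorm p.
  rewrite -(@ler_pXn2r _ 2)// ?nnegrE ?enorm_ge0// real_normK ?num_real//.
  by rewrite sqr_enorm /dot -!expr2 lerDl sqr_ge0.
have hy p : `|p.2| <= enorm p.
  rewrite -(@ler_pXn2r _ 2)// ?nnegrE ?enorm_ge0// real_normK ?num_real//.
  by rewrite sqr_enorm /dot -!expr2 lerDr sqr_ge0.
have c1 := coord fst hx (fun p v => erefl); have c2 := coord snd hy (fun p v => erefl).
pose u : plane R := (limn (fun n => (direction (y n)).1), limn (fun n => (direction (y n)).2)).
have yu : asymptotic_direction y u by exact: (cvg_pair c1 c2).
exists u; last exact/asymptotic_directionP.
rewrite /unit_circle/=; apply/eqP; rewrite -subr_eq0 -normr_eq0 eq_le normr_ge0 andbT.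
apply/ler_addgt0Pl => e e0; rewrite addr0.
move/asymptotic_directionP : yu => /(_ e e0)[m hm].
have h := hm m.+1 (leqnSn m).
have e1 : enorm (direction (y m.+1)) = 1 by apply: enorm_direction; case: (ty.2 m).
rewrite ler_norml; apply/andP; split.
- by have := enorm_le_sub (direction (y m.+1)) u; rewrite e1; lra.
- by have := enorm_le_sub u (direction (y m.+1)); rewrite e1 enormN; lra.
Qed.

(* König's lemma along the vertices with infinitely many descendants among Z. *)
Lemma konig (Z : nat -> plane R) u : (forall l, N (Z l)) -> (forall l, l%:R <= enorm (Z l)) ->
  converges_to (fun l => direction (Z l)) u ->
  exists y, [/\ tree_path y, converges_to (fun n => direction (y n)) u &
    forall n, exists l j, iter j anc (Z l) = y n].
Proof.
move=> NZ Zl Zu.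
pose good X := N X /\ forall m, exists2 l, (m <= l)%N & exists j, iter j anc (Z l) = X.
have good0 : good origin.
  by split => // m; exists m => //; exact: iter_anc_origin.
have next X : good X -> exists Y, good Y /\ (Y <> origin /\ anc Y = X).
  move=> [NX gX]; have /finite_seqP[s sE] := finite_children NX.
  apply: contrapT => nY.
  (* If every child of X had only finitely many descendants among the Z l, one bound m would serve
     for the finitely many children. *)
  have [m hm] : exists m, forall Y l, Y \in s -> (m <= l)%N -> ~ exists j, iter j anc (Z l) = Y.
    apply: finite_bound => Y Ys; have : [set` s] Y by []. rewrite -sE => -[NY Y0 YX].
    apply: contrapT => h; apply: nY; exists Y; split => //; split => // m.
    apply: contrapT => h'; apply: h; exists m => l ml [j e]; apply: h'.
    by exists l => //; exists j.
  (* Taking l above |X| forces Z l to differ from X. *)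
  have [l ml [j0 e0]] := gX (maxn m (Num.truncn (enorm X)).+1).
  have ex : exists j, iter j anc (Z l) == X by exists j0; rewrite e0.
  (* With the least number of generations, the iterate just before X is a genuine child; otherwise
     it could be the origin, which [anc] fixes. *)
  case: (ex_minnP ex) => [[|j]] /eqP e jmin.
    move: ml; rewrite geq_max => /andP[_ ml].
    have := Zl l; rewrite -[Z l]/(iter 0 anc (Z l)) e => h.
    have := truncnS_gt (enorm X); rewrite ltNge (le_trans _ h)// ler_nat//.
  apply: (hm (iter j anc (Z l)) l).
  - have -> : (iter j anc (Z l) \in s) = ([set` s] (iter j anc (Z l))) :> Prop by [].
    rewrite -sE; split => //; first exact: N_iter_anc.
    move=> eo; have := jmin j; rewrite eo -e iterS eo anc_origin eqxx ltnn => /(_ isT).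
    by [].
  - by move: ml; rewrite geq_max => /andP[].
  - by exists j.
pose nxt X := xget origin [set Y | good Y /\ (Y <> origin /\ anc Y = X)].
have nxtP X : good X -> good (nxt X) /\ (nxt X <> origin /\ anc (nxt X) = X).
  by move=> /next; exact: (@xgetPex _ origin [set Y | good Y /\ (Y <> origin /\ anc Y = X)]).
pose y n := iter n nxt origin.
have gy n : good (y n) by elim: n => // n IH; rewrite /y iterS; case: (nxtP _ IH).
have ty : tree_path y.
  split => // n; have [[Ny _] [yo yn]] := nxtP _ (gy n).
  by split => //; rewrite /y iterS.
exists y; split => //; last by move=> n; have [_ /(_ 0%N)[l _ [j h]]] := gy n; exists l, j.
(* Each y n has descendants Z l with l arbitrarily large; by straightness its direction is close to
   that of Z l, which is close to u. *)
move=> e e0; have e2 : 0 < e / 2 by rewrite divr_gt0.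
have [rho hrho] := straight e2; have [m hm] := tree_path_unbounded ty rho.
have [m' hm'] := Zu _ e2.
exists m => n mn; have [_ /(_ m')[l ml [j h]]] := gy n.
have := hrho (Z l) j (NZ l); rewrite h => /(_ (hm n mn)); rewrite enormN => h1.
have := hm' l ml => h2.
by have := enorm_triangle (direction (Z l)) (direction (y n)) u; lra.
Qed.

Lemma tree_path_exists u : unit_circle u ->
  exists2 y, tree_path y & converges_to (fun n => direction (y n)) u.
Proof.
by move=> /dense_directions[Z [NZ Zl Zu]]; have [y [ty yu _]] := konig NZ Zl Zu; exists y.
Qed.

Lemma polar_cvg (th : nat -> R) t (Z : nat -> plane R) : (forall l, `|th l - t| <= l.+1%:R^-1) ->
  (forall l, enorm (Z l - polar 1 (th l)) <= l.+1%:R^-1) ->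
  converges_to Z (polar 1 t).
Proof.
move=> h1 h2 e e0; exists (Num.truncn (2 / e)) => n hn.
have h : n.+1%:R^-1 <= e / 2.
  rewrite -[e / 2]invrK lef_pV2 ?posrE ?invr_gt0 ?divr_gt0// invf_div.
  by rewrite (le_trans (ltW (truncnS_gt _)))// ler_nat.
apply: (le_trans (enorm_triangle (polar 1 (th n)) _ _)); rewrite [leRHS]splitr lerD//.
  exact: le_trans (h2 n) h.
by apply: le_trans (enorm_polar_sub _ _) _; exact: le_trans (h1 n) h.
Qed.

(** * No arc of directions with unique paths *)

Section two_paths.
Variable I : set R.
Hypothesis unique_path : forall t y z, I t -> tree_path y -> tree_path z ->
  converges_to (fun n => direction (y n)) (polar 1 t) ->
  converges_to (fun n => direction (z n)) (polar 1 t) -> y =1 z.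

Let unit_polar t : unit_circle (polar 1 t : plane R).
Proof. by rewrite /unit_circle/= enorm_polar. Qed.

Let Y t : nat -> plane R := sval (cid2 (tree_path_exists (unit_polar t))).
Let tY t : tree_path (Y t). Proof. by rewrite /Y; case: cid2. Qed.
Let dY t : converges_to (fun n => direction (Y t n)) (polar 1 t).
Proof. by rewrite /Y; case: cid2. Qed.

(** Choose far vertices on the paths of directions th l. König's lemma yields from them a path of
    direction t, which is [Y t] by uniqueness at t, and its k-th vertex is also the k-th vertex of
    some [Y (th l)]. So the k-th vertex cannot change abruptly at t. *)
Lemma path_vertex_closed (th : nat -> R) t k (P : plane R -> Prop) : I t ->
  (forall l, `|th l - t| <= l.+1%:R^-1) -> (forall l, P (Y (th l) k)) -> P (Y t k).
Proof.
move=> It tht Pk.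
have far l : exists j, [/\ (k <= j)%N, l%:R <= enorm (Y (th l) j) &
    enorm (direction (Y (th l) j) - polar 1 (th l)) <= l.+1%:R^-1].
  have [m hm] := tree_path_unbounded (tY (th l)) l%:R.
  have l0 : 0 < l.+1%:R^-1 :> R by rewrite invr_gt0 ltr0n.
  have [m' hm'] := @dY (th l) _ l0.
  exists (maxn k (maxn m m')); split; first exact: leq_maxl.
  - by apply: hm; rewrite !leq_max leqnn/= orbT.
  - by apply: hm'; rewrite !leq_max leqnn !orbT.
pose J l := sval (cid (far l)).
have [J1 J2 J3] : [/\ forall l, (k <= J l)%N, forall l, l%:R <= enorm (Y (th l) (J l)) &
    forall l, enorm (direction (Y (th l) (J l)) - polar 1 (th l)) <= l.+1%:R^-1].
  by split => l; rewrite /J; case: cid => j [].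
have [y [ty yt yZ]] := @konig (fun l => Y (th l) (J l)) (polar 1 t)
  (fun l => tree_path_N (tY _) _) J2 (polar_cvg tht J3).
rewrite -(unique_path It ty (tY t) yt (@dY t)).
have [l [j e]] := yZ k.
suff -> : y k = Y (th l) k by [].
rewrite -e.
have [jJ|Jj] := leqP j (J l).
  have e' : iter j anc (Y (th l) (J l)) = Y (th l) (J l - j)%N.
    by rewrite -{1}(subnKC jJ) tree_path_iter.
  by rewrite e'; congr (Y _ _); apply: (tree_path_depth (tY (th l)) ty); rewrite -e' e.
(* With more than J l generations the iterate has already reached the origin and stays there. *)
have e' : iter j anc (Y (th l) (J l)) = Y (th l) 0.
  have h0 : iter (J l) anc (Y (th l) (J l)) = origin.
    by have := tree_path_iter (tY (th l)) (J l) 0; rewrite addn0 (tY (th l)).1.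
  rewrite -(subnK (ltnW Jj)) iterD h0 (tY (th l)).1.
  by elim: (j - J l)%N => //= i ->; exact: anc_origin.
by rewrite e'; congr (Y _ _); apply: (tree_path_depth (tY (th l)) ty); rewrite -e' e.
Qed.

(** Connectedness of the interval: let t be the supremum of the angles whose k-th vertex is that of
    t1. Approached from within the set, t belongs to it; approached from the right, it does not. The
    bound 1 on the length ensures that the two end directions differ. *)
Lemma no_unique_interval (t1 t2 : R) : t1 < t2 -> t2 - t1 < 1 ->
  ~ (forall t : R, t1 <= t <= t2 -> I t).
Proof.
move=> t12 t21 hI.
have [k nk] : exists k, Y t1 k <> Y t2 k.
  apply: contrapT => h.
  have {}h k : Y t1 k = Y t2 k by apply: contrapT => h'; apply: h; exists k.
  have d2 : converges_to (fun n => direction (Y t1 n)) (polar 1 t2).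
    by have -> : Y t1 = Y t2 by apply/funext.
  have e := converges_to_unique (@dY t1) d2.
  have : cross (polar 1 t1) (polar 1 t2) = 0 by rewrite e /cross mulrC subrr.
  rewrite cross_polar !mul1r => s0.
  have : 0 < sin (t2 - t1).
    by rewrite sin_gt0_pi// subr_gt0 t12/= (lt_le_trans t21)// (le_trans _ (pi_ge2 R))// ler1n.
  by rewrite s0 ltxx.
pose A := [set t | t1 <= t <= t2 /\ Y t k = Y t1 k].
have A1 : A t1 by split => //; rewrite lexx ltW.
have supA : has_sup A by split; [exists t1|exists t2 => t [/andP[]]].
pose t := sup A.
have tA (x : R) : A x -> x <= t by move=> Ax; apply: ub_le_sup => //; case: supA.
have t2t : t <= t2 by apply: ge_sup; [exists t1|move=> x [/andP[]]].
have tt : t1 <= t <= t2 by rewrite tA.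
have At : Y t k = Y t1 k.
  have ex l : exists x, A x /\ `|x - t| <= l.+1%:R^-1.
    have l0 : 0 < l.+1%:R^-1 :> R by rewrite invr_gt0.
    have [x Ax hx] := sup_adherent l0 supA; exists x; split => //.
    by rewrite ler_distl (ltW hx)/= (le_trans (tA x Ax))// lerDl (ltW l0).
  pose th l := sval (cid (ex l)).
  apply: (@path_vertex_closed th t k (fun X => X = Y t1 k)) (hI t tt) _ _ => l;
    rewrite /th; case: cid => x [[]] //.
have t_lt : t < t2.
  by rewrite lt_neqAle t2t andbT; apply/eqP => e; apply: nk; rewrite -e At.
have d0 : 0 < t2 - t by rewrite subr_gt0.
have d1 : t2 - t < 1 by case/andP: tt => *; lra.
(* Angles to the right of the supremum t, hence with another k-th vertex. *)
pose th l := t + (t2 - t) / l.+1%:R.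
have thl l : t < th l <= t2.
  rewrite /th ltrDl divr_gt0//= -lerBrDl ler_pdivrMr// ler_pMr// ler1n//.
apply: (@path_vertex_closed th t k (fun X => X <> Y t1 k)) (hI t tt) _ _ _ => // l.
  rewrite /th addrAC subrr add0r ger0_norm ?divr_ge0 ?(ltW d0)//.
  by rewrite -[leRHS]mul1r ler_wpM2r ?invr_ge0// ltW.
move=> e; have := thl l; rewrite ltNge tA//=; split => //.
by have /andP[h ->] := thl l; rewrite andbT (le_trans _ (ltW h))//; case/andP: tt.
Qed.

End two_paths.

Theorem tree_directions :
  [/\ forall y, semi_infinite_path N y ->
        exists2 u, unit_circle u & asymptotic_direction y u,
      forall u : plane R, unit_circle u ->
        exists2 y, semi_infinite_path N y & asymptotic_direction y u
    & unit_circle `<=`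
      closure [set u : plane R | unit_circle u /\
        exists y z : nat -> plane R,
          [/\ semi_infinite_path N y, semi_infinite_path N z,
              asymptotic_direction y u, asymptotic_direction z u
            & ~ same_path y z]]].
Proof.
split=> [y /semi_infinite_tree_path /tree_path_direction[u u1 yu]|u /tree_path_exists[y ty yu]|].
- by exists u => //; exact/asymptotic_directionP.
- by exists y; [exact: tree_path_semi_infinite|exact/asymptotic_directionP].
move=> u u1 B /nbhs_ballP[e /= e0 eB]; apply: contrapT => hB.
have [t0 ut] := polar_exists_acos u; rewrite (u1 : enorm u = 1) in ut.
pose I := [set t : R | B (polar 1 t)].
have /no_unique_interval : forall t y z, I t -> tree_path y -> tree_path z ->
    converges_to (fun n => direction (y n)) (polar 1 t) ->
    converges_to (fun n => direction (z n)) (polar 1 t) -> y =1 z.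
  move=> t y z It ty tz yt zt; apply: same_tree_path => //.
  apply: contrapT => nyz; apply: hB; exists (polar 1 t); split => //.
  split; first by rewrite /unit_circle/= enorm_polar.
  by exists y, z; split => //; [exact: tree_path_semi_infinite..|exact/asymptotic_directionP|exact/asymptotic_directionP].
pose d := Num.min (e / 2) (1 / 2).
have d0 : 0 < d by rewrite lt_min !divr_gt0.
have de : d < e by rewrite gt_min (_ : e / 2 < e)//; lra.
have d1 : d < 1 by rewrite gt_min (_ : 1 / 2 < 1) ?orbT//; lra.
move=> /(_ t0 (t0 + d)); rewrite ltrDl addrAC subrr add0r => /(_ d0 d1); apply.
move=> t /andP[h1 h2]; apply: eB.
have := enorm_polar_sub t t0; rewrite -ut => h.
have h' : enorm (polar 1 t - u) < e.
  by rewrite (le_lt_trans h)// ger0_norm ?subr_ge0// (le_lt_trans _ de)// lerBlDl.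
split; rewrite /ball/= /ball_/= distrC; apply: le_lt_trans h';
  rewrite -(@ler_pXn2r _ 2)// ?nnegrE ?enorm_ge0// real_normK ?num_real//.
- by rewrite sqr_enorm /dot -!expr2 lerDl sqr_ge0.
- by rewrite sqr_enorm /dot -!expr2 lerDr sqr_ge0.
Qed.

End Tree.

(** * Paths in an annulus *)

Section Annulus.
Context {R : realType}.
Implicit Types (X Y Z p q u v z : plane R).
Variable N : set (plane R).
Hypothesis N0 : N origin.
Hypothesis Nfin : forall r : R, finite_set (N `&` [set z | enorm z < r]).
Hypothesis Nuniq : forall X, N X -> X <> origin -> unique_nearest N X.
Hypothesis Ninj : forall X Y, N X -> N Y -> enorm X = enorm Y -> X = Y.
Local Notation anc := (anc N).
Local Notation iterA k := (iter k anc).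

Definition generic p := snear N p (anc p).

Lemma generic_N X : N X -> X <> origin -> generic X.
Proof. exact: snear_ancN. Qed.

Lemma generic_N_anc p : generic p -> N (anc p).
Proof. by case. Qed.

Lemma generic_lt p : generic p -> enorm (anc p) < enorm p.
Proof. by case. Qed.

Lemma generic_iter p k : generic p -> (forall i, (i <= k)%N -> 0 < enorm (iterA i p)) ->
  generic (iterA k p).
Proof.
case: k => // k gp h; apply: generic_N.
  by rewrite iterSr; apply: N_iter_anc => //; exact: generic_N_anc.
by move=> e; have := h k.+1 (leqnn _); rewrite e enorm0 ltxx.
Qed.

Lemma enorm_iter_lt p i j : generic p -> (i < j)%N ->
  (forall l, (l < j)%N -> 0 < enorm (iterA l p)) -> enorm (iterA j p) < enorm (iterA i p).
Proof.
move=> gp; elim: j => // j IH; rewrite ltnS leq_eqVlt => ij h.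
have hj : enorm (iterA j.+1 p) < enorm (iterA j p).
  by apply/generic_lt/generic_iter => // l lj; apply: h.
move: ij => /orP[/eqP -> //|ij]; apply: lt_trans hj (IH ij _).
by move=> l lj; apply: h; rewrite ltnS ltnW.
Qed.

Definition below p (r : R) k := (forall i, (i <= k)%N -> r <= enorm (iterA i p)) /\
  enorm (iterA k.+1 p) < r.

(** The chosen position lies on the edge that leaves the last vertex of norm at least r, at its
    first point on the circle. *)
Definition at_level p (r : R) q := exists2 k, below p r k &
  q = pos (iterA k p) (iterA k.+1 p) r.

Lemma at_level_exists p (r : R) : generic p -> 0 < r <= enorm p -> exists q, at_level p r q.
Proof.
move=> gp /andP[r0 rp].
have ex : exists k, enorm (iterA k p) < r.
  have [k hk] := iter_anc_origin N0 Nfin Nuniq (generic_N_anc gp).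
  by exists k.+1; rewrite iterSr hk enorm0.
case: (ex_minnP ex) => [[|k]] kr kmin.
  by move: rp; rewrite leNgt /= in kr *; rewrite kr.
exists (pos (iterA k p) (iterA k.+1 p) r); exists k => //; split => // i ik.
by rewrite leNgt; apply/negP => /kmin; rewrite leqNgt ltnS ik.
Qed.

Lemma at_level_generic p (r : R) q : generic p -> 0 < r -> at_level p r q ->
  [/\ generic q, enorm q = r & exists k, below p r k /\ anc q = iterA k.+1 p].
Proof.
move=> gp r0 [k [rk kr] ->].
have gk : generic (iterA k p).
  by apply: generic_iter => // i ik; apply: lt_le_trans (rk i ik).
have e : enorm (pos (iterA k p) (iterA k.+1 p) r) = r.
  by rewrite enorm_pos ?ltW//; exact: generic_lt.
have s : snear N (pos (iterA k p) (iterA k.+1 p) r) (iterA k.+1 p).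
  apply: snear_seg => //; last by rewrite -/(pos _ _ _) e.
  by apply: tau_itv; [exact: generic_lt|rewrite ltW//= rk].
by split => //; [rewrite /generic (anc_snear s)|exists k; rewrite (anc_snear s)].
Qed.

(** The position on the circle of radius r has the same ancestor as the vertex above it, so stopping
    there does not alter the rest of the path. *)
Lemma at_level_trans p (r r' : R) q q' : generic p -> 0 < r' <= r -> at_level p r q ->
  at_level p r' q' -> at_level q r' q'.
Proof.
move=> gp /andP[r'0 r'r] [k [rk kr] ->] [k' [rk' kr'] ->].
have r0 : 0 < r by apply: lt_le_trans r'r.
have hq : at_level p r (pos (iterA k p) (iterA k.+1 p) r) by exists k.
have [gq nq [k2 [[rk2 k2r] _]]] := at_level_generic gp r0 hq.
have gk : generic (iterA k p).
  by apply: generic_iter => // i ik; apply: lt_le_trans (rk i ik).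
have aq : anc (pos (iterA k p) (iterA k.+1 p) r) = iterA k.+1 p.
  apply: anc_snear; apply: snear_seg => //.
    by apply: tau_itv; [exact: generic_lt|rewrite ltW//= rk].
  by rewrite -/(pos _ _ _) nq.
set q0 := pos (iterA k p) (iterA k.+1 p) r in hq gq nq aq *.
have it i : iterA i.+1 q0 = iterA (i + k).+1 p by rewrite iterSr aq -iterD addnS.
have kk' : (k <= k')%N.
  by rewrite leqNgt; apply/negP => /rk h; move: kr'; rewrite ltNge (le_trans r'r h).
exists (k' - k)%N.
- split=> [[|i] ik|]; first by rewrite nq.
  + rewrite it; apply: rk'; move: ik; rewrite -ltnS -subSn// ltn_subRL addnC => ik.
    by rewrite -ltnS.
  + by rewrite it subnK.
case: (ltngtP k k') kk' => // [kk' _|kE _].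
  by rewrite it subnK ?(ltnW kk')//; case: k' rk' kr' kk' => // k' *;
    rewrite subSn// it subnK.
by rewrite -kE subnn /= /q0 aq pos_pos ?rk// kE.
Qed.

Lemma cone_near u z : 0 < enorm u -> enorm (z - u) <= enorm u / 3 -> cone u z.
Proof.
move=> u0 h.
have c1 : `|cross u z| <= enorm u * (enorm u / 3).
  have -> : cross u z = cross u (z - u) by rewrite /cross/=; ring.
  by rewrite (le_trans (norm_cross_le _ _))// ler_pM2l.
have d1 : enorm u * (enorm u / 3) < dot u z.
  have -> : dot u z = enorm u ^+ 2 - dot u (u - z) by rewrite sqr_enorm /dot/=; ring.
  have h2 : dot u (u - z) <= enorm u * (enorm u / 3).
    by rewrite (le_trans (dot_le _ _))// enormN ler_pM2l.
  have : 0 < enorm u * enorm u by rewrite mulr_gt0.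
  rewrite expr2; lra.
exact: le_lt_trans c1 d1.
Qed.

Lemma enorm_seg_sub p a v (t d : R) : 0 <= t <= 1 -> enorm (p - v) <= d -> enorm (a - v) <= d ->
  enorm (seg p a t - v) <= d.
Proof.
move=> /andP[t0 t1] h1 h2.
have -> : seg p a t - v = (t * (p - v).1, t * (p - v).2) + ((1 - t) * (a - v).1, (1 - t) * (a - v).2).
  by rewrite /seg; apply/eqP; rewrite xpair_eqE /=; apply/andP; split; apply/eqP; ring.
have nZ (c : R) x : 0 <= c -> enorm (c * x.1, c * x.2) = c * enorm x.
  by move=> c0; rewrite enormZ ger0_norm.
rewrite (le_trans (enormD_le _ _))// (nZ t (p - v))// (nZ (1 - t) (a - v)) ?subr_ge0//.
have : t * enorm (p - v) <= t * d by rewrite ler_wpM2l.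
have : (1 - t) * enorm (a - v) <= (1 - t) * d by rewrite ler_wpM2l// subr_ge0.
lra.
Qed.

Variables (rin rout W eta : R) (K : nat).
Hypothesis rin0 : 0 < rin.
Hypothesis W0 : 0 < W.
Hypothesis eta0 : 0 < eta.
Hypothesis dense : forall p, rin <= enorm p <= rout ->
  exists z, [/\ N z, enorm z < enorm p & enorm (p - z) <= W].
Hypothesis sparse : forall v : nat -> plane R, (forall i, (i <= K)%N -> N (v i)) ->
  (forall i j, (i < j <= K)%N -> enorm (v j) < enorm (v i)) ->
  (forall i, (i < K)%N -> enorm (v i - v i.+1) <= W) -> rin <= enorm (v K) ->
  enorm (v 0%N) <= rout -> enorm (v 0%N) - enorm (v K) <= eta -> False.

Lemma generic_step p : generic p -> rin <= enorm p <= rout -> enorm (p - anc p) <= W.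
Proof.
move=> [_ _ h] hp; have [z [Nz zp zW]] := dense hp.
have [<- //|/eqP za] := eqVneq z (anc p).
exact: le_trans (ltW (h z Nz zp za)) zW.
Qed.

(* A path that descends by D makes at most (D / eta + 1) (K + 1) steps. *)
Definition kap (D : R) := ((D / eta + 1) * K.+1%:R + 1) * W.

Lemma kapE D : kap D = ((D / eta + 1) * K.+1%:R + 1) * W. Proof. by []. Qed.

Section lateral.
Variables (p : plane R) (k : nat) (D : R).
Hypothesis gp : generic p.
Hypothesis pk : forall i, (i <= k)%N -> rin <= enorm (iterA i p).
Hypothesis prout : enorm p <= rout.
Hypothesis pD : enorm p - enorm (iterA k p) <= D.

Let gen i : (i <= k)%N -> generic (iterA i p).
Proof. by move=> ik; apply: generic_iter => // l li; apply: lt_le_trans (pk _) => //; exact: leq_trans ik. Qed.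

Let dec i j : (i <= j <= k)%N -> enorm (iterA j p) <= enorm (iterA i p).
Proof.
move=> /andP[+ jk]; rewrite leq_eqVlt => /orP[/eqP -> //|ij].
by apply/ltW/enorm_iter_lt => // l lj; apply: lt_le_trans (pk _) => //; exact: ltnW (leq_trans lj jk).
Qed.

Let top i : (i <= k)%N -> enorm (iterA i p) <= rout.
Proof. by move=> ik; apply: le_trans prout; apply: (@dec 0 i). Qed.

Let stepW i : (i <= k)%N -> enorm (iterA i p - iterA i.+1 p) <= W.
Proof. by move=> ik; apply: generic_step; [exact: gen|rewrite pk// top]. Qed.

Let descent (q : nat) : (q * K.+1 <= k)%N -> q%:R * eta <= enorm p - enorm (iterA (q * K.+1) p).
Proof.
elim: q => [|q IH] hq; first by rewrite mul0r mul0n subrr.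
have hq' : (q * K.+1 <= k)%N by apply: leq_trans hq; rewrite leq_mul2r leqnSn orbT.
suff : eta <= enorm (iterA (q * K.+1) p) - enorm (iterA (q.+1 * K.+1) p).
  by have := IH hq'; rewrite -natr1 mulrDl mul1r; lra.
rewrite leNgt; apply/negP => small.
have e : (q.+1 * K.+1 = (q * K.+1 + K).+1)%N by rewrite mulSn addnC addnS.
(* The K + 1 points start one generation below the beginning of the group of K + 1 steps, since p
   itself need not belong to [N]. *)
apply: (@sparse (fun i => iterA (q * K.+1 + i).+1 p)).
- by move=> i _; rewrite iterSr; apply: N_iter_anc => //; exact: generic_N_anc.
- move=> i j /andP[ij jK]; apply: enorm_iter_lt => //; first by rewrite ltnS ltn_add2l.
  move=> l lj; apply: lt_le_trans (pk _) => //; apply: leq_trans hq; rewrite e.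
  by rewrite (leq_trans (ltnW lj))// ltnS leq_add2l.
- move=> i iK; rewrite addnS; apply: stepW; apply: leq_trans hq; rewrite e.
  by rewrite ltnS leq_add2l ltnW.
- by apply: pk; rewrite -e.
- by apply: top; apply: leq_trans hq; rewrite e ltnS leq_add2l.
- rewrite -e addn0; apply: le_trans (ltW small); rewrite lerD2r.
  by apply: dec; rewrite leqnSn/= (leq_trans _ hq)// e ltnS leq_addr.
Qed.

Lemma lateral i : (i <= k.+1)%N -> enorm (p - iterA i p) <= kap D.
Proof.
move=> ik; apply: (@le_trans _ _ (i%:R * W)).
  elim: i ik => [|i IH] ik; first by rewrite subrr enorm0 mul0r.
  have := enorm_triangle (iterA i p) p (iterA i.+1 p).
  have := IH (ltnW ik); have := stepW ik; rewrite -natr1 mulrDl mul1r; lra.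
rewrite /kap ler_pM2r//.
apply: (@le_trans _ _ k.+1%:R); first by rewrite ler_nat.
rewrite -natr1 lerD2r.
have h := descent (leq_trunc_div k K.+1).
have hD : (k %/ K.+1)%:R <= D / eta.
  rewrite ler_pdivlMr//; apply: (le_trans h); apply: le_trans pD; rewrite lerD2l lerN2.
  by apply: dec; rewrite leq_trunc_div leqnn.
apply: (@le_trans _ _ ((k %/ K.+1).+1 * K.+1)%:R).
  by rewrite ler_nat ltnW// ltn_ceil.
by rewrite natrM ler_wpM2r// -natr1 lerD2r.
Qed.

End lateral.

Lemma kap_ge0 (D : R) : 0 <= D -> 0 <= kap D.
Proof.
by move=> D0; rewrite /kap mulr_ge0 ?(ltW W0)// addr_ge0// mulr_ge0// addr_ge0// divr_ge0// ltW.
Qed.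

Lemma lateral_level p (r : R) k (D : R) : generic p -> below p r k -> rin <= r -> enorm p <= rout ->
  enorm p - r <= D -> forall i, (i <= k.+1)%N -> enorm (p - iterA i p) <= kap D.
Proof.
move=> gp [rk kr] rr pr pD i ik; apply: (@lateral p k) => //.
- by move=> j jk; apply: le_trans (rk _ jk).
- by apply: le_trans pD; rewrite lerD2l lerN2 rk.
Qed.

Lemma pos_itv p (r : R) k : generic p -> below p r k -> 0 < r ->
  0 <= tau (iterA k p) (iterA k.+1 p) r <= 1.
Proof.
move=> gp [rk kr] r0; apply: tau_itv; last by rewrite ltW//= rk.
by apply/generic_lt/generic_iter => // i ik; apply: lt_le_trans (rk i ik).
Qed.

Lemma at_level_near p (r : R) q (D : R) : generic p -> at_level p r q -> rin <= r -> enorm p <= rout ->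
  enorm p - r <= D -> enorm (p - q) <= kap D.
Proof.
move=> gp [k bk ->] rr pr pD; rewrite enormN; apply: enorm_seg_sub.
- by apply: pos_itv => //; exact: lt_le_trans rr.
- by rewrite enormN; apply: (lateral_level gp bk).
- by rewrite enormN; apply: (lateral_level gp bk).
Qed.

Lemma at_level_flow p (r : R) q u : generic p -> at_level p r q -> 0 < r -> 0 < enorm u ->
  (forall k i, below p r k -> (i <= k.+1)%N -> enorm (iterA i p - u) <= enorm u / 3) ->
  exists k, flow N u r k p q.
Proof.
move=> gp [k bk ->] r0 u0 h; exists k.
have {}h i : (i <= k.+1)%N -> cone u (iterA i p).
  by move=> ik; apply: cone_near => //; exact: h ik.
elim: k p gp bk h => [|k IH] p gp [rk kr] h.
  apply: flow_stop => //; [exact: (rk 0)|exact: (h 0)|exact: (h 1)].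
have e i : iterA i.+1 p = iterA i (anc p) by rewrite iterSr.
suff hf : flow N u r k (anc p) (pos (iterA k.+1 p) (iterA k.+2 p) r).
  exact: (flow_step gp (rk 1%N isT) (h 0%N isT) (h 1%N isT) hf).
rewrite !e; apply: IH.
- apply: generic_N; first exact: generic_N_anc.
  by move=> o; have := rk 1%N isT; rewrite /= o enorm0 leNgt r0.
- by split => [i ik|]; rewrite -e//; apply: rk.
- by move=> i ik; rewrite -e; apply: h.
Qed.

(** Planarity in terms of angles. The bound on [kap D] keeps both paths within a third of |u| of the
    first starting point u, hence in its cone. Reversed arrival angles would differ by at most 1 <
    pi, so their sine would contradict the sign of the cross product. *)
Lemma polar_order (s r t1 t2 : R) p' q' (t1' t2' D : R) :
  generic (polar s t1) -> generic (polar s t2) -> t1 <= t2 <= t1 + 1 / 8 ->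
  rin <= r -> r <= s -> s <= rout -> s - r <= D -> kap D <= rin / 16 ->
  at_level (polar s t1) r p' -> at_level (polar s t2) r q' ->
  p' = polar r t1' -> q' = polar r t2' -> `|t1' - t1| <= 1 / 2 -> `|t2' - t2| <= 1 / 2 ->
  t1' <= t2'.
Proof.
move=> g1 g2 /andP[t12 t21] rr rs sr sD kD l1 l2 e1 e2 n1 n2.
have r0 : 0 < r by apply: lt_le_trans rr.
have s0 : 0 < s by apply: lt_le_trans rs.
have ns t : enorm (polar s t) = s by rewrite enorm_polar// ltW.
have ks : kap D <= s / 16 by lra.
have u0 : 0 < enorm (polar s t1) by rewrite ns.
have [k1 f1] : exists k, flow N (polar s t1) r k (polar s t1) p'.
  apply: at_level_flow => // k i bk ik; rewrite enormN ns.
  have := lateral_level g1 bk rr; rewrite ns => /(_ _ sr sD i ik); lra.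
have d12 : enorm (polar s t1 - polar s t2) <= s / 8.
  have -> : polar s t1 - polar s t2 = (s * (polar 1 t1 - polar 1 t2).1, s * (polar 1 t1 - polar 1 t2).2).
    by rewrite /polar; apply/eqP; rewrite xpair_eqE /=; apply/andP; split; apply/eqP; ring.
  have nZ (c : R) x : 0 <= c -> enorm (c * x.1, c * x.2) = c * enorm x.
    by move=> c0; rewrite enormZ ger0_norm.
  rewrite (nZ s (_ - _)) ?(ltW s0)// ler_pM2l//.
  rewrite (le_trans (enorm_polar_sub _ _))// ler_norml; apply/andP; split; lra.
have [k2 f2] : exists k, flow N (polar s t1) r k (polar s t2) q'.
  apply: at_level_flow => // k i bk ik; rewrite ns.
  have := lateral_level g2 bk rr; rewrite ns => /(_ _ sr sD i ik) h.
  have := enorm_triangle (polar s t2) (iterA i (polar s t2)) (polar s t1).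
  by move: h d12; rewrite enormN (enormN (polar s t1)) => h d12 h3; lra.
have c12 : 0 <= cross (polar s t1) (polar s t2).
  rewrite cross_polar mulr_ge0 ?mulr_ge0 ?(ltW s0)// sin_ge0_pi// subr_ge0 t12/=.
  have := pi_ge2 R; lra.
have := flow_cross_ge0 Ninj f1 f2; rewrite !ns => /(_ erefl c12).
rewrite e1 e2 cross_polar => h; rewrite leNgt; apply/negP => lt'.
have : 0 < sin (t1' - t2').
  rewrite sin_gt0_pi// subr_gt0 lt'/=; have := pi_ge2 R.
  by move: n1 n2; rewrite !ler_norml => /andP[_ n1] /andP[n2 _]; lra.
have -> : t1' - t2' = - (t2' - t1') by rewrite opprB.
by rewrite sinN oppr_gt0 ltNge -(pmulr_rge0 _ (mulr_gt0 r0 r0)) h.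
Qed.

Lemma at_level_self p q : generic p -> 0 < enorm p -> at_level p (enorm p) q -> q = p.
Proof.
move=> gp p0 [[|k] [rk kr] ->]; first by rewrite pos_top//; exact: generic_lt.
have := @enorm_iter_lt p 0 k.+1 gp isT; rewrite /= ltNge (rk k.+1)// => h.
suff : false by []; apply: h => l lk; apply: lt_le_trans p0 (rk l _); exact: ltnW.
Qed.

Lemma at_level_polar p (r D : R) q t : generic p -> p = polar (enorm p) t ->
  at_level p r q -> rin <= r -> r <= enorm p -> enorm p <= rout -> enorm p - r <= D ->
  kap D <= rin / 16 ->
  exists2 t', q = polar r t' & `|t' - t| <= 1 / 4.
Proof.
move=> gp pt lq rr rp pr pD kD.
have r0 : 0 < r by apply: lt_le_trans rr.
have p0 : 0 < enorm p by apply: lt_le_trans rp.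
have [_ nq _] := at_level_generic gp r0 lq.
have near := at_level_near gp lq rr pr pD.
have qp : enorm (q - polar (enorm p) t) <= kap D by rewrite -pt enormN.
have [|t' qt h] := polar_near p0 qp; first lra.
exists t'; first by rewrite {1}qt nq.
by apply: (le_trans h); rewrite ler_pdivrMr//; lra.
Qed.

(* The path started at angle i delta on the circle of radius r j reaches the next circle
   between the angles lo j i delta and up j i delta. *)
Variables (M delta : R) (r : nat -> R) (J : nat) (up lo : nat -> int -> int).
Hypothesis M0 : 0 < M.
Hypothesis delta0 : 0 < delta.
Hypothesis rS : forall j, r j.+1 = r j - M.
Hypothesis rinJ : rin + W <= r J.
Hypothesis rout0 : r 0%N <= rout.
Hypothesis kapM : kap M <= rin / 16.
Let start j i := polar (r j) (i%:~R * delta).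
Hypothesis generic_start : forall j i, (j < J)%N -> generic (start j i).
Hypothesis start_bounds : forall j i q, (j < J)%N -> at_level (start j i) (r j.+1) q ->
  exists t, [/\ q = polar (r j.+1) t, `|t - i%:~R * delta| <= 1 / 4,
    (lo j i)%:~R * delta <= t & t <= (up j i)%:~R * delta].

Fixpoint chain (f : nat -> int -> int) j n i :=
  if n is n'.+1 then f (j + n')%N (chain f j n' i) else i.

Let r_le i j : (i <= j)%N -> r j <= r i.
Proof.
elim: j => [|j IH]; first by case: i.
rewrite leq_eqVlt => /orP[/eqP -> //|/IH]; apply: le_trans.
by rewrite rS gerBl ltW.
Qed.

Let rSB j : r j - r j.+1 = M. Proof. by rewrite rS opprB addrC subrK. Qed.

Let rin_le j : (j <= J)%N -> rin <= r j. Proof. by move=> /r_le; have := rinJ; have := W0; lra. Qed.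

Let r_gt0 j : (j <= J)%N -> 0 < r j. Proof. by move=> /rin_le; exact: lt_le_trans. Qed.

Let r_rout j : r j <= rout.
Proof. by apply: le_trans rout0; exact: r_le. Qed.

(* By planarity a path stays between the paths restarted, on every circle, at the neighbouring
   starting angles. *)
Lemma trapped j0 p t i n q : generic p -> p = polar (r j0) t ->
  i%:~R * delta <= t <= (i + 1)%:~R * delta -> (j0 + n <= J)%N ->
  (forall n', (n' <= n)%N -> ((chain up j0 n' (i + 1) - i)%:~R * delta <= 1 / 16)
     /\ ((i - chain lo j0 n' i)%:~R * delta <= 1 / 16)) ->
  at_level p (r (j0 + n)) q -> exists2 t', q = polar (r (j0 + n)) t' &
  (chain lo j0 n i)%:~R * delta <= t' <= (chain up j0 n (i + 1))%:~R * delta.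
Proof.
move=> gp pt ti; elim: n q => [|n IH] q nJ bnd lq.
  rewrite addn0 in nJ lq *; have np : enorm p = r j0 by rewrite pt enorm_polar// ltW// r_gt0.
  by exists t => //; rewrite -pt; apply: at_level_self => //; rewrite ?np// r_gt0.
rewrite addnS in nJ lq *; have nJ' := ltnW nJ.
have j0J : (j0 <= J)%N by apply: leq_trans nJ'; rewrite leq_addr.
have np : enorm p = r j0 by rewrite pt enorm_polar// ltW// r_gt0.
have [s lqs] : exists q, at_level p (r (j0 + n)) q.
  by apply: at_level_exists => //; rewrite np r_gt0//= r_le// leq_addr.
have [] := IH s nJ' _ lqs; first by move=> n' hn'; apply: bnd; exact: leq_trans hn' (leqnSn n).
move=> t' st' /andP[t1 t2].
have [gs ns _] := at_level_generic gp (r_gt0 nJ') lqs.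
have lqs' : at_level s (r (j0 + n).+1) q.
  by apply: at_level_trans lqs lq => //; rewrite r_gt0//= r_le.
have pol : s = polar (enorm s) t' by rewrite ns.
have [|||t'' qt'' near] := at_level_polar gs pol lqs' (rin_le nJ) _ _ _ kapM.
- by rewrite ns r_le.
- by rewrite ns.
- by rewrite ns rSB.
have near2 : `|t'' - t'| <= 1 / 2 by apply: (le_trans near); lra.
have [b1 b2] := bnd n (leqnSn n).
set a := chain lo j0 n i in t1 b2 *; set b := chain up j0 n (i + 1) in t2 b1 *.
(* Each bounding angle has moved by at most 1/16, so the path and its two neighbours start within
   the 1/8 allowed by [polar_order]. *)
have ab : b%:~R * delta <= a%:~R * delta + 1 / 8.
  by move: b1 b2; rewrite !intrB !mulrBl; lra.
exists t'' => //=; rewrite -/a -/b.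
have ex (c : int) : exists q', at_level (start (j0 + n) c) (r (j0 + n).+1) q'.
  apply: at_level_exists; first exact: generic_start.
  by rewrite r_gt0//= enorm_polar ?r_le// ltW// r_gt0.
apply/andP; split.
- have [qa la] := ex a; have [ta [qta na loa upa]] := start_bounds nJ la.
  apply: (le_trans loa); rewrite -/(start _ _) in la.
  apply: (polar_order (s := r (j0 + n)) (r := r (j0 + n).+1) (D := M) (t1 := a%:~R * delta) (t2 := t')
     (p' := qa) (q' := q)) => //; rewrite -?st' ?rSB ?r_le ?rin_le//.
  + exact: generic_start.
  + by rewrite t1/=; lra.
  + by apply: (le_trans na); lra.
- have [qb lb] := ex b; have [tb [qtb nb lob upb]] := start_bounds nJ lb.
  apply: le_trans upb.
  apply: (polar_order (s := r (j0 + n)) (r := r (j0 + n).+1) (D := M) (t1 := t') (t2 := b%:~R * delta)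
     (p' := q) (q' := qb)) => //; rewrite -?st' ?rSB ?r_le ?rin_le//.
  + exact: generic_start.
  + by rewrite t2/=; lra.
  + by apply: (le_trans nb); lra.
Qed.

(** The difference of the directions is (p - q) / |p| plus a multiple of q of norm ||q| - |p|| /
    |p|; each has norm at most |p - q| / s. *)
Lemma direction_lip p q (s : R) : 0 < s -> s <= enorm p -> s <= enorm q ->
  enorm (direction p - direction q) <= 2 * enorm (p - q) / s.
Proof.
move=> s0 sp sq.
have p0 : 0 < enorm p by apply: lt_le_trans sp.
have q0 : 0 < enorm q by apply: lt_le_trans sq.
set a := (enorm p)^-1; set b := (enorm q - enorm p) / (enorm p * enorm q).
have -> : direction p - direction q =
    (a * (p - q).1, a * (p - q).2) + (b * q.1, b * q.2).
  rewrite /direction /a /b; apply/eqP; rewrite xpair_eqE /=.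
  by apply/andP; split; apply/eqP; field; rewrite !gt_eqF.
have h : `|enorm q - enorm p| <= enorm (p - q).
  rewrite ler_norml; apply/andP; split; last first.
    by rewrite lerBlDl enormN enorm_le_sub.
  by rewrite lerNl opprB lerBlDl enorm_le_sub.
have e1 : enorm (a * (p - q).1, a * (p - q).2) <= enorm (p - q) / s.
  rewrite enormZ ger0_norm ?invr_ge0 ?enorm_ge0// mulrC ler_wpM2l ?enorm_ge0//.
  by rewrite lef_pV2.
have e2 : enorm (b * q.1, b * q.2) <= enorm (p - q) / s.
  rewrite enormZ /b normrM normfV (gtr0_norm (mulr_gt0 p0 q0)) invfM.
  have -> : `|enorm q - enorm p| * ((enorm p)^-1 / enorm q) * enorm q =
     `|enorm q - enorm p| * (enorm p)^-1 by field; rewrite !gt_eqF.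
  by rewrite ler_pM ?invr_ge0 ?enorm_ge0// lef_pV2.
apply: (le_trans (enormD_le _ _)).
have -> : 2 * enorm (p - q) / s = enorm (p - q) / s + enorm (p - q) / s by ring.
exact: lerD.
Qed.

Lemma at_level_iter p l (s : R) q : at_level (iterA l p) s q ->
  (forall i, (i < l)%N -> s <= enorm (iterA i p)) -> at_level p s q.
Proof.
move=> [k [sk ks] ->] h; exists (k + l)%N; last by rewrite -addSn !iterD.
split; last by rewrite -addSn iterD.
move=> i ik; have [il|li] := ltnP i l; first exact: h.
by rewrite -(subnK li) iterD; apply: sk; rewrite leq_subLR addnC.
Qed.

Variable e : R.
Hypothesis e16 : e <= 1 / 16.
Hypothesis chain_bounds : forall j n i, (j + n <= J)%N -> 0 <= i ->
  i%:~R * delta <= 2 * pi ->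
  (chain up j n (i + 1) - i)%:~R * delta <= e /\ (i - chain lo j n i)%:~R * delta <= e.

Lemma level_index p : r J <= enorm p -> enorm p < r 0%N ->
  exists j, [/\ (j <= J)%N, r j <= enorm p, enorm p - r j <= M &
    forall j', r j' <= enorm p -> (j <= j')%N].
Proof.
move=> pJ p0; have ex : exists j, r j <= enorm p by exists J.
case: (ex_minnP ex) => -[|j] jp jmin.
  by move: jp; rewrite leNgt p0.
exists j.+1; split => //; first exact: jmin.
have : enorm p < r j by rewrite ltNge; apply/negP => /jmin; rewrite ltnn.
by have := rSB j; lra.
Qed.

(** Four stretches: from X down to the next circle, between two circles (the trapped part, costing 2
    e), from the last circle back to the last vertex Z known to lie in the annulus, and one more
    edge, whose lower end may be outside. The last edge is what allows annuli to be concatenated. *)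
Theorem annulus_straight X k : N X -> r J <= enorm X -> enorm X < r 0%N ->
  (forall l, (l < k)%N -> r J <= enorm (iterA l X)) ->
  enorm (direction X - direction (iterA k X)) <= 2 * (2 * kap M + W) / rin + 2 * e.
Proof.
move=> NX XJ X0 hk.
have XO : X <> origin.
  by move=> h; have := r_gt0 (leqnn J); rewrite ltNge -(enorm0 (R := R)) -h XJ.
have gX := generic_N NX XO.
(* The case n = 0 of the bound on chains, where the chain from 1 has not moved. *)
have delta_e : delta <= e.
  have [] := chain_bounds (j := 0%N) (n := 0%N) (i := 0) isT (lexx _) _.
    by rewrite mul0r mulr_ge0// pi_ge0.
  by rewrite /= subr0 add0r mul1r.
have kM0 : 0 <= kap M by apply/kap_ge0/ltW.
have e0 : 0 <= e by exact: le_trans (ltW delta0) delta_e.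
have dlip p q : enorm (p - q) <= kap M -> rin <= enorm p -> rin <= enorm q ->
    enorm (direction p - direction q) <= 2 * kap M / rin.
  move=> pq p1 q1; rewrite (le_trans (direction_lip rin0 p1 q1))//.
  by rewrite ler_pM2r ?invr_gt0// ler_pM2l.
case: k hk => [_|k hk].
  rewrite /= enorm_subxx addr_ge0 ?mulr_ge0 ?invr_ge0 ?(ltW rin0) ?(ltW W0)//.
  by have := W0; lra.
set Z := iterA k X.
have ZJ : r J <= enorm Z by apply: hk.
have ZX : enorm Z <= enorm X by exact: enorm_iter_anc_le.
have Z0 : enorm Z < r 0%N by exact: le_lt_trans ZX X0.
have gZ : generic Z.
  by apply: generic_iter => // i ik; apply: lt_le_trans (r_gt0 (leqnn J)) (hk i _).
have [j0 [j0J j0X j0M j0min]] := level_index XJ X0.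
have [j1 [j1J j1Z j1M j1min]] := level_index ZJ Z0.
have j01 : (j0 <= j1)%N by apply: j0min; exact: le_trans ZX.
have [p lp] : exists p, at_level X (r j0) p by apply: at_level_exists => //; rewrite r_gt0.
have [q lq] : exists q, at_level Z (r j1) q by apply: at_level_exists => //; rewrite r_gt0.
have lq' : at_level X (r j1) q.
  apply: at_level_iter lq _ => i ik; apply: le_trans j1Z _.
  apply/ltW/enorm_iter_lt => // l lk; apply: lt_le_trans (r_gt0 (leqnn J)) (hk l _).
  exact: ltn_trans lk (ltnSn k).
have [gp np _] := at_level_generic gX (r_gt0 j0J) lp.
have [gq nq _] := at_level_generic gZ (r_gt0 j1J) lq.
have Xrout : enorm X <= rout by apply: le_trans (ltW X0) rout0.
have Zrout : enorm Z <= rout by apply: le_trans (ltW Z0) rout0.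
have Xp := at_level_near gX lp (rin_le j0J) Xrout j0M.
have Zq := at_level_near gZ lq (rin_le j1J) Zrout j1M.
have lpq : at_level p (r j1) q.
  by apply: at_level_trans lp lq' => //; rewrite r_gt0//= r_le.
have [t pt /andP[t0 t2]] := polar_exists p 0; rewrite add0r in t2.
pose i := Num.floor (t / delta).
have := floor_itv (t / delta); rewrite -/i ler_pdivlMr// ltr_pdivrMr// => /andP[i1 i2].
have i0 : 0 <= i by rewrite /i floor_ge0 divr_ge0// ltW.
have ipi : i%:~R * delta <= 2 * pi by apply: le_trans i1 (ltW t2).
have nJ : (j0 + (j1 - j0) <= J)%N by rewrite subnKC.
have bnd n' : (n' <= j1 - j0)%N -> ((chain up j0 n' (i + 1) - i)%:~R * delta <= 1 / 16)
     /\ ((i - chain lo j0 n' i)%:~R * delta <= 1 / 16).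
  move=> hn; have [|b1 b2] := chain_bounds (j := j0) (n := n') (i := i) _ i0 ipi.
    by rewrite -(subnKC j01) in j1J; rewrite (leq_trans _ j1J)// leq_add2l.
  by split; [apply: (le_trans b1)|apply: (le_trans b2)]; exact: e16.
rewrite np in pt.
have lpq' : at_level p (r (j0 + (j1 - j0))) q by rewrite subnKC.
have tit : i%:~R * delta <= t <= (i + 1)%:~R * delta by rewrite i1 ltW.
have [t' qt /andP[a1 a2]] := trapped gp pt tit nJ bnd lpq'.
rewrite subnKC// in qt.
have [b1 b2] := chain_bounds nJ i0 ipi.
have dpq : enorm (direction p - direction q) <= 2 * e.
  rewrite pt qt !direction_polar ?r_gt0// (le_trans (enorm_polar_sub _ _))//.
  move: a1 a2 b1 b2 i2; rewrite !intrB !intrD !mulrBl mulrDl mul1r ler_norml => a1 a2 b1 b2 i2.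
  by apply/andP; split; lra.
have rX : rin <= enorm X by apply: le_trans (rin_le (leqnn J)) XJ.
have rZ : rin <= enorm Z by apply: le_trans (rin_le (leqnn J)) ZJ.
have rp : rin <= enorm p by rewrite np rin_le.
have rq : rin <= enorm q by rewrite nq rin_le.
have ZA : enorm (Z - iterA k.+1 X) <= W.
  by apply: generic_step => //; rewrite rZ.
have rA : rin <= enorm (iterA k.+1 X).
  have := enorm_le_sub Z (iterA k.+1 X); have := rinJ; have := W0; lra.
have d1 := dlip X p Xp rX rp.
have d2 : enorm (direction q - direction Z) <= 2 * kap M / rin.
  by apply: dlip => //; rewrite enormN.
have d3 : enorm (direction Z - direction (iterA k.+1 X)) <= 2 * W / rin.
  rewrite (le_trans (direction_lip rin0 rZ rA))//.
  by rewrite ler_pM2r ?invr_gt0// ler_pM2l.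
have s1 := enorm_triangle (direction p) (direction X) (direction (iterA k.+1 X)).
have s2 := enorm_triangle (direction q) (direction p) (direction (iterA k.+1 X)).
have s3 := enorm_triangle (direction Z) (direction q) (direction (iterA k.+1 X)).
have -> : 2 * (2 * kap M + W) / rin + 2 * e =
  2 * kap M / rin + 2 * e + 2 * kap M / rin + 2 * W / rin by ring.
apply: (le_trans s1); rewrite -!addrA; apply: lerD d1 _.
apply: (le_trans s2); apply: lerD dpq _.
by apply: (le_trans s3); apply: lerD d2 d3.
Qed.

End Annulus.

(** * Independent bits *)

Section ProductWeights.
Context {R : realType} {C : finType}.
Implicit Types (om : {ffun C -> bool}) (A : pred C).
Variable w : C -> bool -> R.
Hypothesis w_ge0 : forall c b, 0 <= w c b.
Hypothesis w_sum : forall c, w c true + w c false = 1.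

(** The law of independent bits, w c b being the probability that bit c equals b. *)
Definition weight om : R := \prod_c w c (om c).
Definition mean (H : {ffun C -> bool} -> R) := \sum_om weight om * H om.
Definition mix A om om' : {ffun C -> bool} := [ffun c => if A c then om' c else om c].

Lemma weight_ge0 om : 0 <= weight om. Proof. exact: prodr_ge0. Qed.

Lemma weight_sum : \sum_om weight om = 1.
Proof.
rewrite -(bigA_distr_bigA (fun c b => w c b)) big1// => c _.
by rewrite (bigD1 true)//= (bigD1 false)//= big_pred0 ?addr0// => -[].
Qed.

Lemma mean_cst x : mean (fun=> x) = x.
Proof. by rewrite /mean -mulr_suml weight_sum mul1r. Qed.

Lemma le_mean H H' : (forall om, H om <= H' om) -> mean H <= mean H'.
Proof. by move=> h; apply: ler_sum => om _; rewrite ler_wpM2l// weight_ge0. Qed.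

Lemma meanZ x H : mean (fun om => x * H om) = x * mean H.
Proof. by rewrite /mean mulr_sumr; apply: eq_bigr => om _; rewrite mulrCA. Qed.

Lemma meanD H H' : mean (fun om => H om + H' om) = mean H + mean H'.
Proof. by rewrite /mean -big_split; apply: eq_bigr => om _; rewrite mulrDr. Qed.

(* Exchanging the A-coordinates of two independent copies preserves the weight. *)
Lemma mean_mix A H : mean H = mean (fun om => mean (fun om' => H (mix A om om'))).
Proof.
pose sw (x : {ffun C -> bool} * {ffun C -> bool}) := (mix A x.1 x.2, mix A x.2 x.1).
have swK : involutive sw.
  by move=> [x y]; rewrite /sw/=; congr pair; apply/ffunP => c; rewrite !ffunE; case: (A c).
have wsw x : weight (sw x).1 * weight (sw x).2 = weight x.1 * weight x.2.
  rewrite /weight -!big_split; apply: eq_bigr => c _; rewrite !ffunE.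
  by case: (A c) => //; exact: mulrC.
transitivity (\sum_x weight x.1 * weight x.2 * H x.1).
  rewrite -(pair_bigA _ (fun x y => weight x * weight y * H x))/=.
  apply: eq_bigr => om _; rewrite -[LHS]mulr1 -weight_sum mulr_sumr.
  by apply: eq_bigr => om' _; rewrite mulrAC.
rewrite (reindex_inj (inv_inj swK))/=.
rewrite -(pair_bigA _ (fun x y => weight (sw (x, y)).1 * weight (sw (x, y)).2 * H (mix A x y)))/=.
apply: eq_bigr => om _; rewrite mulr_sumr; apply: eq_bigr => om' _.
by rewrite (wsw (om, om'))/= mulrA.
Qed.

Lemma mean_odd (s : {ffun C -> bool} -> {ffun C -> bool}) H : involutive s ->
  (forall om, weight (s om) = weight om) -> (forall om, H (s om) = - H om) -> mean H = 0.
Proof.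
move=> sK ws Hs; have : mean H = - mean H.
  rewrite {1}/mean (reindex_inj (inv_inj sK)) /mean -sumrN.
  by apply: eq_bigr => om _; rewrite ws Hs mulrN.
by move=> /eqP; rewrite -addr_eq0 -mulr2n mulrn_eq0/= => /eqP.
Qed.

(** From 1 + y <= exp y at y = - x when x <= 0, and at y = - x / 2, squared, when x > 0. *)
Lemma expR_le_quadratic (x : R) : - (1 / 2) <= x <= 1 / 2 -> expR x <= 1 + x + 2 * x ^+ 2.
Proof.
move=> /andP[x1 x2].
have [x0|x0] := leP x 0.
  have h := expR_ge1Dx (- x); have e : expR x * expR (- x) = 1 by rewrite -expRD subrr expR0.
  have ex := expR_gt0 x.
  have p : expR x * (1 - x) <= 1 by rewrite -[leRHS]e ler_wpM2l// ltW.
  have : expR x * (1 - x) <= (1 + x + 2 * x ^+ 2) * (1 - x).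
    apply: (le_trans p); rewrite !expr2; have : 0 <= (- x) * x * x by rewrite -!mulrA; nra.
    have := sqr_ge0 x; rewrite expr2; nra.
  by rewrite ler_pM2r//; lra.
have h := expR_ge1Dx (- x / 2).
have e : expR x * expR (- x / 2) ^+ 2 = 1.
  by rewrite expr2 -!expRD -[RHS](@expR0 R); congr expR; field.
have ex := expR_gt0 x.
have p : expR x * (1 - x / 2) ^+ 2 <= 1.
  rewrite -[leRHS]e ler_wpM2l ?(ltW ex)// lerXn2r// ?nnegrE ?expR_ge0//.
    by lra.
  by move: h; rewrite mulNr.
have : expR x * (1 - x / 2) ^+ 2 <= (1 + x + 2 * x ^+ 2) * (1 - x / 2) ^+ 2.
  apply: (le_trans p); rewrite -subr_ge0.
  have -> : (1 + x + 2 * x ^+ 2) * (1 - x / 2) ^+ 2 - 1 =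
     x ^+ 2 * (5 / 4 - 7 / 4 * x + x ^+ 2 / 2) by field.
  by rewrite mulr_ge0 ?sqr_ge0//; have := sqr_ge0 x; lra.
by rewrite ler_pM2r// exprn_gt0//; lra.
Qed.

(** After the quadratic bound the linear term has mean zero, and 1 + y <= exp y concludes. *)
Lemma mean_expR_le (D : {ffun C -> bool} -> R) (c l : R) : 0 <= l -> l * c <= 1 / 2 ->
  (forall om, `|D om| <= c) -> mean D = 0 ->
  mean (fun om => expR (l * D om)) <= expR (2 * (l * c) ^+ 2).
Proof.
move=> l0 lc Dc D0.
apply: (@le_trans _ _ (mean (fun om => 1 + 2 * (l * c) ^+ 2 + l * D om))).
  apply: le_mean => om.
  have h : `|l * D om| <= l * c by rewrite normrM ger0_norm// ler_wpM2l.
  have h2 : (l * D om) ^+ 2 <= (l * c) ^+ 2.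
    rewrite -(real_normK (num_real (l * D om))) ler_pXn2r// nnegrE//.
    exact: le_trans h.
  have /andP[h3 h4] : - (1 / 2) <= l * D om <= 1 / 2 by rewrite -ler_norml (le_trans h).
  by have := @expR_le_quadratic (l * D om); rewrite h3 h4 => /(_ isT); lra.
rewrite meanD mean_cst meanZ D0 mulr0 addr0; exact: expR_ge1Dx.
Qed.

Variable blk : C -> nat.
Variable f : nat -> {ffun C -> bool} -> int -> int.
Hypothesis f_blk : forall j om om' , (forall c, blk c = j -> om c = om' c) ->
  f j om =1 f j om'.

Lemma chain_mix j n i k om om' : (j + n <= k)%N ->
  chain (f ^~ (mix (fun c => blk c == k) om om')) j n i = chain (f ^~ om) j n i.
Proof.
elim: n => //= n IH; rewrite addnS => jk; rewrite IH ?(ltnW jk)//.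
apply: f_blk => c cj; rewrite ffunE cj; case: eqP => // e.
by move: jk; rewrite e ltnn.
Qed.

(** Conditioning by resampling: the bits of the last block are replaced by an independent copy. The
    index reached before that block does not see them, so the one-step bound applies at a fixed
    index and contributes one factor G. *)
Lemma mean_chain_expR (l G : R) (J : nat) : 0 <= G ->
  (forall j i, (j < J)%N -> mean (fun om => expR (l * (f j om i - i)%:~R)) <= G) ->
  forall j n i, (j + n <= J)%N ->
  mean (fun om => expR (l * (chain (f ^~ om) j n i - i)%:~R)) <= G ^+ n.
Proof.
move=> G0 fG j n i; elim: n => [|n IH] jn.
  by rewrite /= subrr mulr0 expR0 mean_cst expr0.
rewrite addnS in jn; rewrite (mean_mix (fun c => blk c == (j + n)%N)).
apply: (@le_trans _ _ (mean (fun om => G * expR (l * (chain (f ^~ om) j n i - i)%:~R)))); last first.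
  by rewrite meanZ exprS ler_wpM2l// IH// ltnW.
apply: le_mean => om; rewrite /=.
set s := chain (f ^~ om) j n i.
apply: (@le_trans _ _ (mean (fun om' => expR (l * (s - i)%:~R) *
   expR (l * (f (j + n)%N om' s - s)%:~R)))); last first.
  by rewrite meanZ mulrC ler_wpM2r ?expR_ge0// fG.
apply: le_mean => om'; rewrite chain_mix// -/s -expRD -mulrDr -intrD.
have -> : s - i + (f (j + n)%N om' s - s) = f (j + n)%N om' s - i by rewrite addrC addrA subrK.
rewrite (@f_blk _ _ om')// => c cj; by rewrite ffunE cj eqxx.
Qed.

(** Markov's inequality for the exponential moment. *)
Lemma mean_chain_tail (l G E : R) (J : nat) : 0 <= l -> 0 <= G ->
  (forall j i, (j < J)%N -> mean (fun om => expR (l * (f j om i - i)%:~R)) <= G) ->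
  forall j n i, (j + n <= J)%N ->
  mean (fun om => (nat_of_bool (E < (chain (f ^~ om) j n i - i)%:~R)%R)%:R) <= expR (- (l * E)) * G ^+ n.
Proof.
move=> l0 G0 fG j n i jn.
apply: (@le_trans _ _ (mean (fun om => expR (- (l * E)) *
  expR (l * (chain (f ^~ om) j n i - i)%:~R)))).
  apply: le_mean => om; rewrite -expRD; case: (ltP E) => h; last exact: expR_ge0.
  by rewrite -[leLHS]expR0 ler_expR addrC subr_ge0 ler_wpM2l// ltW.
by rewrite meanZ ler_wpM2l ?expR_ge0//; exact: mean_chain_expR fG _ _ _ jn.
Qed.

End ProductWeights.

(** * Discrete walks *)

(* Block, level inside the block, angular index. *)
Notation cell J q m1 := ('I_J * 'I_q * 'I_m1.+1)%type.

Section DiscreteWalk.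
Context {R : realType}.
Variables (J q m1 : nat).
Local Notation m := m1.+1.
Local Notation cell := (cell J q m1).
Implicit Types (c : cell) (om : {ffun cell -> bool}) (k : int).

Definition blk c : nat := c.1.1.
Definition lev c : nat := c.1.2.
(* Twice the angle of the centre of the cell, in units of 2 pi / m. *)
Definition idx c : int := 2 * (c.2 : nat)%:Z + 1.

(** Half the angular width of a cell. *)
Definition gam : R := pi / m%:R.

Lemma gamE : gam = pi / m%:R. Proof. by []. Qed.

(** Reflection in the line at angle k0 gam: it sends [idx c] to 2 k0 - [idx c] modulo 2 m, that is,
    the angular number a to k0 - a - 1 modulo m. It preserves the set of cells for every integer
    k0. *)
Definition refl k0 c : cell := (c.1, inord (absz ((k0 - (c.2 : nat)%:Z - 1) %% m%:Z)%Z)).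

Lemma refl_val k0 c : ((refl k0 c).2 : nat)%:Z = ((k0 - (c.2 : nat)%:Z - 1) %% m%:Z)%Z.
Proof.
have m0 : m%:Z != 0 by [].
have h := modz_ge0 (k0 - (c.2 : nat)%:Z - 1) m0.
have h2 := ltz_mod (k0 - (c.2 : nat)%:Z - 1) m0.
rewrite /refl /= inordK ?gez0_abs//.
by rewrite -ltz_nat gez0_abs.
Qed.

Lemma refl_idx k0 c : exists z : int, idx (refl k0 c) = 2 * k0 - idx c + 2 * m%:Z * z.
Proof.
exists (- ((k0 - (c.2 : nat)%:Z - 1) %/ m%:Z)%Z).
rewrite /idx refl_val /modz.
set d := divz _ _; ring.
Qed.

Lemma reflK k0 : involutive (refl k0).
Proof.
move=> c; rewrite [RHS]surjective_pairing; congr pair; apply/val_inj => /=.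
apply/eqP; rewrite -eqz_nat; apply/eqP; rewrite (refl_val k0 (refl k0 c)) refl_val.
set x := (c.2 : nat)%:Z.
have -> : k0 - ((k0 - x - 1) %% m%:Z)%Z - 1 = ((k0 - x - 1) %/ m%:Z)%Z * m%:Z + x.
  by rewrite /modz; set d := divz _ _; ring.
by rewrite modzMDl modz_small// /x ltz_nat ltn_ord.
Qed.

Lemma cosDz (t : R) (z : int) : cos (t + 2 * pi * z%:~R) = cos t.
Proof. by have := polarDz 1 t z; rewrite /polar !mul1r => -[]. Qed.

Variable rad : nat -> nat -> R.

(** The law of cosines for the distance from the point with polar coordinates (s, k gam) to the
    centre of c. Angles enter only through the cosine of their difference, so reflection invariance
    is exact. *)
Definition dist2 (s : R) k c : R := s ^+ 2 + rad (blk c) (lev c) ^+ 2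
  - 2 * (s * rad (blk c) (lev c) * cos ((idx c - k)%:~R * gam)).

Lemma dist2E s k c : dist2 s k c = enorm (polar s (k%:~R * gam)
  - polar (rad (blk c) (lev c)) ((idx c)%:~R * gam)) ^+ 2.
Proof.
set r := rad _ _; rewrite sqr_enorm /dist2 -/r intrB mulrBl.
set a := _ * gam; set b := _ * gam; rewrite cosB /dot/=.
have := cos2Dsin2 a; have := cos2Dsin2 b; rewrite !expr2 => h1 h2.
transitivity (s * s * (cos b * cos b + sin b * sin b) +
  r * r * (cos a * cos a + sin a * sin a) - 2 * (s * r * (cos a * cos b + sin a * sin b))).
  by rewrite h1 h2; ring.
by ring.
Qed.

Lemma dist2_refl s k k0 c : dist2 s (2 * k0 - k) (refl k0 c) = dist2 s k c.
Proof.
rewrite /dist2; have [z ->] := refl_idx k0 c.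
have -> : (2 * k0 - idx c + 2 * m%:Z * z - (2 * k0 - k))%:~R * gam =
   - ((idx c - k)%:~R * gam) + 2 * pi * z%:~R.
  have -> : 2 * k0 - idx c + 2 * m%:Z * z - (2 * k0 - k) = - (idx c - k) + 2 * m%:Z * z by ring.
  move: (idx c - k) => A; rewrite intrD intrN mulrDl mulNr; congr (_ + _).
  by rewrite !intrM /gam; field.
by rewrite cosDz cosN.
Qed.

Definition candidate j om b c := [&& blk c == j, om c & (lev c < b)%N].

Definition nearest_cell j om s k b c := candidate j om b c &&
  [forall c', candidate j om b c' ==> (c' != c) ==> (dist2 s k c < dist2 s k c')].

Variable stop : nat.

Fixpoint walk j om n s k b : option cell :=
  if n is n'.+1 then
    if [pick c | nearest_cell j om s k b c] is Some c then
      if (lev c < stop)%N then Some c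
      else walk j om n' (rad (blk c) (lev c)) (idx c) (lev c)
    else None
  else None.

Lemma nearest_cell_inj j om s k b c c' : nearest_cell j om s k b c ->
  nearest_cell j om s k b c' -> c = c'.
Proof.
move=> /andP[c1 /forallP h1] /andP[c2 /forallP h2]; apply/eqP/negPn/negP => ne.
have /implyP/(_ c2)/implyP := h1 c'; rewrite eq_sym => /(_ ne) lt1.
have /implyP/(_ c1)/implyP/(_ ne) lt2 := h2 c.
by have := lt_trans lt1 lt2; rewrite ltxx.
Qed.

Lemma pick_nearest_cell j om s k b c : nearest_cell j om s k b c ->
  [pick c' | nearest_cell j om s k b c'] = Some c.
Proof.
move=> nc; case: pickP => [c' nc'|/(_ c)]; last by rewrite nc.
by rewrite (nearest_cell_inj nc nc').
Qed.

Lemma dist2_mod s k k' c : (exists z : int, k' = k + 2 * m%:Z * z) ->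
  dist2 s k' c = dist2 s k c.
Proof.
move=> [z ->]; rewrite /dist2; congr (_ - 2 * (_ * _)).
have -> : (idx c - (k + 2 * m%:Z * z))%:~R * gam = (idx c - k)%:~R * gam + 2 * pi * (- z)%:~R.
  by rewrite !intrD !intrN intrD !intrM /gam; field.
exact: cosDz.
Qed.

Definition mirror k0 om : {ffun cell -> bool} := [ffun c => om (refl k0 c)].

Lemma mirrorK k0 : involutive (mirror k0).
Proof. by move=> om; apply/ffunP => c; rewrite !ffunE reflK. Qed.

Lemma nearest_cell_mirror k0 j om s k k' b c : (exists z : int, k' = 2 * k0 - k + 2 * m%:Z * z) ->
  nearest_cell j (mirror k0 om) s k' b (refl k0 c) = nearest_cell j om s k b c.
Proof.
move=> hk; have cand c' : candidate j (mirror k0 om) b (refl k0 c') = candidate j om b c'.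
  by rewrite /candidate ffunE reflK.
have d c' : dist2 s k' (refl k0 c') = dist2 s k c'.
  by rewrite (dist2_mod _ _ hk) dist2_refl.
rewrite /nearest_cell cand; congr andb; apply/forallP/forallP => h c'.
- have := h (refl k0 c'); rewrite cand !d.
  by rewrite (inj_eq (inv_inj (reflK k0))).
- have := h (refl k0 c'); rewrite -{2}(reflK k0 c') -[in X in _ -> X](reflK k0 c') cand !d.
  by rewrite (inj_eq (inv_inj (reflK k0))) reflK.
Qed.

Lemma walk_mirror k0 j om n s k k' b : (exists z : int, k' = 2 * k0 - k + 2 * m%:Z * z) ->
  walk j (mirror k0 om) n s k' b = omap (refl k0) (walk j om n s k b).
Proof.
elim: n s k k' b => //= n IH s k k' b hk.
case: (pickP (nearest_cell j om s k b)) => [c nc|none].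
  have nc' : nearest_cell j (mirror k0 om) s k' b (refl k0 c).
    by rewrite (nearest_cell_mirror _ _ _ _ _ hk).
  rewrite (pick_nearest_cell nc') /=; case: ifP => //= _.
  by apply: IH; exact: refl_idx.
case: pickP => // c nc; have := none (refl k0 c).
by rewrite -(nearest_cell_mirror _ _ _ _ _ hk) reflK nc.
Qed.

Variable cm : int.
Hypothesis cm0 : 0 <= cm.
Hypothesis cm_lt : cm < m%:Z.

(* The representative of y modulo 2 m in [- cm, cm], with junk value 0 if there is none;
   the truncation makes the displacement bounded for every configuration. *)
Definition wrap (y : int) : int :=
  let z := (y %% (2 * m%:Z))%Z in
  if z <= cm then z else if 2 * m%:Z - z <= cm then z - 2 * m%:Z else 0.

Let m2_gt0 : 0 < 2 * m%:Z. Proof. by []. Qed.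

Lemma wrap_le y : `|wrap y| <= cm.
Proof.
rewrite /wrap; have z0 := modz_ge0 y (lt0r_neq0 m2_gt0).
have z1 := ltz_pmod y m2_gt0; set z := (y %% _)%Z in z0 z1 *.
case: (leP z cm) => h1; first by rewrite ger0_norm.
case: (leP (2 * m%:Z - z) cm) => h2; last by rewrite normr0.
by lia.
Qed.

Lemma wrap_small y z : `|y| <= cm -> wrap (y + 2 * m%:Z * z) = y.
Proof.
move=> yc; rewrite /wrap (mulrC _ z) addrC modzMDl.
have m2 := cm_lt; have [y0|y0] := leP 0 y.
  rewrite ger0_norm// in yc; rewrite modz_small ?yc// y0/=.
  by rewrite (le_lt_trans yc)// (lt_le_trans m2)// ler_peMl.
rewrite ltr0_norm// in yc.
have -> : (y %% (2 * m%:Z))%Z = y + 2 * m%:Z.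
  rewrite -[in LHS](addrK (2 * m%:Z) y) -mulN1r -[in LHS](mulrC (2 * m%:Z)) (mulrC _ (-1)) addrC modzMDl modz_small//.
  by apply/andP; split; lia.
by case: ifP => [h|_]; [lia|case: ifP => [_|]; lia].
Qed.

(** The interval [- cm, cm] is symmetric and cm < m leaves at most one representative in it; the
    default value 0 is its own opposite. *)
Lemma wrapN y z : wrap (- y + 2 * m%:Z * z) = - wrap y.
Proof.
rewrite /wrap (mulrC _ z) addrC modzMDl.
have z0 := modz_ge0 y (lt0r_neq0 m2_gt0); have z1 := ltz_pmod y m2_gt0.
have e : y = (y %/ (2 * m%:Z))%Z * (2 * m%:Z) + (y %% (2 * m%:Z))%Z by exact: divz_eq.
set z' := (y %% _)%Z in z0 z1 e *; set d := (y %/ _)%Z in e.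
have [z'0|z'n0] := eqVneq z' 0.
  have -> : - y = (- d) * (2 * m%:Z) + 0 by rewrite e z'0; ring.
  by rewrite modzMDl mod0z z'0 cm0 oppr0.
have -> : - y = (- d - 1) * (2 * m%:Z) + (2 * m%:Z - z') by rewrite e; ring.
rewrite modzMDl modz_small; last by apply/andP; split; lia.
have := cm_lt; move: z'n0 z0 z1; case: ifP => h1; case: ifP => h2; try lia.
case: ifP => h3; try lia.
case: ifP => h3; try lia.
Qed.

Definition disp j om k0 n s : int :=
  if walk j om n s k0 q is Some c then wrap (idx c - k0) else 0.

Lemma disp_le j om k0 n s : `|disp j om k0 n s| <= cm.
Proof. by rewrite /disp; case: walk => [c|]; [exact: wrap_le|rewrite normr0]. Qed.

Lemma disp_mirror j om k0 n s : disp j (mirror k0 om) k0 n s = - disp j om k0 n s.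
Proof.
rewrite /disp (@walk_mirror k0 j om n s k0 k0); last by exists 0; ring.
case: walk => [c|] /=; last by rewrite oppr0.
have [z ->] := refl_idx k0 c.
by rewrite -(wrapN _ z); congr wrap; ring.
Qed.

Lemma candidate_blk j om om' b : (forall c, blk c = j -> om c = om' c) ->
  candidate j om b =1 candidate j om' b.
Proof. by move=> h c; rewrite /candidate; case: eqP => // /h ->. Qed.

(** Candidates are sought in block j only. This is the source of the independence between rings. *)
Lemma disp_blk j om om' k0 n s : (forall c, blk c = j -> om c = om' c) ->
  disp j om k0 n s = disp j om' k0 n s.
Proof.
move=> h; rewrite /disp.
suff -> : forall n' s' k' b, walk j om n' s' k' b = walk j om' n' s' k' b by [].
elim=> //= n' IH s' k' b.
have e : nearest_cell j om s' k' b =1 nearest_cell j om' s' k' b.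
  move=> c; rewrite /nearest_cell (candidate_blk _ h); congr andb.
  by apply: eq_forallb => c'; rewrite (candidate_blk _ h).
by rewrite (eq_pick e); case: pickP => // c _; case: ifP => // _; exact: IH.
Qed.

Variable w : cell -> bool -> R.
Hypothesis w_ge0 : forall c b, 0 <= w c b.
Hypothesis w_sum : forall c, w c true + w c false = 1.
Hypothesis w_rot : forall c c', c.1 = c'.1 -> w c = w c'.

Lemma weight_mirror k0 om : weight w (mirror k0 om) = weight w om.
Proof.
rewrite /weight (reindex_inj (inv_inj (reflK k0)))/=; apply: eq_bigr => c _.
by rewrite ffunE reflK (w_rot (c' := c)).
Qed.

Variables (fuel : nat) (rho : nat -> R) (m' : nat) (B : nat).
Hypothesis m'0 : (0 < m')%N.

(* Starting angles are the multiples of 2 m' cell half-widths; displacements are measured in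
   that unit.  The integer B absorbs the part of the block that the walk does not explore. *)
Definition step_disp j om (i : int) : R :=
  (disp j om (2 * m'%:Z * i) fuel (rho j))%:~R / (2 * m'%:R).

Definition upper j om (i : int) : int := i + Num.ceil (step_disp j om i) + B%:Z.
Definition lower j om (i : int) : int := i + Num.floor (step_disp j om i) - B%:Z.

Lemma step_disp_le j om i : `|step_disp j om i| <= cm%:~R / (2 * m'%:R).
Proof.
have h : 0 < 2 * m'%:R :> R by rewrite mulr_gt0// ltr0n.
rewrite /step_disp normrM normfV (gtr0_norm h) ler_pM2r ?invr_gt0//.
by rewrite -intr_norm ler_int disp_le.
Qed.

Lemma mean_step_disp j i : mean w (fun om => step_disp j om i) = 0.
Proof.
apply: (mean_odd (mirrorK (2 * m'%:Z * i))) => om; first exact: weight_mirror.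
by rewrite /step_disp disp_mirror intrN mulNr.
Qed.

Section chernoff.
Variable l : R.
Hypothesis l0 : 0 <= l.
Let c : R := cm%:~R / (2 * m'%:R).
Hypothesis lc : l * c <= 1 / 2.
(** The factor for one ring: a deterministic drift of at most B + 1 units, one of them for the
    rounding, and the second-order term of the centred displacement. *)
Let G := expR (l * (B%:R + 1) + 2 * (l * c) ^+ 2).

Let mean_le (D : {ffun cell -> bool} -> R) : (forall om, `|D om| <= c) -> mean w D = 0 ->
  mean w (fun om => expR (l * (Num.ceil (D om) + B%:Z)%:~R)) <= G.
Proof.
move=> Dc D0; apply: (@le_trans _ _ (mean w (fun om => expR (l * (B%:R + 1)) * expR (l * D om)))).
  apply: le_mean => // om; rewrite -expRD ler_expR -mulrDr ler_wpM2l//.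
  have h := ceilB1_lt (D om); rewrite intrD.
  have -> : (B%:Z)%:~R = B%:R :> R by [].
  by move: h; rewrite ?intrB; lra.
by rewrite meanZ /G expRD ler_wpM2l ?expR_ge0// mean_expR_le.
Qed.

Lemma upper_tail (E : R) j n i : (j + n <= J)%N ->
  mean w (fun om => (nat_of_bool (E < (chain (upper ^~ om) j n i - i)%:~R)%R)%:R) <=
  expR (- (l * E)) * G ^+ n.
Proof.
move=> jn; apply: (@mean_chain_tail _ _ _ w_ge0 w_sum blk upper _ l G E J) => //.
- move=> k om om' h i'; rewrite /upper /step_disp; congr (_ + Num.ceil (_%:~R / _) + _).
  exact: disp_blk.
- exact: expR_ge0.
move=> k i' _; rewrite (_ : (fun om => _) =
    (fun om => expR (l * (Num.ceil (step_disp k om i') + B%:Z)%:~R))); last first.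
  by apply/funext => om; congr (expR (l * _%:~R)); rewrite /upper; ring.
by apply: mean_le; [move=> om; exact: step_disp_le|exact: mean_step_disp].
Qed.

Lemma lower_tail (E : R) j n i : (j + n <= J)%N ->
  mean w (fun om => (nat_of_bool (E < (i - chain (lower ^~ om) j n i)%:~R)%R)%:R) <=
  expR (- (l * E)) * G ^+ n.
Proof.
(* Changing the sign of the index turns floors into ceilings and lower deviations into upper
   ones. *)
move=> jn; pose f (k : nat) om i' := - lower k om (- i').
have fE om n' : chain (f ^~ om) j n' (- i) = - chain (lower ^~ om) j n' i.
  by elim: n' => //= n' ->; rewrite /f opprK.
rewrite (_ : (fun om => _) = (fun om =>
    (nat_of_bool (E < (chain (f ^~ om) j n (- i) - - i)%:~R)%R)%:R)); last first.
  by apply/funext => om; rewrite fE opprK addrC.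
apply: (@mean_chain_tail _ _ _ w_ge0 w_sum blk f _ l G E J) => //.
- move=> k om om' h i'; rewrite /f /lower /step_disp; congr (- (_ + Num.floor (_%:~R / _) - _)).
  exact: disp_blk.
- exact: expR_ge0.
move=> k i' _; rewrite (_ : (fun om => _) =
    (fun om => expR (l * (Num.ceil (- step_disp k om (- i')) + B%:Z)%:~R))); last first.
  apply/funext => om; congr (expR (l * _%:~R)); rewrite /f /lower floorNceil.
  ring.
apply: mean_le; first by move=> om; rewrite normrN; exact: step_disp_le.
rewrite (_ : (fun om => _) = (fun om => -1 * step_disp k om (- i'))); last first.
  by apply/funext => om; rewrite mulN1r.
by rewrite meanZ mean_step_disp mulr0.
Qed.

End chernoff.

End DiscreteWalk.

(** * Polar cells *)

Lemma int_lt1 (z : int) : -1 < z -> z < 1 -> z = 0.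
Proof. lia. Qed.

Section Sector.
Context {R : realType}.
Implicit Types (z : plane R) (s t a b : R).

(** Two half-plane conditions, convenient for measurability and rotations; [sectorP] identifies them
    with an interval of angles when the width is less than pi. *)
Definition sector a b : set (plane R) :=
  [set z | 0 <= cross (polar 1 a) z /\ 0 < cross z (polar 1 b)].

Lemma sin_itv t : 0 <= t < 2 * pi -> (0 <= sin t -> t <= pi) /\ (0 < sin t -> t < pi).
Proof.
move=> /andP[t0 t2].
have neg : pi < t -> sin t < 0.
  move=> pt; have -> : t = (t - pi) + pi by rewrite subrK.
  by rewrite sinDpi oppr_lt0 sin_gt0_pi//; apply/andP; split; lra.
split=> h; first by rewrite leNgt; apply/negP => /neg; rewrite ltNge h.
rewrite ltNge; apply/negP; rewrite le_eqVlt => /orP[/eqP e|/neg].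
  by move: h; rewrite -e sinpi ltxx.
by rewrite ltNge ltW.
Qed.

Lemma polar_inj s t t' : 0 < s -> polar s t = polar s t' ->
  exists z : int, t = t' + 2 * pi * z%:~R.
Proof.
move=> s0 e; have pi0 := pi_gt0 R; have pi20 : 0 < 2 * pi :> R by rewrite mulr_gt0.
pose k := Num.floor ((t - t') / (2 * pi)).
have := floor_itv ((t - t') / (2 * pi)).
rewrite -/k ler_pdivlMr// ltr_pdivrMr// intrD => /andP[h1 h2].
exists k; pose u := t - t' - 2 * pi * k%:~R.
have u02 : 0 <= u < 2 * pi by rewrite /u; apply/andP; split; lra.
have c0 : sin u = 0 /\ cos u = 1.
  have hs : cross (polar s t') (polar s t) = 0 by rewrite e /cross mulrC subrr.
  have hc : dot (polar s t') (polar s t) = s ^+ 2 by rewrite e -sqr_enorm enorm_polar// ltW.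
  have eu := polarDz 1 u k; rewrite {1}/u subrK in eu.
  have [e1 e2] : cos (t - t') = cos u /\ sin (t - t') = sin u.
    by move: eu; rewrite /polar !mul1r => -[].
  rewrite cross_polar in hs; rewrite dot_polar expr2 in hc; rewrite -e1 -e2.
  have ss : s * s != 0 by rewrite gt_eqF// mulr_gt0.
  split; first by move/eqP: hs; rewrite mulf_eq0 (negbTE ss) => /eqP.
  by apply: (mulfI ss); rewrite mulr1.
suff : u = 0 by rewrite /u; lra.
have [c1 c2] := c0; have [le_pi _] := sin_itv u02.
have upi : u <= pi by apply: le_pi; rewrite c1.
case/andP: u02 => u0 _; apply/eqP; rewrite eq_le u0 andbT leNgt; apply/negP => up.
have [upi'|pu] := ltP u pi.
  have : 0 < sin u by rewrite sin_gt0_pi// up.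
  by rewrite c1 ltxx.
have ue : u = pi by apply/eqP; rewrite eq_le upi.
by move: c2; rewrite ue cospi => h; lra.
Qed.

Lemma sectorP a b z : a < b < a + pi -> sector a b z <->
  z <> origin /\ exists2 t, z = polar (enorm z) t & a <= t < b.
Proof.
move=> /andP[ab ba]; have pi0 := pi_gt0 R.
have cr1 t : z = polar (enorm z) t -> cross (polar 1 a) z = enorm z * sin (t - a).
  by move=> {1}->; rewrite cross_polar mul1r.
have cr2 t : z = polar (enorm z) t -> cross z (polar 1 b) = enorm z * sin (b - t).
  by move=> {1}->; rewrite cross_polar mulr1.
split=> [[h1 h2]|[/enorm_gt0 z0 [t zt /andP[at_ tb]]]]; last first.
  split; first by rewrite (cr1 t)// mulr_ge0 ?(ltW z0)// sin_ge0_pi//; apply/andP; split; lra.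
  by rewrite (cr2 t)// mulr_gt0// sin_gt0_pi//; apply/andP; split; lra.
have zn : z <> origin.
  by move=> e; move: h2; rewrite e /cross/= !mul0r subrr ltxx.
have z0 := enorm_gt0 zn; split => //.
have [t zt /andP[t1 t2]] := polar_exists z a; exists t => //; rewrite t1/=.
move: h1 h2; rewrite (cr1 t)// (cr2 t)// pmulr_rge0// pmulr_rgt0// => h1 h2.
have [|le_pi _] := @sin_itv (t - a); first by apply/andP; split; lra.
have tap := le_pi h1; rewrite ltNge; apply/negP => bt.
have : 0 <= sin (t - b) by rewrite sin_ge0_pi//; apply/andP; split; lra.
by rewrite -opprB sinN oppr_ge0 leNgt h2.
Qed.

End Sector.

Section Cells.
Context {R : realType}.
Implicit Types (X Y Z p v z : plane R).
Variables (J q m1 : nat) (r : nat -> R) (M h : R).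
Local Notation m := m1.+1.
Local Notation gam := (@gam R m1).
Local Notation cell := (cell J q m1).
Implicit Types (c : cell).
Hypothesis rS : forall j, r j.+1 = r j - M.
Hypothesis M0 : 0 < M.
Hypothesis h0 : 0 < h.
Hypothesis qh : q%:R * h = M.
Hypothesis m3 : (2 < m)%N.
Hypothesis rJ : 0 < r J.

Definition annulus_set (s : R) : set (plane R) := [set z | s <= enorm z < s + h].

Definition cellset c : set (plane R) :=
  annulus_set (r (blk c).+1 + (lev c)%:R * h) `&`
  sector ((c.2 : nat)%:R * (2 * gam)) ((c.2 : nat).+1%:R * (2 * gam)).

Definition rad j b : R := r j.+1 + (b%:R + 1 / 2) * h.
Definition ctr c := polar (rad (blk c) (lev c)) ((idx c)%:~R * gam).

Lemma gam_gt0 : 0 < gam.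
Proof. by rewrite divr_gt0// pi_gt0. Qed.

Lemma gam_m : m%:R * (2 * gam) = 2 * pi.
Proof. by rewrite /gam; field. Qed.

Lemma gam2_lt_pi : 2 * gam < pi.
Proof.
rewrite gamE mulrA ltr_pdivrMr// mulrC ltr_pM2l ?pi_gt0//.
by rewrite ltr_nat.
Qed.

Lemma arc_itv (a : nat) : a%:R * (2 * gam) < a.+1%:R * (2 * gam) < a%:R * (2 * gam) + pi.
Proof.
have := gam2_lt_pi; have := gam_gt0; rewrite -natr1 mulrDl mul1r => g0 g1.
by apply/andP; split; lra.
Qed.

Lemma r_le i j : (i <= j)%N -> r j <= r i.
Proof.
elim: j => [|j IH]; first by case: i.
rewrite leq_eqVlt => /orP[/eqP -> //|/IH]; apply: le_trans.
by rewrite rS gerBl ltW.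
Qed.

Lemma cellsetP c z : cellset c z -> [/\ r (blk c).+1 + (lev c)%:R * h <= enorm z,
  enorm z < r (blk c).+1 + ((lev c)%:R + 1) * h &
  exists2 t, z = polar (enorm z) t &
    (c.2 : nat)%:R * (2 * gam) <= t < ((c.2 : nat)%:R + 1) * (2 * gam)].
Proof.
move=> [/andP[h1 h2] /sectorP []].
  exact: arc_itv.
move=> _ [t zt ht]; split => //; first by rewrite mulrDl mul1r addrA.
by exists t => //; rewrite natr1.
Qed.

Lemma cellset_block c z : cellset c z -> r (blk c).+1 <= enorm z < r (blk c).
Proof.
move=> /cellsetP[h1 h2 _]; apply/andP; split.
  by rewrite (le_trans _ h1)// lerDl mulr_ge0// ltW.
apply: (lt_le_trans h2); have -> : r (blk c) = r (blk c).+1 + M by rewrite rS subrK.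
rewrite lerD2l -qh ler_wpM2r ?(ltW h0)// natr1 ler_nat; exact: ltn_ord.
Qed.

Lemma cellset_inj c c' z : cellset c z -> cellset c' z -> c = c'.
Proof.
move=> cz c'z.
have /andP[b1 b2] := cellset_block cz; have /andP[b1' b2'] := cellset_block c'z.
have eb : blk c = blk c'.
  case: (ltngtP (blk c) (blk c')) => // lt'.
  - by have := lt_le_trans b2' (r_le lt'); rewrite ltNge b1.
  - by have := lt_le_trans b2 (r_le lt'); rewrite ltNge b1'.
have [l1 l2 [t zt /andP[t1 t2]]] := cellsetP cz.
have [l1' l2' [t' zt' /andP[t1' t2']]] := cellsetP c'z.
have el : lev c = lev c'.
  rewrite -eb in l1' l2'.
  have le_lev (x y : nat) : r (blk c).+1 + x%:R * h <= enorm z ->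
      enorm z < r (blk c).+1 + (y%:R + 1) * h -> (x <= y)%N.
    move=> /le_lt_trans hx /hx; rewrite ltrD2l ltr_pM2r// natr1 ltr_nat ltnS//.
  by apply/eqP; rewrite eqn_leq (le_lev _ _ l1 l2') (le_lev _ _ l1' l2).
have z0 : 0 < enorm z.
  by apply: lt_le_trans b1; apply: lt_le_trans rJ (r_le _); exact: ltn_ord.
have g0 : 0 < 2 * gam by rewrite mulr_gt0 ?gam_gt0.
have ang (c0 : cell) (t0 : R) : (c0.2 : nat)%:R * (2 * gam) <= t0 -> t0 < ((c0.2 : nat)%:R + 1) * (2 * gam) ->
    0 <= t0 < 2 * pi.
  move=> s1 s2; apply/andP; split.
    by apply: le_trans s1; rewrite mulr_ge0 ?(ltW g0).
  apply: (lt_le_trans s2).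
  by rewrite -gam_m ler_wpM2r ?(ltW g0)// natr1 ler_nat ltn_ord.
have /andP[a1 a2] := ang c t t1 t2; have /andP[a1' a2'] := ang c' t' t1' t2'.
have [zi ezi] : exists z0 : int, t = t' + 2 * pi * z0%:~R.
  by apply: (polar_inj z0); rewrite -zt -zt'.
have pi0 := pi_gt0 R.
have zi0 : zi = 0.
  have h1 : (-1 < zi%:~R :> R) by nra.
  have h2 : (zi%:~R < 1 :> R) by nra.
  by apply: int_lt1; rewrite -(ltr_int R) ?intrN.
rewrite zi0 mulr0 addr0 in ezi; rewrite -ezi in t1' t2'.
have le_ang (x y : nat) : x%:R * (2 * gam) <= t -> t < (y%:R + 1) * (2 * gam) -> (x <= y)%N.
  by move=> /le_lt_trans hx /hx; rewrite ltr_pM2r// natr1 ltr_nat ltnS.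
have e2 : c.2 = c'.2.
  by apply/val_inj/eqP; rewrite eqn_leq (le_ang _ _ t1 t2') (le_ang _ _ t1' t2).
move: eb el e2; rewrite /blk /lev; case: (c) => [[x y] w]; case: (c') => [[x' y'] w'] /=.
by move=> /val_inj -> /val_inj -> ->.
Qed.

Lemma cellset_cover j z : (j < J)%N -> r j.+1 <= enorm z < r j ->
  exists2 c, blk c = j & cellset c z.
Proof.
move=> jJ /andP[z1 z2].
have z0 : 0 < enorm z by apply: lt_le_trans z1; apply: lt_le_trans rJ (r_le _).
have zn : z <> origin by move=> e; move: z0; rewrite e enorm0 ltxx.
have g0 : 0 < 2 * gam by rewrite mulr_gt0 ?gam_gt0.
have [t zt /andP[t1 t2]] := polar_exists z 0; rewrite add0r -gam_m in t2.
have t20 : 0 <= t / (2 * gam) by rewrite divr_ge0// ltW.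
have /andP[a1 a2] := truncn_itv t20; set a := Num.truncn _ in a1 a2.
have am : (a < m)%N.
  by rewrite -(ltr_nat R) (le_lt_trans a1)// ltr_pdivrMr.
have d0 : 0 <= (enorm z - r j.+1) / h by rewrite divr_ge0 ?subr_ge0// ltW.
have /andP[b1 b2] := truncn_itv d0; set b := Num.truncn _ in b1 b2.
have bq : (b < q)%N.
  rewrite -(ltr_nat R) (le_lt_trans b1)// ltr_pdivrMr// qh ltrBlDl.
  by have := rS j; lra.
exists (Ordinal jJ, Ordinal bq, Ordinal am) => //.
rewrite ler_pdivlMr// in b1; rewrite ltr_pdivrMr// in b2.
rewrite ler_pdivlMr// in a1; rewrite ltr_pdivrMr// in a2.
split; rewrite /blk /lev /=.
  rewrite /annulus_set/=; move: b1 b2; rewrite -natr1 mulrDl mul1r => b1 b2.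
  by apply/andP; split; lra.
apply/sectorP.
  exact: arc_itv.
by split => //; exists t => //; rewrite a1.
Qed.

Lemma idx_gam c : (idx c)%:~R * gam = ((c.2 : nat)%:R + 1 / 2) * (2 * gam).
Proof. by rewrite /idx intrD intrM -[((c.2 : nat)%:Z)%:~R]/((c.2 : nat)%:R : R); field. Qed.

(** First turn z to the angle of the centre, at a cost of at most |z| gam, then move along the ray
    by less than h. *)
Lemma cellset_ctr c z : cellset c z -> enorm (z - ctr c) <= h + r 0%N * gam.
Proof.
move=> cz; have /andP[z1 z2] := cellset_block cz.
have [h1 h2 [t zt /andP[t1 t2]]] := cellsetP cz.
apply: (le_trans (enorm_triangle (polar (enorm z) ((idx c)%:~R * gam)) _ _)).
have -> : polar (enorm z) ((idx c)%:~R * gam) - ctr c =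
   ((enorm z - rad (blk c) (lev c)) * (polar 1 ((idx c)%:~R * gam)).1,
    (enorm z - rad (blk c) (lev c)) * (polar 1 ((idx c)%:~R * gam)).2).
  by rewrite /ctr /polar; apply/eqP; rewrite xpair_eqE /=; apply/andP; split; apply/eqP; ring.
rewrite enormZ enorm_polar// mulr1 addrC; apply: lerD.
  rewrite /rad ler_norml; move: h1 h2; rewrite !mulrDl !mul1r => h1 h2.
  by have := h0; move=> h0'; apply/andP; split; lra.
have -> : z - polar (enorm z) ((idx c)%:~R * gam) =
   (enorm z * (polar 1 t - polar 1 ((idx c)%:~R * gam)).1,
    enorm z * (polar 1 t - polar 1 ((idx c)%:~R * gam)).2).
  rewrite {1}zt; rewrite /polar; apply/eqP; rewrite xpair_eqE /=; apply/andP; split; apply/eqP; ring.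
rewrite enormZ ger0_norm ?enorm_ge0//; apply: ler_pM; rewrite ?enorm_ge0//.
  by rewrite (le_trans (ltW z2))// r_le.
apply: (le_trans (enorm_polar_sub _ _)); rewrite idx_gam.
by move: t1 t2; rewrite !mulrDl !mul1r ler_norml => t1 t2; apply/andP; split; lra.
Qed.

End Cells.

(** * Paths follow discrete walks *)

Section AngleArithmetic.
Variable R : realFieldType.
Implicit Types (a f s t u d g k c b : R).

Lemma angle_in_cell u s a t g : a <= t -> t < a + (g + g) ->
  - g <= t + (u + u) - (s + (a + 2^-1 * (g + g) - s + (u + u))) <= g.
Proof. by move=> h1 h2; apply/andP; split; lra. Qed.

Lemma angle_truncation t s d g k c : - g <= t - (s + d) -> t - (s + d) <= g ->
  - k <= t - s -> t - s <= k -> k <= c - g -> - c <= d <= c.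
Proof. by move=> h1 h2 h3 h4 h5; apply/andP; split; lra. Qed.

Lemma angle_quarter t u s c k : - c <= u - s -> u - s <= c -> - k <= t - u -> t - u <= k ->
  c <= 1 / 16 -> k <= 1 / 16 -> - (1 / 4) <= t - s <= 1 / 4.
Proof. by move=> h1 h2 h3 h4 h5 h6; apply/andP; split; lra. Qed.

Lemma angle_lower t u s d f g k b : - k <= t - u -> - g <= u - (s + d) -> g + k <= b -> f <= d ->
  s + f - b <= t.
Proof. by lra. Qed.

Lemma angle_upper t u s d c g k b : t - u <= k -> u - (s + d) <= g -> g + k <= b -> d <= c ->
  t <= s + c + b.
Proof. by lra. Qed.

End AngleArithmetic.

Section Matching.
Context {R : realType}.
Implicit Types (X Y Z p v x z : plane R).
Variable N : set (plane R).
Hypothesis N0 : N origin.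
Hypothesis Nfin : forall r : R, finite_set (N `&` [set z | enorm z < r]).
Hypothesis Nuniq : forall X, N X -> X <> origin -> unique_nearest N X.
Local Notation anc := (anc N).
Local Notation iterA k := (iter k anc).
Variables (rin rout W eta : R) (K : nat).
Hypothesis rin0 : 0 < rin.
Hypothesis W0 : 0 < W.
Hypothesis eta0 : 0 < eta.
Hypothesis dense : forall p, rin <= enorm p <= rout ->
  exists z, [/\ N z, enorm z < enorm p & enorm (p - z) <= W].
Hypothesis sparse : forall v : nat -> plane R, (forall i, (i <= K)%N -> N (v i)) ->
  (forall i j, (i < j <= K)%N -> enorm (v j) < enorm (v i)) ->
  (forall i, (i < K)%N -> enorm (v i - v i.+1) <= W) -> rin <= enorm (v K) ->
  enorm (v 0%N) <= rout -> enorm (v 0%N) - enorm (v K) <= eta -> False.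
Local Notation kap := (kap W eta K).

Variables (J q m0 m' m1 : nat) (r : nat -> R) (M h : R).
Hypothesis rS : forall j, r j.+1 = r j - M.
Hypothesis M0 : 0 < M.
Hypothesis h0 : 0 < h.
Hypothesis qh : q%:R * h = M.
Hypothesis m3 : (2 < m1.+1)%N.
Hypothesis mE : m1.+1 = (m0 * m')%N.
Hypothesis m00 : (0 < m0)%N.
Hypothesis m'0 : (0 < m')%N.
Hypothesis rJ : rin <= r J.
Hypothesis rout0 : r 0%N <= rout.
Local Notation m := m1.+1.
Local Notation gam := (@gam R m1).
Local Notation cell := (cell J q m1).
Implicit Types (c : cell).
Local Notation cellset := (cellset r h).
Local Notation ctr := (ctr r h).
Local Notation rad := (rad r h).
Let delta : R := 2 * pi / m0%:R.
Local Notation start j i := (polar (r j) (i%:~R * delta)).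

Variable om : {ffun cell -> bool}.
Hypothesis omP : forall c, om c <-> exists2 z, N z & cellset c z.

Variable g : R.
Hypothesis gh : 4 * (h + r 0%N * gam) <= g.
Definition in_range z := r J <= enorm z /\ enorm z < r 0%N.
Hypothesis no_norm_tie : forall X Y, N X -> N Y -> X <> Y -> in_range X -> in_range Y ->
  g < `|enorm X - enorm Y|.
Definition no_tie x := forall Y Z, N Y -> N Z -> Y <> Z -> in_range Y -> in_range Z ->
  Y <> x -> Z <> x -> g < `|enorm (x - Y) - enorm (x - Z)|.
Hypothesis no_dist_tie : forall X, N X -> in_range X -> no_tie X.

Let rJ0 : 0 < r J. Proof. exact: lt_le_trans rJ. Qed.
Let rle : forall i j, (i <= j)%N -> r j <= r i. Proof. exact: r_le rS M0. Qed.
Let g0 : 0 < gam. Proof. exact: gam_gt0. Qed.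

Let cblock c z : cellset c z -> r (blk c).+1 <= enorm z < r (blk c).
Proof. by apply: cellset_block. Qed.
Let cinj c c' z : cellset c z -> cellset c' z -> c = c'.
Proof. by apply: cellset_inj. Qed.
Let ccover j z : (j < J)%N -> r j.+1 <= enorm z < r j -> exists2 c : cell, blk c = j & cellset c z.
Proof. by apply: cellset_cover. Qed.
Let cctr c z : cellset c z -> enorm (z - ctr c) <= h + r 0%N * gam.
Proof. by apply: cellset_ctr. Qed.

(** By the absence of ties the ancestor wins by more than g. Passing from x to the current walk
    position affects both distances, and passing from the two points to the centres of their cells
    affects one each: four errors of at most h + r 0 gam, which [gh] allows. *)
Lemma nearest_cell_anc j (s : R) k b x ca : (j < J)%N ->
  generic N x -> no_tie x -> r j.+1 <= enorm (anc x) -> enorm x <= r j ->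
  enorm (x - polar s (k%:~R * gam)) <= h + r 0%N * gam ->
  (forall c z, N z -> cellset c z -> blk c = j -> (lev c < b)%N -> enorm z < enorm x) ->
  cellset ca (anc x) -> blk ca = j -> (lev ca < b)%N ->
  nearest_cell rad j om s k b ca.
Proof.
move=> jJ gx ntx ax xj xs low ca_x caj cab.
have [Na ax' hnear] := gx.
apply/andP; split; first by apply/and3P; split=> //; [exact/eqP|apply/omP; exists (anc x)].
apply/forallP => c'; apply/implyP => /and3P[/eqP c'j omc' c'b]; apply/implyP => c'ne.
have [z Nz c'z] := (omP c').1 omc'.
have za : z <> anc x.
  move=> e; rewrite e in c'z; move/eqP: c'ne; apply.
  exact: (cinj c'z ca_x).
have zx := low c' z Nz c'z c'j c'b.
have lt_xz := hnear z Nz zx za.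
have J1 : r J <= r j.+1 by apply: rle.
have J0 : r j <= r 0%N by apply: rle.
have /andP[z1 z2] := cblock c'z.
rewrite c'j in z1 z2.
have gap : enorm (x - anc x) + g < enorm (x - z).
  have az : anc x <> z by move=> e; apply: za.
  have := @ntx (anc x) z Na Nz az.
  rewrite ltr0_norm ?subr_lt0// opprB ltrBrDl; apply.
  - by split; [exact: le_trans J1 ax|exact: lt_le_trans (lt_le_trans ax' xj) J0].
  - by split; [exact: le_trans J1 z1|exact: lt_le_trans z2 J0].
  - by move=> e; move: ax'; rewrite e ltxx.
  - by move=> e; move: zx; rewrite e ltxx.
rewrite !dist2E ltr_pXn2r// ?nnegrE ?enorm_ge0// -/(ctr ca) -/(ctr c').
have d1 := cctr ca_x.
have d2 := cctr c'z.
move: xs; set y := polar s _ => xs.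
have t1 := enorm_triangle x y (ctr ca); have t2 := enorm_triangle (anc x) x (ctr ca).
have t3 := enorm_triangle y x z; have t4 := enorm_triangle (ctr c') y z.
rewrite (enormN y x) in t1 t3; rewrite (enormN (ctr c') z) in t4.
move: gh gap d1 d2 xs t1 t2 t3 t4.
move: (h + _) (enorm _) (enorm (x - z)) (enorm (x - y)) (enorm (y - ctr ca)) (enorm (anc x - ctr ca))
  (enorm (x - ctr ca)) (enorm (y - z)) (enorm (y - ctr c')) (enorm (z - ctr c')).
move=> a1 a2 a3 a4 a5 a6 a7 a8 a9 a10 b1 b2 b3 b4 b5 b6 b7 b8 b9; lra.
Qed.

Variable stop : nat.
Hypothesis stopW : W <= stop%:R * h.
Hypothesis stopq : (stop < q)%N.

(** Invariant: among the points of block j, those of level below b are exactly those lower than x.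
    Levels strictly decrease, so b units of fuel suffice. Above the level [stop], [stopW] keeps the
    next vertex inside the block, where the walk can see it. *)
Lemma walk_anc j n (s : R) k b x : (j < J)%N -> (b <= n)%N -> generic N x -> no_tie x ->
  r j.+1 + stop%:R * h <= enorm x -> enorm x <= r j ->
  enorm (x - polar s (k%:~R * gam)) <= h + r 0%N * gam ->
  (forall c z, N z -> cellset c z -> blk c = j -> (lev c < b)%N -> enorm z < enorm x) ->
  (forall c z, N z -> cellset c z -> blk c = j -> enorm z < enorm x -> (lev c < b)%N) ->
  exists L c, [/\ walk rad stop j om n s k b = Some c, (0 < L)%N,
    cellset c (iterA L x) /\ blk c = j, enorm (iterA L x) < r j.+1 + stop%:R * h &
    forall l, (l < L)%N -> r j.+1 + stop%:R * h <= enorm (iterA l x)].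
Proof.
move=> jJ; elim: n s k b x => [|n IH] s k b x bn gx ntx xlow xtop xs low high.
all: have J1 : r J <= r j.+1 by apply: rle.
all: have J0 : r j <= r 0%N by apply: rle.
all: have [Na ax _] := gx.
all: have r1 : rin <= r j.+1 by apply: le_trans rJ J1.
all: have sh0 : 0 <= stop%:R * h by rewrite mulr_ge0// ltW.
all: have xrin : rin <= enorm x <= rout by
  apply/andP; split; [apply: le_trans xlow; apply: (le_trans r1); rewrite lerDl
    |apply: (le_trans xtop); exact: le_trans rout0].
all: have stepx : enorm (x - anc x) <= W by apply: (generic_step dense).
all: have ar : r j.+1 <= enorm (anc x) by
  have := enorm_le_sub x (anc x); have := stopW; move: stepx xlow; lra.
all: have ablock : r j.+1 <= enorm (anc x) < r j by rewrite ar (lt_le_trans ax).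
all: have [ca caj ca_x] := ccover jJ ablock.
all: have cab : (lev ca < b)%N by exact: high ca_x caj ax.
  by move: cab; rewrite ltnNge (leq_trans bn).
have nc := nearest_cell_anc jJ gx ntx ar xtop xs low ca_x caj cab.
rewrite /= (pick_nearest_cell nc).
have [l1 l2 _] := cellsetP m3 ca_x.
case: ifP => castop.
  exists 1%N, ca; split => //.
    rewrite /= caj in l2 *; apply: (lt_le_trans l2); rewrite lerD2l ler_wpM2r ?(ltW h0)//.
    by rewrite natr1 ler_nat.
  by move=> [|//] _.
have alow : r j.+1 + stop%:R * h <= enorm (anc x).
  rewrite caj in l1; apply: le_trans l1; rewrite lerD2l ler_wpM2r ?(ltW h0)//.
  by rewrite ler_nat leqNgt castop.
have apos : 0 < enorm (anc x) by apply: lt_le_trans rin0 (le_trans r1 ar).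
have aO : anc x <> origin by move=> e; move: apos; rewrite e enorm0 ltxx.
have atop := lt_le_trans ax xtop.
have arange : in_range (anc x).
  by split; [exact: le_trans J1 ar|exact: lt_le_trans atop J0].
have ga : generic N (anc x) by apply: generic_N.
have low' c z : N z -> cellset c z -> blk c = j -> (lev c < lev ca)%N -> enorm z < enorm (anc x).
  move=> Nz cz cj clev; have [_ z2 _] := cellsetP m3 cz.
  apply: (lt_le_trans z2); apply: le_trans l1; rewrite cj caj lerD2l ler_wpM2r ?(ltW h0)//.
  by rewrite natr1 ler_nat.
(* A point lower than the ancestor but not of smaller level would have a norm within h of that of
   the ancestor, a tie. *)
have high' c z : N z -> cellset c z -> blk c = j -> enorm z < enorm (anc x) -> (lev c < lev ca)%N.
  move=> Nz cz cj za; rewrite ltnNge; apply/negP => lec.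
  have [z1 z2 _] := cellsetP m3 cz; rewrite cj in z1 z2; rewrite caj in l2.
  have zb := cblock cz; rewrite cj in zb.
  case/andP: zb => zb1 zb2.
  have zne : z <> anc x by move=> e; move: za; rewrite e ltxx.
  have zrange : in_range z.
    by split; [exact: le_trans J1 zb1|exact: lt_le_trans zb2 J0].
  have := no_norm_tie Nz Na zne zrange arange.
  rewrite ltr0_norm ?subr_lt0// opprB => gap.
  have lec' : (lev ca)%:R * h <= (lev c)%:R * h by rewrite ler_wpM2r ?(ltW h0)// ler_nat.
  have g1 : 0 <= r 0%N * gam.
    by rewrite mulr_ge0 ?(ltW g0)// (le_trans (ltW rin0))// (le_trans rJ)// rle.
  have := gh; have := h0; move: gap l2 z1 lec' g1; rewrite mulrDl mul1r.
  by move: (_ * gam) => gg; lra.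
have [L [c [wc L0 [cL cj] Lstop Lbig]]] := IH (rad (blk ca) (lev ca)) (idx ca) (lev ca) (anc x)
  (leq_trans cab bn : (lev ca <= n)%N) ga (no_dist_tie Na arange) alow (ltW atop)
  (cctr ca_x) low' high'.
exists L.+1, c; split => //; rewrite ?iterSr//.
move=> [|l] lL; first by [].
by rewrite iterSr; apply: Lbig.
Qed.

Variables (cm : int) (B : nat).
Hypothesis cm0 : 0 <= cm.
Hypothesis cm_lt : cm < m%:Z.
Hypothesis kapM : kap M <= rin / 64.
Hypothesis cm_le : 4 * kap M / rin <= (cm%:~R - 1) * gam.
Hypothesis B_le : gam + 4 * kap (stop%:R * h) / rin <= B%:R * delta.
Hypothesis generic_start : forall j i, (j < J)%N -> generic N (start j i).
Hypothesis no_tie_start : forall j i, (j < J)%N -> no_tie (start j i).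

Lemma delta_gam : delta = 2 * m'%:R * gam.
Proof.
have e : m%:R = m0%:R * m'%:R :> R by rewrite mE natrM.
rewrite /delta gamE e; field.
by rewrite !pnatr_eq0 -!lt0n m00 m'0.
Qed.

Let delta0 : 0 < delta.
Proof. by rewrite delta_gam mulr_gt0// mulr_gt0// ltr0n. Qed.

Lemma at_level_suffix p l (s : R) y : at_level N p s y ->
  (forall i, (i <= l)%N -> s <= enorm (iterA i p)) -> at_level N (iterA l p) s y.
Proof.
move=> [k [sk ks] ->] hl.
have lk : (l <= k)%N.
  by rewrite leqNgt; apply/negP => kl; have := hl k.+1 kl; rewrite leNgt ks.
exists (k - l)%N; last by rewrite -!iterD addSn subnK.
split; last by rewrite -iterD addSn subnK.
by move=> i ik; rewrite -iterD; apply: sk; rewrite -(subnK lk) leq_add2r.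
Qed.

(** Let V be the first vertex of the path within [stop] levels of the inner circle. The walk ends in
    the cell of V, which gives its angle up to [gam]; from V to the circle the angle changes by at
    most 4 kap (stop h) / rin. [B_le] pays for both. *)
Lemma start_step j i y : (j < J)%N -> at_level N (start j i) (r j.+1) y ->
  exists t, [/\ y = polar (r j.+1) t, `|t - i%:~R * delta| <= 1 / 4,
    (lower rad stop cm q r m' B j om i)%:~R * delta <= t &
    t <= (upper rad stop cm q r m' B j om i)%:~R * delta].
Proof.
move=> jJ; set x := start j i => ly.
have rj0 : 0 < r j by apply: lt_le_trans rJ0 (rle (ltnW jJ)).
have nx : enorm x = r j by rewrite enorm_polar// ltW.
have gx : generic N x by exact: generic_start.
have ntx : no_tie x by exact: no_tie_start.
have M1 : r j = r j.+1 + M by rewrite rS subrK.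
have stopM : stop%:R * h <= M by rewrite -qh ler_wpM2r ?(ltW h0)// ler_nat ltnW.
have sh0 : 0 <= stop%:R * h by rewrite mulr_ge0// ltW.
have J1 : r J <= r j.+1 by apply: rle.
have J0 : r j <= r 0%N by apply: rle.
have r1 : rin <= r j.+1 by apply: le_trans rJ J1.
have r10 : 0 < r j.+1 by apply: lt_le_trans r1.
pose k0 := 2 * m'%:Z * i.
have k0E : k0%:~R * gam = i%:~R * delta.
  by rewrite delta_gam /k0 !intrM -[(m'%:Z)%:~R]/(m'%:R : R); ring.
have [|||||L [c [wc L0 [cL cj] Lstop Lbig]]] := @walk_anc j q (r j) k0 q x jJ (leqnn q) gx ntx.
- by rewrite nx M1 lerD2l.
- by rewrite nx.
- rewrite k0E enorm_subxx addr_ge0 ?(ltW h0)// mulr_ge0 ?(ltW g0)//.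
  exact: le_trans (ltW rj0) J0.
- move=> c z Nz cz cj _; have := cblock cz.
  by rewrite cj nx => /andP[].
- by move=> c z Nz cz cj _; exact: ltn_ord.
set V := iterA L x in cL Lstop.
have VJ1 : r j.+1 <= enorm V.
  by have /andP[] := cblock cL; rewrite cj.
have Vbig l : (l <= L)%N -> r j.+1 <= enorm (iterA l x).
  rewrite leq_eqVlt => /orP[/eqP -> //|/Lbig]; apply: le_trans.
  by rewrite lerDl.
have xrout : enorm x <= rout by rewrite nx; exact: le_trans J0 rout0.
have xV : enorm (x - V) <= kap M.
  have lat := lateral N0 Nfin Nuniq rin0 W0 eta0 dense sparse gx; apply: (lat L) => //.
  - by move=> l /Vbig; apply: le_trans.
  - by rewrite nx -/V; move: VJ1 M1; lra.
have V0 : 0 < enorm V by apply: lt_le_trans VJ1.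
have Vpos l : (l <= L)%N -> 0 < enorm (iterA l x).
  by move=> /Vbig; apply: lt_le_trans.
have gV : generic N V by apply: generic_iter.
have lyV : at_level N V (r j.+1) y by apply: at_level_suffix.
have [||t' Vt' nt'] := @polar_near R (r j) (i%:~R * delta) V (kap M) rj0.
- by rewrite enormN.
- by have := kapM; have := rin0; move: r1 M1; have := M0; lra.
have kapM0 : 0 <= kap M by apply: kap_ge0 => //; exact: ltW.
have rinj : rin <= r j by rewrite M1; have := M0; move: r1; lra.
have nt1 : `|t' - i%:~R * delta| <= 4 * kap M / rin.
  apply: (le_trans nt'); apply: ler_wpM2l; first by move: kapM0; lra.
  by rewrite lef_pV2 ?posrE.
have nt2 : 4 * kap M / rin <= 1 / 16.
  by rewrite ler_pdivrMr//; have := kapM; lra.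
have kstop : kap (stop%:R * h) <= kap M.
  rewrite kapE ler_wpM2r ?(ltW W0)// lerD2r ler_wpM2r// lerD2r.
  by rewrite ler_wpM2r// invr_ge0 ltW.
have Vrout : enorm V <= rout.
  apply: le_trans xrout; apply/ltW/(@enorm_iter_lt _ N N0 Nfin Nuniq x 0 L) => // l lL.
  by apply: Vpos; exact: ltnW.
have Vy : enorm (V - y) <= kap (stop%:R * h).
  apply: (at_level_near N0 Nfin Nuniq rin0 W0 eta0 dense sparse gV lyV) => //.
  by move: Lstop; lra.
have rinV : rin <= enorm V by exact: le_trans VJ1.
have ks0 : 0 <= kap (stop%:R * h) by apply: kap_ge0.
have [||t yt nt] := @polar_near R (enorm V) t' y (kap (stop%:R * h)) V0.
- by rewrite -Vt' enormN.
- by have := kapM; have := rin0; move: kstop rinV; lra.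
have [_ ny _] := at_level_generic N0 Nfin Nuniq gV r10 lyV.
have nt3 : `|t - t'| <= 4 * kap (stop%:R * h) / rin.
  apply: (le_trans nt); apply: ler_wpM2l; first by move: ks0; lra.
  by rewrite lef_pV2 ?posrE.
have nt4 : 4 * kap (stop%:R * h) / rin <= 1 / 16.
  by apply: le_trans nt2; rewrite ler_wpM2r ?invr_ge0 ?(ltW rin0)// ler_wpM2l.
have [_ _ [tV VtV /andP[tV1 tV2]]] := cellsetP m3 cL.
have [z ez] : exists z : int, t' = tV + 2 * pi * z%:~R.
  by apply: (polar_inj V0); rewrite -Vt' -VtV.
(* The walk knows the angle only modulo full turns; z restores the turn along the actual path. *)
pose d := idx c - k0 + 2 * m%:Z * z.
have dE : d%:~R * gam = (idx c)%:~R * gam - i%:~R * delta + 2 * pi * z%:~R.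
  rewrite /d intrD intrB mulrDl mulrBl k0E; congr (_ + _).
  by rewrite !intrM -[(m%:Z)%:~R]/(m%:R : R) -(gam_m m1); ring.
have td : `|t' - (i%:~R * delta + d%:~R * gam)| <= gam.
  rewrite dE ez idx_gam ler_norml; move: tV1 tV2; rewrite !mulrDl !mul1r.
  move: (_ * z%:~R) (i%:~R * delta) (c.2%:R * _) => a1 a2 a3 s1 s2.
  exact: angle_in_cell.
(* The actual displacement is within the truncation, so [wrap] returns d and not its default
   value. *)
have dcm : `|d| <= cm.
  rewrite -(ler_int R) intr_norm -(ler_pM2r g0) -{1}(gtr0_norm g0) -normrM.
  have := cm_le; move: td nt1; rewrite !ler_norml mulrBl mul1r => /andP[u1 u2] /andP[u3 u4] u5.
  exact: angle_truncation u1 u2 u3 u4 u5.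
have dispE : disp rad stop cm j om k0 q (r j) = d.
  rewrite /disp wc; have -> : idx c - k0 = d + 2 * m%:Z * (- z) by rewrite /d; ring.
  exact: wrap_small.
have m'n : m'%:R != 0 :> R by rewrite pnatr_eq0 -lt0n.
have sE : step_disp rad stop cm q r m' j om i * delta = d%:~R * gam.
  by rewrite /step_disp dispE delta_gam; field.
set S := step_disp rad stop cm q r m' j om i in sE.
move: nt1 nt3 td; rewrite !ler_norml => /andP[u1 u2] /andP[u3 u4] /andP[u5 u6].
have := B_le => u7.
have fl : (Num.floor S)%:~R * delta <= S * delta.
  by rewrite ler_pM2r//; case/andP: (floor_itv S).
have cl : S * delta <= (Num.ceil S)%:~R * delta.
  by rewrite ler_pM2r// ceil_ge.
rewrite sE in fl cl.
exists t; split.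
- by rewrite {1}yt ny.
- by rewrite ler_norml; exact: angle_quarter u1 u2 u3 u4 nt2 nt4.
- rewrite /lower -/S intrB intrD mulrBl mulrDl -[(B%:Z)%:~R]/(B%:R : R).
  exact: angle_lower u3 u5 u7 fl.
- rewrite /upper -/S !intrD !mulrDl -[(B%:Z)%:~R]/(B%:R : R).
  exact: angle_upper u4 u6 u7 cl.
Qed.

End Matching.

(** * Areas *)

Lemma eq_of_ltS (a b : nat) : (b < a.+1)%N -> (a < b.+1)%N -> a = b.
Proof. lia. Qed.

Section Affine1.
Context {R : realType}.
Local Notation leb := (@lebesgue_measure R).
Variables (a b : R).
Hypothesis a0 : 0 < a.

Let f (x : measurableTypeR R) : measurableTypeR R := a * x + b.

Lemma measurable_affine : measurable_fun [set: measurableTypeR R] f.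
Proof. by apply: measurable_funD => //; apply: measurable_funM. Qed.

Let mu (A : set (measurableTypeR R)) : \bar R := (a%:E * leb (f @^-1` A))%E.

Let mf (A : set (measurableTypeR R)) : measurable A -> measurable (f @^-1` A).
Proof. by move=> mA; rewrite -[X in measurable X]setTI; exact: measurable_affine. Qed.

Let mu0 : mu set0 = 0%E.
Proof. by rewrite /mu preimage_set0 measure0 mule0. Qed.

Let mu_ge0 A : (0 <= mu A)%E.
Proof. by rewrite mule_ge0// lee_fin ltW. Qed.

Let mu_sigma_additive : semi_sigma_additive mu.
Proof.
move=> F mF tF mUF; rewrite /mu preimage_bigcup.
rewrite (_ : (fun n => _) = (fun n => a%:E * \sum_(0 <= i < n) leb (f @^-1` (F i)))%E); last first.
  by apply/funext => n; rewrite ge0_sume_distrr.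
apply: cvgeZl => //; apply: measure_semi_sigma_additive.
- by move=> i; exact: mf.
- apply/trivIsetP => /= i j _ _ ij; rewrite -preimage_setI.
  by move/trivIsetP : tF => /(_ _ _ _ _ ij) ->//; rewrite preimage_set0.
- by rewrite -preimage_bigcup; exact: mf.
Qed.

HB.instance Definition _ := isMeasure.Build _ _ _ mu mu0 mu_ge0 mu_sigma_additive.

(** The rescaled pullback [mu] is a measure that agrees with Lebesgue measure on half-open
    intervals, hence everywhere. *)
Lemma lebesgue_measure_affine (A : set R) : measurable A ->
  (leb ((fun x => a * x + b)%R @^-1` A) = (a^-1)%:E * leb A)%E.
Proof.
move=> mA; suff H : forall X, ocitv X -> leb X = mu X.
  by rewrite (_ : leb A = mu A); 
    [rewrite /mu muleA -EFinM mulVf ?gt_eqF// mul1e|exact: (@lebesgue_measure_unique R mu H)].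
move=> X oX; have /ocitvP[->|[[x y] /= xy ->]] := oX.
  by rewrite /mu preimage_set0 !measure0 mule0.
  rewrite /mu (_ : f @^-1` _ = `]((x - b) / a), ((y - b) / a)]%classic); last first.
    apply/seteqP; split => z; rewrite /f/= !in_itv/= ltr_pdivrMr// ler_pdivlMr// [z * a]mulrC.
      by move=> /andP[h1 h2]; apply/andP; split; lra.
    by move=> /andP[h1 h2]; apply/andP; split; lra.
  rewrite !lebesgue_measure_itv/= !lte_fin xy ltr_pM2r ?invr_gt0// ltrD2r xy.
  by rewrite -!EFinD -EFinM; congr (_%:E); field; rewrite gt_eqF.
Qed.

End Affine1.

Section LebesguePlane.
Context {R : realType}.
Implicit Types (A B : set (plane R)) (z : plane R).
Local Notation leb := (@lebesgue_measure R).
Local Notation leb2 := (@lebesgue_plane R).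

(** Stated with preimages, so k is the inverse of the Jacobian. *)
Definition scales (k : R) (f : plane R -> plane R) := measurable_fun [set: plane R] f /\
  forall A, measurable A -> leb2 (f @^-1` A) = (k%:E * leb2 A)%E.

Lemma measurable_preimage (f : plane R -> plane R) A :
  measurable_fun [set: plane R] f -> measurable A -> measurable (f @^-1` A).
Proof. by move=> mf mA; rewrite -[X in measurable X]setTI; exact: mf. Qed.

Lemma scales_comp k l f g : scales k f -> scales l g -> scales (k * l) (f \o g).
Proof.
move=> [mf kf] [mg lg]; split; first exact: measurableT_comp.
move=> A mA; rewrite comp_preimage lg; last exact: measurable_preimage.
by rewrite kf// muleA -EFinM mulrC.
Qed.

(** Tonelli's theorem for an indicator function: vertical and horizontal sections compute the same
    area. *)
Lemma scales_swap : scales 1 (fun z => (z.2, z.1)).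
Proof.
have mS : measurable_fun [set: plane R] (fun z => (z.2, z.1)) by exact: measurable_swap.
split=> // A mA; rewrite mul1e.
have := @indic_fubini_tonelli _ _ _ _ R leb leb A mA.
have hG : (\int[leb]_y fubini_G leb (EFin \o \1_A) y = \int[leb]_y (leb \o ysection A) y)%E.
  by apply: eq_integral => y _; rewrite indic_fubini_tonelli_GE.
have hF : (\int[leb]_y fubini_F leb (EFin \o \1_A) y = leb2 A)%E.
  by apply: eq_integral => y _; rewrite indic_fubini_tonelli_FE.
rewrite hG hF => ->; rewrite /lebesgue_plane /product_measure1; apply: eq_integral => x _ /=.
congr (leb _); apply/seteqP; split => y; rewrite /xsection /ysection /=.
all: by rewrite !inE.
Qed.

Lemma scales_skew (a b c : R) : 0 < a ->
  scales a^-1 (fun z => (z.1, a * z.2 + b * z.1 + c)).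
Proof.
move=> a0; have mf : measurable_fun [set: plane R] (fun z => (z.1, a * z.2 + b * z.1 + c)).
  apply: measurable_fun_pair => //; apply: measurable_funD => //.
  by apply: measurable_funD; apply: measurable_funM.
split=> // A mA; rewrite /lebesgue_plane /product_measure1 -ge0_integralZl//; last 2 first.
- exact: measurable_fun_xsection.
- by rewrite lee_fin invr_ge0 ltW.
apply: eq_integral => x _ /=; rewrite -(@lebesgue_measure_affine _ a (b * x + c))//; last first.
  exact: measurable_xsection.
by congr (leb _); apply/seteqP; split => y; rewrite /xsection /= !inE/= addrA.
Qed.

Lemma scales_skew' (a b c : R) : 0 < a ->
  scales a^-1 (fun z => (a * z.1 + b * z.2 + c, z.2)).
Proof.
move=> a0; have := scales_comp (scales_comp scales_swap (scales_skew b c a0)) scales_swap.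
by rewrite mul1r mulr1.
Qed.

Lemma scales_translate (c : plane R) : scales 1 (fun z => z + c).
Proof.
have := scales_comp (scales_skew 0 c.2 ltr01) (scales_skew' 0 c.1 ltr01).
rewrite invr1 mul1r (_ : _ \o _ = fun z => z + c)//.
by apply/funext => -[x y]; case: c => c d; rewrite /= !mul1r !mul0r !addr0.
Qed.

Lemma scales_dilate (a : R) : 0 < a -> scales (a^-1 ^+ 2) (fun z => a *: z).
Proof.
move=> a0; have := scales_comp (scales_skew 0 0 a0) (scales_skew' 0 0 a0).
rewrite (_ : _ \o _ = fun z => a *: z) ?expr2//.
by apply/funext => -[x y]; rewrite /= !mul0r !addr0.
Qed.

Definition rot (t : R) z : plane R := (cos t * z.1 - sin t * z.2, sin t * z.1 + cos t * z.2).

(* A rotation is a product of three shears; the half turn is done in two steps. *)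
Lemma scales_rot t : scales 1 (rot t).
Proof.
have cs (s : R) : cos s ^+ 2 + sin s ^+ 2 = 1 by exact: cos2Dsin2.
have main s : 1 + cos s != 0 -> scales 1 (rot s).
  move=> cn; pose k := sin s / (1 + cos s).
  have sk : scales 1 (fun z => (1 * z.1 + (- k) * z.2 + 0, z.2)).
    by rewrite -[X in scales X](invr1 R); exact: scales_skew'.
  have sh : scales 1 (fun z => (z.1, 1 * z.2 + sin s * z.1 + 0)).
    by rewrite -[X in scales X](invr1 R); exact: scales_skew.
  have := scales_comp (scales_comp sk sh) sk; rewrite !mul1r.
  have e1 : 1 - k * sin s = cos s.
    apply: (mulfI cn); rewrite mulrBr mulr1 (_ : _ * (k * _) = sin s ^+ 2); last by rewrite /k; field.
    by have := cs s; move=> e; nra.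
  have e2 : k * (1 + cos s) = sin s by rewrite /k; field.
  rewrite (_ : _ \o _ = rot s)//.
  apply/funext => -[x y]; rewrite /rot /=; congr pair.
    transitivity ((1 - k * sin s) * x - k * (1 + (1 - k * sin s)) * y); first by ring.
    by rewrite e1 e2.
  by transitivity (sin s * x + (1 - k * sin s) * y); [ring|rewrite e1].
have [h|h] := eqVneq (1 + cos t) 0; last exact: main.
have ct : cos t = -1 by lra.
have c2 : 1 + cos (t / 2) != 0.
  have := cosD (t / 2) (t / 2); rewrite (_ : t / 2 + t / 2 = t) ?ct -?expr2; last by field.
  move=> e.
  have := cs (t / 2); move: e; move: (cos _) (sin _) => x y e e'.
  by apply/eqP => hx; nra.
have := scales_comp (main _ c2) (main _ c2); rewrite mul1r.
rewrite (_ : _ \o _ = rot t)//; apply/funext => -[x y]; rewrite /rot /=.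
have -> : cos t = cos (t / 2 + t / 2) by congr cos; field.
have -> : sin t = sin (t / 2 + t / 2) by congr sin; field.
by rewrite cosD sinD; congr pair; ring.
Qed.

Lemma enorm_rot t z : enorm (rot t z) = enorm z.
Proof.
rewrite /enorm /rot /=; congr Num.sqrt; have := cos2Dsin2 t; case: z => x y /=.
move: (cos t) (sin t) => c s e; transitivity ((c ^+ 2 + s ^+ 2) * (x ^+ 2 + y ^+ 2)); first by ring.
by rewrite e mul1r.
Qed.

Lemma measurable_enorm_sub (c : plane R) : measurable_fun [set: plane R] (fun z => enorm (z - c)).
Proof.
have mS : measurable_fun [set: R] (@Num.sqrt R).
  by apply: continuous_measurable_fun; exact: sqrt_continuous.
apply: (measurableT_comp mS) => /=.
by apply: measurable_funD; apply: measurable_funX; apply: measurable_funB.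
Qed.

Definition disc (c : plane R) (s : R) := [set z | enorm (z - c) < s].

Definition ring_at (c : plane R) (s h : R) := [set z | s <= enorm (z - c) < s + h].

Lemma measurable_disc c s : measurable (disc c s).
Proof.
rewrite (_ : disc c s = (fun z => enorm (z - c)) @^-1` `]-oo, s[%classic).
  rewrite -[X in measurable X]setTI; exact: measurable_enorm_sub.
by apply/seteqP; split => z; rewrite /disc /= in_itv.
Qed.

Lemma measurable_ring c s h : measurable (ring_at c s h).
Proof.
rewrite (_ : ring_at c s h = (fun z => enorm (z - c)) @^-1` `[s, s + h[%classic).
  rewrite -[X in measurable X]setTI; exact: measurable_enorm_sub.
by apply/seteqP; split => z; rewrite /ring_at /= in_itv.
Qed.

Definition square (s : R) (i j : int) : set (plane R) :=
  `[i%:~R * s, (i + 1)%:~R * s[%classic `*` `[j%:~R * s, (j + 1)%:~R * s[%classic.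

Lemma measurable_square s i j : measurable (square s i j).
Proof. by apply: measurableX. Qed.

Lemma area_square s i j : 0 < s -> leb2 (square s i j) = (s ^+ 2)%:E.
Proof.
move=> s0; rewrite /lebesgue_plane /square product_measure1E//.
have H (k : int) : leb `[k%:~R * s, (k + 1)%:~R * s[%classic = s%:E.
  rewrite lebesgue_measure_itv/= lte_fin ltr_pM2r// ltr_int ltrDl ltr01 -EFinD.
  by congr (_%:E); rewrite intrD; ring.
by rewrite [X in (X * _)%E]H [X in (_ * X)%E]H -EFinM expr2.
Qed.

Definition unit_area : R := fine (leb2 (disc 0%R 1)).

Lemma unit_areaE : leb2 (disc 0%R 1) = unit_area%:E.
Proof.
rewrite /unit_area fineK//; apply/fin_numPlt.
rewrite (lt_le_trans _ (measure_ge0 _ _)) ?ltNyr//=.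
have : (leb2 (disc 0%R 1) <= leb2 (`[(-1)%R, 1%R]%classic `*` `[(-1)%R, 1%R]%classic))%E.
  apply: le_measure; rewrite ?inE; [exact: measurable_disc|exact: measurableX|].
  move=> z; rewrite /disc /= subr0 !in_itv/= => z1.
  have e2 := sqr_enorm z; rewrite /dot in e2; have e0 := enorm_ge0 z.
  have z2 : z.1 * z.1 + z.2 * z.2 <= 1 by rewrite -e2 exprn_ile1// ltW.
  have := sqr_ge0 z.1; have := sqr_ge0 z.2; rewrite !expr2 => a1 a2.
  by split; apply/andP; split; nra.
move=> /le_lt_trans; apply; rewrite /lebesgue_plane product_measure1E//.
have H : leb `[(-1)%R, 1%R]%classic = 2%:E.
  rewrite lebesgue_measure_itv/= lte_fin ifT; last by rewrite (@lt_trans _ _ 0)// oppr_lt0.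
  by rewrite -EFinD opprK.
by rewrite [X in (X * _)%E]H [X in (_ * X)%E]H -EFinM ltry.
Qed.

Lemma unit_area_ge0 : 0 <= unit_area.
Proof. by rewrite fine_ge0// measure_ge0. Qed.

Lemma area_disc c s : 0 < s -> leb2 (disc c s) = (s ^+ 2 * unit_area)%:E.
Proof.
move=> s0; have [_ sT] := scales_translate (- c).
have -> : disc c s = (fun z => z + - c) @^-1` disc 0 s.
  by apply/seteqP; split => z; rewrite /disc /= subr0.
rewrite sT ?mul1e; last exact: measurable_disc.
have -> : disc 0 s = (fun z => s^-1 *: z) @^-1` disc 0 1.
  apply/seteqP; split => z; rewrite /disc /= !subr0 enormZ gtr0_norm ?invr_gt0// mulrC ltr_pdivrMr// mul1r//.
have si : 0 < s^-1 by rewrite invr_gt0.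
have [_ ->] := scales_dilate si; last exact: measurable_disc.
by rewrite invrK unit_areaE -EFinM.
Qed.

Lemma area_ring c s h : 0 <= s -> 0 < h ->
  leb2 (ring_at c s h) = ((2 * s * h + h ^+ 2) * unit_area)%:E.
Proof.
move=> s0 h0; have sh : 0 < s + h by rewrite ltr_wpDl.
have [e|sn] := eqVneq s 0.
  have -> : ring_at c s h = disc c h.
    by apply/seteqP; split => z; rewrite /ring_at /disc /= e add0r ?enorm_ge0.
  by rewrite area_disc// e; congr (_%:E); ring.
have s0' : 0 < s by rewrite lt_neqAle eq_sym sn.
have := area_disc c sh.
have -> : disc c (s + h) = disc c s `|` ring_at c s h.
  apply/seteqP; split => z; rewrite /disc /ring_at /=.
    by move=> zs; case: (ltP (enorm (z - c)) s) => ?; [left|right].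
  by move=> [zs|/andP[]//]; rewrite (lt_trans zs)// ltrDl.
have dj : disc c s `&` ring_at c s h = set0.
  apply/seteqP; split => // z; rewrite /disc /ring_at /= => -[zs /andP[]].
  by rewrite leNgt zs.
have -> : leb2 (disc c s `|` ring_at c s h) = (leb2 (disc c s) + leb2 (ring_at c s h))%E.
  exact: (@measureU _ _ _ leb2 _ _ (measurable_disc _ _) (measurable_ring _ _ _) dj).
rewrite area_disc// => e; rewrite (_ : leb2 _ = ((s + h) ^+ 2 * unit_area)%:E - (s ^+ 2 * unit_area)%:E)%E.
  by rewrite -EFinB; congr (_%:E); ring.
by rewrite -e addeAC subee// add0e.
Qed.

Lemma rot_sector t a b : rot t @^-1` sector a b = sector (a - t) (b - t).
Proof.
have e1 x z : cross (polar 1 x) (rot t z) = cross (polar 1 (x - t)) z.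
  by rewrite /cross /rot /polar /= cosB sinB; ring.
have e2 x z : cross (rot t z) (polar 1 x) = cross z (polar 1 (x - t)).
  by rewrite /cross /rot /polar /= cosB sinB; ring.
by apply/seteqP; split => z; rewrite /sector /= e1 e2.
Qed.

Lemma measurable_sector (a b : R) : measurable (sector a b).
Proof.
have mc (p : plane R) : measurable_fun [set: plane R] (cross p).
  by apply: measurable_funB; apply: measurable_funM.
have mc' (p : plane R) : measurable_fun [set: plane R] (fun z => cross z p).
  by apply: measurable_funB; apply: measurable_funM.
rewrite (_ : sector a b = (cross (polar 1 a) @^-1` `[0, +oo[%classic) `&`
    ((fun z => cross z (polar 1 b)) @^-1` `]0, +oo[%classic)).
  by apply: measurableI; rewrite -[X in measurable X]setTI; [exact: mc|exact: mc'].
by apply/seteqP; split => z; rewrite /sector /= !in_itv/= !andbT.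
Qed.

Definition ring_cell (m1 : nat) (s h : R) (a : nat) : set (plane R) :=
  ring_at 0 s h `&` sector (a%:R * (2 * @gam R m1)) (a.+1%:R * (2 * @gam R m1)).

Lemma measurable_ring_cell m1 s h a : measurable (ring_cell m1 s h a).
Proof. by apply: measurableI; [exact: measurable_ring|exact: measurable_sector]. Qed.

Lemma area_ring_cell_rot m1 s h a : leb2 (ring_cell m1 s h a) = leb2 (ring_cell m1 s h 0).
Proof.
have [_ sR] := scales_rot (a%:R * (2 * @gam R m1)).
have := sR _ (measurable_ring_cell m1 s h a); rewrite mul1e => <-; congr leb2.
rewrite /ring_cell preimage_setI rot_sector subrr mul0r -mulrBl -(natrB _ (leqnSn a)) subSnn mul1r.
by congr (_ `&` _); apply/seteqP; split => z; rewrite /ring_at /= !subr0 enorm_rot.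
Qed.

Lemma ring_cell_inj m1 s h a b z : (2 < m1.+1)%N -> (a < m1.+1)%N -> (b < m1.+1)%N ->
  ring_cell m1 s h a z -> ring_cell m1 s h b z -> a = b.
Proof.
move=> m3 am bm [_ /(sectorP _ (arc_itv m3 a)) [z0 [t zt ta]]].
move=> [_ /(sectorP _ (arc_itv m3 b)) [_ [u zu ub]]].
have [k e] := polar_inj (enorm_gt0 z0) (etrans (esym zt) zu).
have pi0 := pi_gt0 R; have g0 := @gam_gt0 R m1; have gm := @gam_m R m1.
have bd (x : nat) v : (x < m1.+1)%N -> x%:R * (2 * @gam R m1) <= v < x.+1%:R * (2 * @gam R m1) ->
    0 <= v < 2 * pi.
  move=> xm /andP[v1 v2]; apply/andP; split.
    by apply: le_trans v1; rewrite !mulr_ge0// ltW.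
  by apply: (lt_le_trans v2); rewrite -gm ler_wpM2r ?ler_nat// mulr_ge0// ltW.
have k0 : k = 0.
  have /andP[a1 a2] := bd _ _ am ta; have /andP[b1 b2] := bd _ _ bm ub.
  have p2 : 0 < 2 * pi :> R by rewrite mulr_gt0.
  apply: int_lt1; rewrite -(ltr_int R) -(ltr_pM2l p2) ;
    [rewrite (_ : (-1)%:~R = -1 :> R)//; lra|rewrite mulr1; lra].
have tu : t = u by rewrite e k0 mulr0 addr0.
have g2 : 0 < 2 * @gam R m1 by rewrite mulr_gt0.
case/andP: ta => a1 a2; case/andP: ub => b1 b2; rewrite tu in a1 a2.
have := le_lt_trans a1 b2; have := le_lt_trans b1 a2; rewrite !ltr_pM2r// !ltr_nat.
exact: eq_of_ltS.
Qed.

(** The m rotated copies of the cell are disjoint, of equal area and contained in the ring. *)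
Lemma area_ring_cell_le m1 s h a : (2 < m1.+1)%N -> 0 <= s -> 0 < h ->
  fine (leb2 (ring_cell m1 s h a)) * m1.+1%:R <= (2 * s * h + h ^+ 2) * unit_area.
Proof.
move=> m3 s0 h0; rewrite -lee_fin -(area_ring 0 s0 h0).
have fin : leb2 (ring_cell m1 s h a) \is a fin_num.
  apply/fin_numPlt; rewrite (lt_le_trans _ (measure_ge0 _ _)) ?ltNyr//=.
  apply: (@le_lt_trans _ _ (leb2 (ring_at 0%R s h))); last by rewrite area_ring// ltry.
  by apply: le_measure; rewrite ?inE; [exact: measurable_ring_cell|exact: measurable_ring|exact: subIsetl].
rewrite EFinM fineK//.
have tr : trivIset setT (fun i : 'I_m1.+1 => ring_cell m1 s h i).
  move=> i j _ _ [z [zi zj]]; apply/val_inj; exact: (ring_cell_inj m3 (ltn_ord i) (ltn_ord j) zi zj).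
have e : leb2 (\big[setU/set0]_(i < m1.+1) ring_cell m1 s h i) = (\sum_(i < m1.+1) leb2 (ring_cell m1 s h i))%E.
  apply: (@measure_bigsetU_ord _ _ _ leb2) => // i; exact: measurable_ring_cell.
have <- : leb2 (\big[setU/set0]_(i < m1.+1) ring_cell m1 s h i) = (leb2 (ring_cell m1 s h a) * (m1.+1%:R)%:E)%E.
  rewrite e (eq_bigr (fun _ => leb2 (ring_cell m1 s h a))); last first.
    by move=> i _; rewrite [LHS]area_ring_cell_rot; exact/esym/area_ring_cell_rot.
  by rewrite -(fineK fin) sumEFin sumr_const card_ord -EFinM mulr_natr.
apply: le_measure; rewrite ?inE; [|exact: measurable_ring|].
  by apply: bigsetU_measurable => i _; exact: measurable_ring_cell.
by move=> z; rewrite -bigcup_mkord_ord => -[i _ []].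
Qed.

Definition rot_cell (m1 : nat) (s h t : R) : set (plane R) :=
  ring_at 0 s h `&` sector t (t + 2 * @gam R m1).

Lemma measurable_rot_cell m1 s h t : measurable (rot_cell m1 s h t).
Proof. by apply: measurableI; [exact: measurable_ring|exact: measurable_sector]. Qed.

Lemma area_rot_cell m1 s h t : leb2 (rot_cell m1 s h t) = leb2 (ring_cell m1 s h 0).
Proof.
have [_ sR] := scales_rot t.
have := sR _ (measurable_rot_cell m1 s h t); rewrite mul1e => <-; congr leb2.
rewrite /rot_cell /ring_cell preimage_setI rot_sector subrr mul0r mul1r (addrC t) addrK.
by congr (_ `&` _); apply/seteqP; split => z; rewrite /ring_at /= !subr0 enorm_rot.
Qed.

Lemma cellset_ring_cell J q m1 (r : nat -> R) h (c : cell J q m1) :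
  cellset r h c = ring_cell m1 (r (blk c).+1 + (lev c)%:R * h) h c.2.
Proof.
by rewrite /cellset /ring_cell; congr (_ `&` _); apply/seteqP; split => z; rewrite /ring_at /annulus_set /= subr0.
Qed.

End LebesguePlane.

(** * Poisson processes *)

Section OuterBounds.
Context {R : realType} d (T : measurableType d) (P : probability T R).
Implicit Types (E F : set T) (x y : R).

(* [E] need not be measurable. *)
Definition ple E x := exists F, [/\ measurable F, E `<=` F & (P F <= x%:E)%E].

Lemma ple_sub E F x y : F `<=` E -> x <= y -> ple E x -> ple F y.
Proof.
move=> FE xy [G [mG EG Gx]]; exists G; split => //; first exact: subset_trans EG.
by apply: le_trans Gx _; rewrite lee_fin.
Qed.

Lemma ple_ge0 E x : ple E x -> 0 <= x.
Proof. by move=> [F [mF _ Fx]]; rewrite -lee_fin (le_trans _ Fx). Qed.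

Lemma ple0 : ple set0 0.
Proof. by exists set0; split => //; rewrite measure0. Qed.

Lemma pleU E F x y : ple E x -> ple F y -> ple (E `|` F) (x + y).
Proof.
move=> [E' [mE EE Ex]] [F' [mF FF Fy]]; exists (E' `|` F'); split.
- exact: measurableU.
- exact: setUSS.
- by apply: le_trans (measureU2 _ mE mF) _; rewrite EFinD leeD.
Qed.

Lemma ple_bigU (I : Type) (s : seq I) (E : I -> set T) (x : I -> R) :
  (forall i, ple (E i) (x i)) -> ple (\big[setU/set0]_(i <- s) E i) (\sum_(i <- s) x i).
Proof.
move=> h; elim: s => [|i s IH]; first by rewrite !big_nil; exact: ple0.
by rewrite !big_cons; apply: pleU.
Qed.

Lemma ple_exists (I : finType) (E : I -> set T) (x : I -> R) :
  (forall i, ple (E i) (x i)) -> ple [set w | exists i, E i w] (\sum_i x i).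
Proof.
move=> h; apply: ple_sub (ple_bigU (index_enum I) h); last exact: lexx.
by move=> w [i Ei]; rewrite -bigcup_seq /=; exists i => //=; rewrite mem_index_enum.
Qed.

Lemma ple_exists_cst (I : finType) (E : I -> set T) x :
  (forall i, ple (E i) x) -> ple [set w | exists i, E i w] (#|I|%:R * x).
Proof.
move=> h; apply: ple_sub (ple_exists h) => //.
by rewrite sumr_const mulr_natl.
Qed.

Lemma ple_negligible E : (forall e : R, 0 < e -> ple E e) -> P.-negligible E.
Proof.
move=> h; have e0 n : 0 < n.+1%:R^-1 :> R by rewrite invr_gt0.
have /choice[F hF] := fun n => h _ (e0 n).
exists (\bigcap_n F n); split.
- by apply: bigcapT_measurable => n; have [] := hF n.
- apply/eqP; rewrite eq_le measure_ge0 andbT; apply/lee_addgt0Pr => e e_gt0; rewrite add0e.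
  have [n] := ltr_add_invr e_gt0; rewrite add0r => hn.
  have [mF _ Fe] := hF n; apply: (@le_trans _ _ (P (F n))).
    apply: le_measure; rewrite ?inE//; last by move=> w /(_ n); apply.
    by apply: bigcapT_measurable => k; have [] := hF k.
  by apply: le_trans Fe _; rewrite lee_fin ltW.
- by move=> w Ew n _; have [_ EF _] := hF n; exact: EF.
Qed.

(** The usual lemma, applied to measurable supersets of the E n. *)
Lemma borel_cantelli (E : nat -> set T) (C : R) :
  (forall n, ple (E n) (C / n.+1%:R ^+ 2)) ->
  P.-negligible [set w | forall n0, exists2 n, (n0 <= n)%N & E n w].
Proof.
move=> /choice[F hF]; have mF n : measurable (F n) by have [] := hF n.
have C0 : 0 <= C by have := ple_ge0 (ex_intro _ _ (hF 0%N)); rewrite expr1n divr1.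
exists (lim_sup_set F); split.
- by apply: bigcapT_measurable => n; exact: bigcup_measurable.
- apply: lim_sup_set_cvg0 => //; apply: (@le_lt_trans _ _ (2 * C)%:E); last exact: ltry.
  apply: lime_le; first exact: is_cvg_nneseries.
  (* Telescoping comparison of the sum of 1 / (i + 1)^2 over i < n with 2 - 2 / (n + 1). *)
  apply: nearW => n; apply: (@le_trans _ _ (C * (2 - 2 / n.+1%:R))%:E); last first.
    by rewrite lee_fin mulrC ler_wpM2r// gerBl divr_ge0.
  elim: n => [|n IH]; first by rewrite big_geq// divr1 subrr mulr0.
  rewrite big_nat_recr//=; have [_ _ Fn] := hF n.
  apply: le_trans (leeD IH Fn) _; rewrite -EFinD lee_fin -mulrDr ler_wpM2l//.
  have n1 : 1 <= n.+1%:R :> R by rewrite ler1n.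
  rewrite -[n.+2%:R]natr1 -addrA lerD2l -subr_ge0.
  move: n1; move: (n.+1%:R : R) => x x1.
  have -> : - (2 / (x + 1)) - (- (2 / x) + (x ^+ 2)^-1) = (x - 1) / (x ^+ 2 * (x + 1)).
    by field; apply/andP; split; lra.
  by rewrite divr_ge0 ?subr_ge0// mulr_ge0 ?sqr_ge0//; lra.
- move=> w h n _; have [m nm Em] := h n; exists m => //.
  by have [_ EF _] := hF m; exact: EF.
Qed.

End OuterBounds.

Section Poisson.
Context {R : realType} d (T : measurableType d) (P : probability T R).
Variable Phi : T -> set (plane R).
Hypothesis hPhi : homogeneous_poisson P 1 Phi.
Local Notation leb2 := (@lebesgue_plane R).
Local Notation cnt := (point_count Phi).
Implicit Types (A : set (plane R)) (a : R) (w : T).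

Definition occupied A w := exists2 z, Phi w z & A z.

Definition many k A w :=
  exists s : seq (plane R), [/\ uniq s, size s = k & forall z, z \in s -> Phi w z /\ A z].

Lemma cnt_eq0 A w : cnt A w = 0%E <-> ~ occupied A w.
Proof.
rewrite /point_count /counting; case: asboolP => h; last first.
  split=> // no; exfalso; apply: h; rewrite (_ : _ `&` _ = set0)//.
  by apply/seteqP; split => // z [z1 z2]; apply: no; exists z.
split=> [[/eqP]|no].
  rewrite pnatr_eq0 size_eq0 => /eqP e [z z1 z2].
  have : (Phi w `&` A) z by split.
  rewrite -{1}(fset_setK h) => /=; rewrite -[is_true _]/(is_true (z \in finmap.enum_fset (fset_set (Phi w `&` A)))).
  by rewrite e.
rewrite (_ : _ `&` _ = set0) ?fset_set0//.
by apply/seteqP; split => // z [z1 z2]; apply: no; exists z.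
Qed.

Lemma many_cnt k A w j : many k A w -> cnt A w = j%:R%:E -> (k <= j)%N.
Proof.
move=> [s [us sk sA]]; rewrite /point_count /counting; case: asboolP => // h [].
move=> /eqP; rewrite eqr_nat => /eqP <-; rewrite -sk.
apply: uniq_leq_size => // z /sA[z1 z2].
have : (Phi w `&` A) z by split.
by rewrite -{1}(fset_setK h).
Qed.

Lemma measurable_cnt_preimage A (B : set (\bar R)) : measurable A -> measurable B ->
  measurable (cnt A @^-1` B).
Proof.
move=> mA mB; have [h _ _] := hPhi; rewrite -[X in measurable X]setTI; exact: h.
Qed.

Lemma prob_cnt A a k : measurable A -> leb2 A = a%:E ->
  P (cnt A @^-1` [set k%:R%:E]) = (expR (- a) * (a ^+ k / k`!%:R))%:E.
Proof.
move=> mA Aa; have [_ h _] := hPhi.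
have a0 : 0 <= a by rewrite -lee_fin -Aa; exact: integral_ge0.
rewrite [LHS](h A mA _ k) ?Aa ?ltry//= mul1r /poisson_prob; case: ifPn => [a_gt0|].
  rewrite esum_set1 ?lee_fin ?poisson_pmf_ge0// /poisson_pmf a_gt0; congr (_%:E); ring.
rewrite -leNgt => a_le0; have -> : a = 0 by apply/eqP; rewrite eq_le a_le0.
rewrite oppr0 expR0 mul1r diracE; case: k => [|k].
  by rewrite mem_set// expr0 fact0 divr1.
by rewrite memNset ?expr0n ?mul0r//= => /eqP.
Qed.

Lemma prob_void A a : measurable A -> leb2 A = a%:E ->
  P (cnt A @^-1` [set 0%E]) = (expR (- a))%:E.
Proof. by move=> mA Aa; rewrite (prob_cnt 0 mA Aa) expr0 fact0 divr1 mulr1. Qed.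

(** Since (i + k)! >= i!, the exponential series from rank k on is at most a^k exp a; thus a Poisson
    variable of mean a reaches k with probability at most a^k. *)
Lemma exp_tail a k : 0 <= a -> 1 - a ^+ k <= \sum_(j < k) expR (- a) * (a ^+ j / j`!%:R).
Proof.
move=> a0; pose S := series (exp_coeff a).
have S_nd : {homo S : m n / (m <= n)%N >-> m <= n}.
  by apply/nondecreasing_seqP => n; rewrite /S seriesSr lerDl exp_coeff_ge0.
have S_le n : S n <= expR a.
  by apply: nondecreasing_cvgn_le => //; exact: is_cvg_series_exp_coeff.
have step n : S n <= S k + a ^+ k * expR a.
  apply: (le_trans (S_nd _ _ (leq_addr k n))); rewrite addnC /S /series /= (big_cat_nat _ (leq_addr n k))//=.
  rewrite lerD2l -{1}[k]add0n [(k + n)%N]addnC big_addn addnK.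
  apply: (@le_trans _ _ (a ^+ k * S n)); last by rewrite ler_wpM2l ?exprn_ge0.
  rewrite /S /series /= big_distrr /=; apply: ler_sum => i _.
  rewrite /exp_coeff /= exprD [a ^+ i * _]mulrC -mulrA ler_wpM2l ?exprn_ge0// ler_wpM2l ?exprn_ge0//.
  by rewrite lef_pV2 ?posrE ?ltr0n ?fact_gt0// ler_nat leq_fact// leq_addr.
have eS : expR a <= S k + a ^+ k * expR a.
  apply: limr_le; first exact: is_cvg_series_exp_coeff.
  exact: nearW.
rewrite -big_distrr /= -(big_mkord xpredT (fun j => a ^+ j / j`!%:R)) -[X in _ * X]/(S k).
rewrite -(ler_pM2l (expR_gt0 a)) mulrA -expRD subrr expR0 mul1r.
by rewrite mulrBr mulr1 lerBlDr [_ * a ^+ k]mulrC.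
Qed.

Lemma ple_many k A a : measurable A -> leb2 A = a%:E -> ple P (many k A) (a ^+ k).
Proof.
move=> mA Aa; have a0 : 0 <= a by rewrite -lee_fin -Aa; exact: integral_ge0.
pose U := \big[setU/set0]_(j < k) (cnt A @^-1` [set j%:R%:E]).
have mU : measurable U by apply: bigsetU_measurable => j _; exact: measurable_cnt_preimage.
exists (~` U); split; first exact: measurableC.
  move=> w mw; rewrite /U -bigcup_seq => -[j _ /= /(many_cnt mw)].
  by rewrite leqNgt ltn_ord.
rewrite probability_setC// (_ : P U = (\sum_(j < k) expR (- a) * (a ^+ j / j`!%:R))%:E).
  by rewrite -EFinB lee_fin; have := exp_tail k a0; lra.
rewrite measure_bigsetU_ord//; last 2 first.
- by move=> j; exact: measurable_cnt_preimage.
- by move=> i j _ _ [w /= [-> [/eqP]]]; rewrite eqr_nat => /eqP e; exact: val_inj.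
by rewrite -sumEFin; apply: eq_bigr => j _; rewrite -(prob_cnt j mA Aa).
Qed.

Lemma ple_empty A a : measurable A -> leb2 A = a%:E ->
  ple P [set w | ~ occupied A w] (expR (- a)).
Proof.
move=> mA Aa; exists (cnt A @^-1` [set 0%E]); split; first exact: measurable_cnt_preimage.
  by move=> w /cnt_eq0.
by rewrite (prob_void mA Aa).
Qed.

Lemma prob_occupied A a : measurable A -> leb2 A = a%:E ->
  P (cnt A @^-1` ~` [set 0%E]) = (1 - expR (- a))%:E.
Proof.
move=> mA Aa; rewrite -[X in P X]/(~` (cnt A @^-1` [set 0%E])) probability_setC; last exact: measurable_cnt_preimage.
by rewrite (prob_void mA Aa).
Qed.

(** The predicate f marks the sets required to be occupied. By independence the probability is a
    product, and 1 - exp (- a) <= a. *)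
Lemma ple_jointly_occupied n (f : 'I_n -> bool) (A : 'I_n -> set (plane R)) (a : 'I_n -> R) :
  (forall i, measurable (A i)) -> (forall i, leb2 (A i) = (a i)%:E) -> trivIset setT A ->
  ple P [set w | forall i, f i -> occupied (A i) w] (\prod_(i < n) if f i then a i else 1).
Proof.
move=> mA Aa tA; have [_ _ ind] := hPhi.
pose B i : set (\bar R) := if f i then ~` [set 0%E] else setT.
have mB i : measurable (B i) by rewrite /B; case: ifP => _ //; exact: measurableC.
have := ind n A mA tA B mB; set F := \bigcap_(i in _) _ => PF.
exists F; split.
- by apply: fin_bigcap_measurable => [|i _]; [exact: finite_finset|exact: measurable_cnt_preimage].
- by move=> w h i _; rewrite /B /=; case: ifP => // fi /cnt_eq0; apply; exact: h.
- rewrite PF (eq_bigr (fun i => (if f i then 1 - expR (- a i) else 1)%:E)); last first.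
    move=> i _; rewrite /B; case: ifP => _; first exact: prob_occupied.
    by rewrite preimage_setT probability_setT.
  rewrite prodEFin lee_fin; apply: ler_prod => i _; case: ifP => _; rewrite ?ler01 ?lexx//.
  have a0 : 0 <= a i by rewrite -lee_fin -Aa; exact: integral_ge0.
  have := expR_ge1Dx (- a i); have : expR (- a i) <= 1 by rewrite -expR0 ler_expR oppr_le0.
  by move=> h1 h2; apply/andP; split; lra.
Qed.

Definition bits (C : finType) (S : C -> set (plane R)) w : {ffun C -> bool} :=
  [ffun c => `[< occupied (S c) w >]].

Definition bit_law (a : R) (b : bool) : R := if b then 1 - expR (- a) else expR (- a).

(** Splitting by the value of the bits leaves finitely many events of product form, to which the
    independence of counts on disjoint sets applies. *)
Lemma ple_bits (C : finType) (S : C -> set (plane R)) (a : C -> R) (G : pred {ffun C -> bool}) :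
  (forall c, measurable (S c)) -> (forall c, leb2 (S c) = (a c)%:E) -> trivIset setT S ->
  ple P [set w | G (bits S w)] (mean (fun c => bit_law (a c)) (fun om => (G om)%:R)).
Proof.
move=> mS Sa tS; have [_ _ ind] := hPhi.
pose B (om : {ffun C -> bool}) (i : 'I_#|C|) : set (\bar R) :=
  if om (enum_val i) then ~` [set 0%E] else [set 0%E].
have mB om i : measurable (B om i) by rewrite /B; case: ifP => _ //; exact: measurableC.
have tA : trivIset setT (fun i : 'I_#|C| => S (enum_val i)).
  by move=> i j _ _ h; apply: enum_val_inj; exact: tS.
have key om : ple P [set w | G om /\ bits S w = om] (weight (fun c => bit_law (a c)) om * (G om)%:R).
  case: (G om) => /=; last by rewrite mulr0; apply: ple_sub (ple0 P) => // w [].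
  rewrite mulr1; have := ind _ _ (fun i => mS (enum_val i)) tA (B om) (mB om).
  set F := \bigcap_(i in _) _ => PF; exists F; split.
  - by apply: fin_bigcap_measurable => [|i _]; [exact: finite_finset|exact: measurable_cnt_preimage].
  - move=> w [_ e] i _; rewrite /B /=.
    have := congr1 (fun f : {ffun C -> bool} => f (enum_val i)) e; rewrite ffunE => <-.
    by case: asboolP => h; [move=> /cnt_eq0|apply/cnt_eq0].
  - rewrite PF /weight (eq_bigr (fun i => (bit_law (a (enum_val i)) (om (enum_val i)))%:E)); last first.
      move=> i _; rewrite /B /bit_law; case: ifP => _; first exact: prob_occupied.
      exact: prob_void.
    by rewrite prodEFin lee_fin [leRHS](reindex _ (onW_bij _ (@enum_val_bij C))).
apply: ple_sub (ple_exists key) => //.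
by move=> w Gw; exists (bits S w).
Qed.

End Poisson.

(** * Grids of squares *)

Section Squares.
Context {R : realType}.
Implicit Types (z c : plane R) (s : R).

Definition corner s (i j : int) : plane R := (i%:~R * s, j%:~R * s).

Lemma square_corner s i j z : 0 < s -> square s i j z -> enorm (z - corner s i j) <= 2 * s.
Proof.
move=> s0 [/=]; rewrite !in_itv/= !intrD !mulrDl !mul1r => /andP[a1 a2] /andP[b1 b2].
rewrite -(@ler_pXn2r _ 2) ?nnegrE ?enorm_ge0 ?mulr_ge0 ?addr_ge0 ?(ltW s0)//.
rewrite sqr_enorm /dot /corner /=; nra.
Qed.

Lemma square_diam_lt s i j z z' : 0 < s -> square s i j z -> square s i j z' -> enorm (z - z') < 2 * s.
Proof.
move=> s0 [/=]; rewrite !in_itv/= !intrD !mulrDl !mul1r => /andP[a1 a2] /andP[b1 b2] [/=].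
rewrite !in_itv/= !intrD !mulrDl !mul1r => /andP[c1 c2] /andP[d1 d2].
rewrite -(@ltr_pXn2r _ 2) ?nnegrE ?enorm_ge0 ?mulr_ge0 ?addr_ge0 ?(ltW s0)//.
rewrite sqr_enorm /dot /=; nra.
Qed.

Lemma square_inj s i j i' j' z : 0 < s -> square s i j z -> square s i' j' z -> i = i' /\ j = j'.
Proof.
move=> s0 [/=]; rewrite !in_itv/= => /andP[a1 a2] /andP[b1 b2] [/=].
rewrite !in_itv/= => /andP[a1' a2'] /andP[b1' b2'].
have H (k l : int) (x : R) : k%:~R * s <= x -> x < (k + 1)%:~R * s ->
    l%:~R * s <= x -> x < (l + 1)%:~R * s -> k = l.
  move=> h1 h2 h3 h4; have := le_lt_trans h1 h4; have := le_lt_trans h3 h2.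
  by rewrite !ltr_pM2r// !ltr_int; clear; lia.
by split; [exact: (H _ _ z.1)|exact: (H _ _ z.2)].
Qed.

Lemma coord_le z : `|z.1| <= enorm z /\ `|z.2| <= enorm z.
Proof.
have e := sqr_enorm z; rewrite /dot in e; have e0 := enorm_ge0 z.
by split; rewrite ler_norml; apply/andP; split; nra.
Qed.

Lemma square_cover s (n : nat) z : 0 < s -> enorm z < n%:R * s ->
  exists i j : 'I_(2 * n), square s ((i : nat)%:Z - n%:Z) ((j : nat)%:Z - n%:Z) z.
Proof.
move=> s0 zn; have [c1 c2] := coord_le z.
have H x : `|x| <= enorm z -> exists2 i : 'I_(2 * n),
    ((i : nat)%:Z - n%:Z)%:~R * s <= x & x < ((i : nat)%:Z - n%:Z + 1)%:~R * s.
  move=> /le_lt_trans/(_ zn); rewrite ltr_norml -mulNr => /andP[x1 x2].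
  have := floor_itv (x / s); set f := Num.floor _.
  rewrite ler_pdivlMr// ltr_pdivrMr// => /andP[f1 f2].
  have fn : - n%:Z <= f.
    rewrite -ltzD1 -(ltr_int R) -(ltr_pM2r s0) (le_lt_trans _ f2)//.
    by rewrite intrN ltW.
  have fn' : f < n%:Z by rewrite -(ltr_int R) -(ltr_pM2r s0); exact: le_lt_trans f1 x2.
  have : (`|(f + n%:Z)%R| < 2 * n)%N by move: fn fn'; clear; lia.
  move=> lt; exists (Ordinal lt) => /=.
    by rewrite (_ : _ - _ = f)//; move: fn; clear; lia.
  by rewrite (_ : _ - _ = f)//; move: fn; clear; lia.
have [i i1 i2] := H _ c1; have [j j1 j2] := H _ c2.
by exists i, j; split; rewrite /= in_itv/=; apply/andP.
Qed.

End Squares.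

(** * Unlikely events: near ties, steep sequences, empty squares *)

Section PoissonEvents.
Context {R : realType} d (T : measurableType d) (P : probability T R).
Variable Phi : T -> set (plane R).
Hypothesis hPhi : homogeneous_poisson P 1 Phi.
Local Notation leb2 := (@lebesgue_plane R).
Local Notation occupied := (occupied Phi).
Local Notation ple := (ple P).
Local Notation many := (many Phi).
Local Notation ua := (@unit_area R).
Implicit Types (w : T) (X Y Z z p : plane R).

Section NearTies.
(** A ring of inner radius at most 4 (r + 1) and width 15 g has area at most (2 * 4 * 15 + 15^2) (r
    + 1) g times that of the unit disc, for g <= 1; and 345 = 120 + 225. *)
Let cst : R := 345.
Let cst0 : 0 <= cst. Proof. exact: ler0n. Qed.
Variables (n0 : nat) (S : 'I_n0 -> plane R) (r : R).
Hypothesis r0 : 0 <= r.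
Hypothesis Sr : forall u, enorm (S u) <= r.

Definition base w X := (exists u, X = S u) \/ (Phi w X /\ enorm X < r).

Definition near_tie (g : R) w := exists X Y Z, [/\ base w X, base w Y, Phi w Z & enorm Z < r] /\
  [/\ X <> Y, Z <> X, Z <> Y & `|enorm (X - Y) - enorm (X - Z)| <= g].

Section Mesh.
Variables (g : R) (n : nat).
Hypothesis g0 : 0 < g.
Hypothesis g1 : g <= 1.
Hypothesis rn : r < n%:R * g.
Hypothesis nr : n%:R * g <= r + 1.

Let I : finType := ('I_n0 + 'I_(2 * n) * 'I_(2 * n))%type.
Let sq (a : 'I_(2 * n) * 'I_(2 * n)) (X : int -> int -> set (plane R)) :=
  X ((a.1 : nat)%:Z - n%:Z) ((a.2 : nat)%:Z - n%:Z).
Let cellof (i : I) : set (plane R) := if i is inr a then sq a (square g) else set0.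
Let loc (i : I) : plane R :=
  match i with inl u => S u | inr a => corner g ((a.1 : nat)%:Z - n%:Z) ((a.2 : nat)%:Z - n%:Z) end.
Let isq (i : I) : bool := if i is inr _ then true else false.
Let wt (i : I) : R := if isq i then g ^+ 2 else 1.

Let at_ w X (i : I) := match i with inl u => X = S u
  | inr a => Phi w X /\ sq a (square g) X end.

Let base_at w X : base w X -> exists i, at_ w X i.
Proof.
move=> [[u ->]|[PX Xr]]; first by exists (inl u).
have [i [j ij]] := square_cover g0 (lt_trans Xr rn).
by exists (inr (i, j)).
Qed.

Let at_loc w X i : at_ w X i -> enorm (X - loc i) <= 2 * g.
Proof.
case: i => [u ->|a [_ h]]; first by rewrite enorm_subxx mulr_ge0// ltW.
exact: square_corner.
Qed.

Let at_occ w X i : at_ w X i -> isq i -> occupied (cellof i) w.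
Proof. by case: i => [//|a [PX aX] _]; exists X. Qed.

Let loc_le i : enorm (loc i) <= 2 * (r + 1).
Proof.
case: i => [u|a] /=; first by rewrite (le_trans (Sr u))//; have := r0; lra.
have H (b : 'I_(2 * n)) : `|((b : nat)%:Z - n%:Z)%:~R * g| <= r + 1.
  rewrite normrM (gtr0_norm g0); apply: le_trans nr; rewrite ler_wpM2r ?(ltW g0)//.
  rewrite -intr_norm -[n%:R]/(n%:Z%:~R) ler_int.
  by have := ltn_ord b; clear; lia.
rewrite /corner; have := H a.2; have := H a.1.
move: (((a.1 : nat)%:Z - n%:Z)%:~R * g) (((a.2 : nat)%:Z - n%:Z)%:~R * g) => x y hx hy.
rewrite -(@ler_pXn2r _ 2) ?nnegrE ?enorm_ge0//; last by have := r0; lra.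
rewrite sqr_enorm /dot /=.
move: hx hy; rewrite !ler_norml => /andP[x1 x2] /andP[y1 y2].
have hx2 : x * x <= (r + 1) * (r + 1) by nra.
have hy2 : y * y <= (r + 1) * (r + 1) by nra.
have := sqr_ge0 (r + 1); rewrite !expr2 => h.
have -> : 2 * (r + 1) * (2 * (r + 1)) = 4 * ((r + 1) * (r + 1)) by ring.
lra.
Qed.

(** Replacing X and Y by [loc i] and [loc k] costs 2 g for |X - Z| and 4 g for |X - Y|, and the tie
    costs g. So |Z - loc i| is within 7 g of |loc i - loc k|; the width 15 g makes the upper bound
    strict. *)
Let ringof i k := ring_at (loc i) (Num.max 0 (enorm (loc i - loc k) - 7 * g)) (15 * g).
(** Removing the two squares from the ring makes the three domains disjoint, so occupations are
    independent. A point Z inside one of the squares makes that square [crowded]. *)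
Let dom i k (j : 'I_3) : set (plane R) :=
  if val j == 0%N then cellof i else if val j == 1%N then cellof k
  else ringof i k `\` cellof i `\` cellof k.

Let measurable_cellof i : measurable (cellof i).
Proof. by case: i => [u|a] //=; exact: measurable_square. Qed.

Let measurable_dom i k j : measurable (dom i k j).
Proof.
rewrite /dom; case: ifP => _ //; case: ifP => _ //.
by apply: measurableD => //; apply: measurableD => //; exact: measurable_ring.
Qed.

Let area_cellof i : leb2 (cellof i) = (if isq i then g ^+ 2 else 0)%:E.
Proof.
by case: i => [u|a] /=; [exact: (@measure0 _ _ _ leb2)|exact: area_square].
Qed.

Let ring_bound : R := cst * (r + 1) * ua * g.

Let area_rest i k : exists2 a : R, leb2 (ringof i k `\` cellof i `\` cellof k) = a%:E & a <= ring_bound.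
Proof.
set D := _ `\` _.
have s0 : 0 <= Num.max 0 (enorm (loc i - loc k) - 7 * g) by rewrite le_max lexx.
have g15 : 0 < 15 * g by rewrite mulr_gt0.
have le1 : (leb2 D <= leb2 (ringof i k))%E.
  apply: (@le_measure _ _ _ leb2); rewrite ?inE; [|exact: measurable_ring|].
    exact: (measurableD (measurableD (measurable_ring _ _ _) (measurable_cellof i)) (measurable_cellof k)).
  by move=> z [[]].
have D0 : (0 <= leb2 D)%E by exact: integral_ge0.
move: le1; rewrite area_ring// => le1.
have Dfin : leb2 D \is a fin_num by rewrite ge0_fin_numE// (le_lt_trans le1)// ltry.
exists (fine (leb2 D)); first by rewrite fineK.
have : fine (leb2 D) <= (2 * Num.max 0 (enorm (loc i - loc k) - 7 * g) * (15 * g) + (15 * g) ^+ 2) * ua.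
  by rewrite -lee_fin fineK.
move=> /le_trans; apply; rewrite /ring_bound.
have -> : cst * (r + 1) * ua * g = (cst * (r + 1) * g) * ua by ring.
rewrite /cst.
rewrite ler_wpM2r ?unit_area_ge0//.
have : Num.max 0 (enorm (loc i - loc k) - 7 * g) <= 4 * (r + 1).
  have hr : 0 <= r := r0; have hg : 0 < g := g0; have li := loc_le i; have lk := loc_le k.
  have t := enorm_triangle origin (loc i) (loc k); rewrite enorm_sub0 enorm_0sub in t.
  rewrite ge_max; apply/andP; split; first by lra.
  lra.
move: (Num.max _ _) s0 => x x0 x4.
have := r0; have := g0; have := g1; nra.
Qed.

Let disjoint_dom i k : i != k -> trivIset setT (dom i k).
Proof.
move=> ik; have cc : cellof i `&` cellof k = set0.
  apply/seteqP; split => // z []; move: ik; case: (i) => [//|a]; case: (k) => [//|b] ab /= az bz.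
  have [] := square_inj g0 az bz => e1 e2; case/eqP: ab; congr inr.
  rewrite [a]surjective_pairing [b]surjective_pairing.
  by congr pair; apply: val_inj => /=; move: e1 e2; clear; lia.
have no x y (z : plane R) : dom i k x z -> dom i k y z -> (x < y)%N -> False.
  case: x => [[|[|[|//]]] ?]; case: y => [[|[|[|//]]] ?] //; rewrite /dom /=.
  - by move=> z1 z2; have : set0 z by rewrite -cc.
  - by move=> z1 [[]].
  - by move=> z1 [].
move=> x y _ _ [z [zx zy]]; apply: val_inj; case: (ltngtP x y) => //.
  by move=> /(no _ _ _ zx zy).
by move=> /(no _ _ _ zy zx).
Qed.

Let tie_at i k w := forall j : 'I_3, (if val j == 0%N then isq i else if val j == 1%N then isq k else true) ->
  occupied (dom i k j) w.

Let ple_tie_at i k : i != k -> ple (tie_at i k) (wt i * wt k * ring_bound).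
Proof.
move=> ik; have [a aE ab] := area_rest i k.
pose f (j : 'I_3) := if val j == 0%N then isq i else if val j == 1%N then isq k else true.
pose ar (j : 'I_3) : R := if val j == 0%N then (if isq i then g ^+ 2 else 0)
  else if val j == 1%N then (if isq k then g ^+ 2 else 0) else a.
have := @ple_jointly_occupied _ _ _ _ _ hPhi 3 f (dom i k) ar (measurable_dom i k).
move=> h; apply: ple_sub (h _ (disjoint_dom ik)) => //.
- rewrite !big_ord_recl big_ord0 mulr1 /f /ar /= mulrA.
  have w0 x : 0 <= wt x by rewrite /wt; case: ifP => _; rewrite ?sqr_ge0.
  have -> : (if isq i then if isq i then g ^+ 2 else 0 else 1) = wt i.
    by rewrite /wt; case: isq.
  have -> : (if isq k then if isq k then g ^+ 2 else 0 else 1) = wt k.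
    by rewrite /wt; case: isq.
  by rewrite ler_wpM2l// mulr_ge0.
- by move=> j; rewrite /dom /ar; case: ifP => _; [|case: ifP => _].
Qed.

Let crowded w := exists a : 'I_(2 * n) * 'I_(2 * n), many 2 (sq a (square g)) w.

Let crowdedP w a X Y : Phi w X -> Phi w Y -> sq a (square g) X -> sq a (square g) Y -> X <> Y -> crowded w.
Proof.
move=> PX PY aX aY XY; exists a; exists [:: X; Y]; split => //.
  by rewrite /= inE andbT; apply/eqP.
by move=> z; rewrite !inE => /orP[] /eqP ->.
Qed.

(* Given the squares of X and Y, a tie puts Z in a ring of width 15 g around X, of area O(g). *)
Let near_tie_cases w : near_tie g w -> crowded w \/ exists ik : I * I, ik.1 != ik.2 /\ tie_at ik.1 ik.2 w.
Proof.
move=> [X [Y [Z [[bX bY PZ Zr] [XY ZX ZY tie]]]]].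
have [i iX] := base_at bX; have [k kY] := base_at bY.
have dZ l V : at_ w V l -> Z <> V -> crowded w \/ ~ cellof l Z.
  case: l => [u|a] /=; first by right.
  move=> [PV aV] ZV; case: (pselect (sq a (square g) Z)) => [aZ|]; last by right.
  by left; exact: crowdedP PZ PV aZ aV ZV.
have [//|iZ] := dZ _ _ iX ZX; first by left.
have [//|kZ] := dZ _ _ kY ZY; first by left.
have [ik|ik] := eqVneq i k.
  left; move: kY iX; rewrite -ik; case: (i) => [u /= e1 e2|a [PY aY] [PX aX]].
    by case: XY; rewrite e1 e2.
  exact: crowdedP PX PY aX aY XY.
right; exists (i, k); split => // -[[|[|[|//]]] ?]; rewrite /dom /=.
- exact: at_occ iX.
- exact: at_occ kY.
- move=> _; exists Z => //; split => //; split => //.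
  have hi := at_loc iX; have hk := at_loc kY.
  have t1 := enorm_triangle (loc i) X Z; have t2 := enorm_triangle X Z (loc i).
  have t3 := enorm_triangle (loc i) X Y; have t4 := enorm_triangle (loc k) (loc i) Y.
  have t5 := enorm_triangle X (loc i) (loc k); have t6 := enorm_triangle Y X (loc k).
  have e1 := enormN (loc i) Z; have e2 := enormN Z X; have e3 := enormN (loc k) Y; have e4 := enormN (loc i) X.
  have [tie1 tie2] : - g <= enorm (X - Y) - enorm (X - Z) /\ enorm (X - Y) - enorm (X - Z) <= g.
    by move: tie; rewrite ler_norml => /andP.
  have z0 := enorm_ge0 (Z - loc i); rewrite /ringof /ring_at /= ge_max z0 /=.
  have lm : enorm (loc i - loc k) - 7 * g <= Num.max 0 (enorm (loc i - loc k) - 7 * g).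
    by rewrite le_max lexx orbT.
  move: lm; move: (Num.max _ _) => mx lm; have := g0; move=> gp.
  by apply/andP; split; lra.
Qed.

(** Two points in one of the (2 n)^2 squares have probability O(g^4) per square. For the rest, the
    weights [wt] sum to n0 + (2 n g)^2, which stays bounded as g tends to 0, so the sum over pairs
    keeps the factor g of the ring. *)
Lemma ple_near_tie_mesh : ple (near_tie g)
  ((4 * (r + 1) ^+ 2 + (n0%:R + 4 * (r + 1) ^+ 2) ^+ 2 * (cst * (r + 1) * ua)) * g).
Proof.
have nn : (2 * n)%:R ^+ 2 * g ^+ 2 <= 4 * (r + 1) ^+ 2.
  have -> : (2 * n)%:R ^+ 2 * g ^+ 2 = 4 * (n%:R * g) ^+ 2 by rewrite natrM; ring.
  rewrite ler_wpM2l// ler_pXn2r ?nnegrE//; last by have := r0; lra.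
  by rewrite mulr_ge0// ltW.
have wt_ge0 x : 0 <= wt x by rewrite /wt; case: ifP => _; rewrite ?sqr_ge0.
have r10 : 0 <= r + 1 by have := r0; lra.
have ring_bound_ge0 : 0 <= ring_bound 
  by apply: mulr_ge0; [apply: mulr_ge0; [apply: mulr_ge0|exact: unit_area_ge0]|exact: ltW g0].
have h1 : ple crowded (4 * (r + 1) ^+ 2 * g).
  have := @ple_exists_cst _ _ _ P _ (fun a w => many 2 (sq a (square g)) w) ((g ^+ 2) ^+ 2).
  move=> h; apply: ple_sub (h _) => //; last first.
    by move=> a; apply: (ple_many hPhi); [exact: measurable_square|exact: area_square].
  rewrite card_prod card_ord natrM -expr2 [X in _ * X]expr2 mulrA.
  apply: (@le_trans _ _ (4 * (r + 1) ^+ 2 * g ^+ 2)); first by rewrite ler_wpM2r ?sqr_ge0.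
  by rewrite ler_wpM2l ?mulr_ge0 ?sqr_ge0// expr2 ler_piMl ?(ltW g0).
have h2 : ple [set w | exists ik : I * I, ik.1 != ik.2 /\ tie_at ik.1 ik.2 w]
    ((n0%:R + 4 * (r + 1) ^+ 2) ^+ 2 * (cst * (r + 1) * ua) * g).
  have key (ik : I * I) : ple [set w | ik.1 != ik.2 /\ tie_at ik.1 ik.2 w] (wt ik.1 * wt ik.2 * ring_bound).
    have [e|ne] := eqVneq ik.1 ik.2; last by apply: ple_sub (ple_tie_at ne) => // w [].
    apply: ple_sub (ple0 P); first by move=> w [].
    by apply: mulr_ge0 => //; exact: mulr_ge0.
  apply: ple_sub (ple_exists key) => //.
  have -> : \sum_ik wt ik.1 * wt ik.2 * ring_bound = (\sum_i wt i) ^+ 2 * ring_bound.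
    rewrite -(pair_bigA _ (fun i k => wt i * wt k * ring_bound)) /= expr2 mulr_suml mulr_suml.
    apply: eq_bigr => i _; rewrite mulr_sumr mulr_suml; apply: eq_bigr => k _.
    by [].
  have -> : \sum_i wt i = n0%:R + (2 * n)%:R ^+ 2 * g ^+ 2.
    rewrite big_sumType /= sumr_const card_ord -[n0%:R]/(1 *+ n0); congr (_ + _).
    rewrite (eq_bigr (fun=> g ^+ 2))//.
    by rewrite sumr_const card_prod card_ord -[LHS]mulr_natl [X in X * _ = _]natrM -expr2.
  have q0 : 0 <= (2 * n)%:R ^+ 2 * g ^+ 2 by apply: mulr_ge0; exact: sqr_ge0.
  rewrite -[leRHS]mulrA; apply: ler_pM => //; first exact: sqr_ge0.
  rewrite ler_pXn2r ?nnegrE ?lerD2l ?addr_ge0//; exact: le_trans nn.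
have := pleU h1 h2; apply: ple_sub; last by lra.
by move=> w /near_tie_cases.
Qed.

End Mesh.

Lemma ple_near_tie : exists2 C : R, 0 <= C & forall g, 0 < g <= 1 -> ple (near_tie g) (C * g).
Proof.
exists (4 * (r + 1) ^+ 2 + (n0%:R + 4 * (r + 1) ^+ 2) ^+ 2 * (cst * (r + 1) * ua)).
  have rr : 0 <= r + 1 by have := r0; lra.
  have sq0 : 0 <= 4 * (r + 1) ^+ 2 by apply: mulr_ge0 => //; exact: sqr_ge0.
  apply: addr_ge0 => //; apply: mulr_ge0; first exact: sqr_ge0.
  by apply: mulr_ge0; [apply: mulr_ge0|exact: unit_area_ge0].
move=> g /andP[g0 g1].
have rg : 0 <= r / g by rewrite divr_ge0// ltW.
apply: (@ple_near_tie_mesh g (Num.truncn (r / g)).+1) => //.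
  by rewrite -ltr_pdivrMr//; exact: truncnS_gt.
rewrite -(natr1 (Num.truncn _)) mulrDl mul1r; apply: lerD => //.
by rewrite -ler_pdivlMr// truncn_le.
Qed.

End NearTies.

Section Sparse.
Variables (rin rout W eta : R) (K m1 L : nat).
Hypothesis rin0 : 0 < rin.
Hypothesis rout0 : 0 <= rout.
Hypothesis W0 : 0 < W.
Hypothesis eta0 : 0 < eta.
Hypothesis m3 : (2 < m1.+1)%N.
Hypothesis KW : K%:R * W <= rin / 4.
Hypothesis gamW : 8 * (K%:R * W) / rin <= @gam R m1.
Hypothesis etaL : rout < L%:R * eta.

(* K + 1 points of a steep sequence lie in a region of area O(eta W rout / rin), hence are
   unlikely; without them a path descends by eta every K + 1 steps. *)
Definition steep w := exists v : nat -> plane R, [/\ forall i, (i <= K)%N -> (origin |` Phi w) (v i),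
  forall i j, (i < j <= K)%N -> enorm (v j) < enorm (v i),
  forall i, (i < K)%N -> enorm (v i - v i.+1) <= W, rin <= enorm (v K) &
  enorm (v 0%N) <= rout /\ enorm (v 0%N) - enorm (v K) <= eta].

(** Overlapping slots: angles advance by gam / 2 with width 2 gam, radii by eta with width 2 eta,
    and the shift by one leaves a margin before the angle of v 0. Points within gam / 2 of that
    angle and spread over at most eta in norm then fit in a single slot. The full turn takes 4 m
    slots. *)
Let angle (a : nat) : R := (a%:R - 1) * (@gam R m1 / 2).
Let slot (l : 'I_L) (a : 'I_(4 * m1.+1)) := rot_cell m1 (l%:R * eta) (2 * eta) (angle a).

Let steep_slot w : steep w -> exists la : 'I_L * 'I_(4 * m1.+1), many K.+1 (slot la.1 la.2) w.
Proof.
move=> [v [Nv dv sv rv [v0 ve]]].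
have mono i : (i <= K)%N -> enorm (v K) <= enorm (v i).
  by rewrite leq_eqVlt => /orP[/eqP ->//|iK]; rewrite ltW// dv// iK leqnn.
have mono0 i : (i <= K)%N -> enorm (v i) <= enorm (v 0%N).
  by case: i => [//|i] iK; rewrite ltW// dv.
have g0 := @gam_gt0 R m1; have gm := @gam_m R m1.
have far i : (i <= K)%N -> enorm (v i - v 0%N) <= i%:R * W.
  elim: i => [|i IH] iK; first by rewrite enorm_subxx mul0r.
  rewrite -natr1 mulrDl mul1r [leRHS]addrC; apply: (le_trans (enorm_triangle (v i) _ _)).
  by rewrite lerD// ?IH ?(ltnW iK)// enormN sv.
have [t0 v0t] := polar_exists (v 0%N) 0; rewrite add0r -gm => /andP[t00 t01].
have rv0 : rin <= enorm (v 0%N) := le_trans rv (mono0 _ (leqnn K)).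
have near i : (i <= K)%N -> exists2 t, v i = polar (enorm (v i)) t & `|t - t0| <= @gam R m1 / 2.
  move=> iK; have [] := @polar_near _ (enorm (v 0%N)) t0 (v i) (K%:R * W).
  - exact: lt_le_trans rv0.
  - by rewrite -v0t (le_trans (far i iK))// ler_wpM2r ?(ltW W0)// ler_nat.
  - by rewrite (le_trans KW)// ler_pM2r.
  move=> t vt tt; exists t => //; apply: le_trans tt _.
  apply: (@le_trans _ _ (4 * (K%:R * W) / rin)).
    rewrite ler_wpM2l ?lef_pV2 ?posrE ?(lt_le_trans rin0)//.
    by rewrite mulr_ge0 ?mulr_ge0// ltW.
  have := gamW; rewrite -(mulrA 8) -(mulrA 4); lra.
have g2 : 0 < @gam R m1 / 2 by rewrite divr_gt0.
pose a := Num.truncn (t0 / (@gam R m1 / 2)).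
have a0 : 0 <= t0 / (@gam R m1 / 2) by rewrite divr_ge0// ltW.
have a1 : a%:R * (@gam R m1 / 2) <= t0 by rewrite -ler_pdivlMr// truncn_le.
have a2 : t0 < (a%:R + 1) * (@gam R m1 / 2) by rewrite -ltr_pdivrMr// natr1 truncnS_gt.
have am : (a < 4 * m1.+1)%N.
  rewrite -(ltr_nat R) natrM -(ltr_pM2r g2) (le_lt_trans a1)// (lt_le_trans t01)//.
  by rewrite le_eqVlt; apply/orP; left; apply/eqP; field.
pose l := Num.truncn (enorm (v K) / eta).
have l0 : 0 <= enorm (v K) / eta by rewrite divr_ge0 ?enorm_ge0// ltW.
have l1 : l%:R * eta <= enorm (v K) by rewrite -ler_pdivlMr// truncn_le.
have l2 : enorm (v K) < (l%:R + 1) * eta by rewrite -ltr_pdivrMr// natr1 truncnS_gt.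
have lL : (l < L)%N.
  rewrite -(ltr_nat R) -(ltr_pM2r eta0) (le_lt_trans l1)// (le_lt_trans _ etaL)//.
  exact: le_trans (mono0 _ (leqnn K)) v0.
exists (Ordinal lL, Ordinal am); exists [seq v i | i <- iota 0 K.+1]; split.
- rewrite map_inj_in_uniq ?iota_uniq// => i j; rewrite !mem_iota !ltnS /= => iK jK e.
  by case: (ltngtP i j) => // ij; [have := dv i j|have := dv j i]; rewrite ij ?iK ?jK e ltxx => /(_ isT).
- by rewrite size_map size_iota.
move=> z /mapP[i]; rewrite mem_iota ltnS /= => iK ->.
have vi0 : 0 < enorm (v i) by rewrite (lt_le_trans rin0)// (le_trans rv) ?mono.
have vin : v i <> origin by move=> e; move: vi0; rewrite e enorm0 ltxx.
split; first by have [|//] := Nv i iK.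
split; rewrite /= ?/ring_at /= ?subr0.
  have := mono i iK; have := mono0 i iK => h1 h2; apply/andP; split; first exact: le_trans l1 h2.
  by move: l2 ve h1; rewrite mulrDl mul1r; lra.
have [t vt] := near i iK; rewrite ler_norml => /andP[b1 b2].
apply/sectorP; last first.
  split=> //; exists t => //; apply/andP; split; rewrite /angle.
    by move: a1 b1; rewrite mulrBl mul1r; lra.
  by move: a2 b2; rewrite mulrBl mulrDl !mul1r; lra.
have gpi := gam2_lt_pi m3; apply/andP; split.
  by rewrite ltrDl mulr_gt0.
by rewrite ltrD2l; exact: gpi.
Qed.

Lemma ple_steep : ple steep
  (L%:R * (4 * m1.+1%:R) * ((4 * (L%:R * eta) * eta + 4 * eta ^+ 2) * ua / m1.+1%:R) ^+ K.+1).
Proof.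
set A := _ / _.
have key (la : 'I_L * 'I_(4 * m1.+1)) : ple (fun w => many K.+1 (slot la.1 la.2) w) (A ^+ K.+1).
  have e2 : 0 < 2 * eta by rewrite mulr_gt0.
  have s0 : 0 <= la.1%:R * eta by rewrite mulr_ge0// ltW.
  have fin : leb2 (ring_cell m1 (la.1%:R * eta) (2 * eta) 0) \is a fin_num.
    have D0 : (0 <= leb2 (ring_cell m1 (la.1%:R * eta) (2 * eta) 0))%E by exact: integral_ge0.
    rewrite ge0_fin_numE//.
    apply: (@le_lt_trans _ _ (leb2 (ring_at 0%R (la.1%:R * eta) (2 * eta)))); last by rewrite area_ring// ltry.
    by apply: (@le_measure _ _ _ leb2); rewrite ?inE; [exact: measurable_ring_cell|exact: measurable_ring|exact: subIsetl].
  have := ple_many hPhi K.+1 (A := slot la.1 la.2) (a := fine (leb2 (ring_cell m1 (la.1%:R * eta) (2 * eta) 0))).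
  move=> h; apply: ple_sub (h _ _) => //; [|exact: measurable_rot_cell|]; last first.
    by rewrite area_rot_cell fineK.
  rewrite ler_pXn2r ?nnegrE//; last 2 first.
  - by rewrite fine_ge0//; exact: integral_ge0.
  - by rewrite /A divr_ge0// mulr_ge0 ?unit_area_ge0// addr_ge0 ?mulr_ge0 ?sqr_ge0 ?(ltW eta0).
  rewrite /A ler_pdivlMr ?ltr0n//.
  apply: (le_trans (area_ring_cell_le 0 m3 s0 e2)); rewrite ler_wpM2r ?unit_area_ge0//.
  have : la.1%:R * eta <= L%:R * eta by rewrite ler_wpM2r ?(ltW eta0)// ler_nat ltnW.
  have := eta0; move: (_ * eta) (_ * eta) => x y e0 xy; nra.
apply: ple_sub (ple_exists_cst key); first by move=> w /steep_slot.
by rewrite card_prod !card_ord !natrM.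
Qed.

End Sparse.

Section Dense.
Variables (s : R) (n : nat).
Hypothesis s0 : 0 < s.

Definition holed w := exists ij : 'I_(2 * n) * 'I_(2 * n),
  ~ occupied (square s ((ij.1 : nat)%:Z - n%:Z) ((ij.2 : nat)%:Z - n%:Z)) w.

Lemma ple_holed : ple holed ((2 * n)%:R ^+ 2 * expR (- s ^+ 2)).
Proof.
apply: ple_sub (ple_exists_cst (I := ('I_(2 * n) * 'I_(2 * n))%type) (x := expR (- s ^+ 2)) _).
- by move=> w; exact: id.
- by rewrite card_prod !card_ord natrM expr2.
- move=> ij; apply: (ple_empty hPhi); [exact: measurable_square|exact: area_square].
Qed.

(** Pull p towards the origin by 2 s. The square around the new position has diameter less than 2 s,
    so its Poisson point is lower than p and within 4 s of it. *)
Lemma not_holed_descend w p : ~ holed w -> 2 * s <= enorm p -> enorm p < n%:R * s ->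
  exists z, [/\ Phi w z, enorm z < enorm p & enorm (p - z) <= 4 * s].
Proof.
move=> nh p2 pn; have p0 : 0 < enorm p by apply: lt_le_trans p2; rewrite mulr_gt0.
pose c := 1 - 2 * s / enorm p; pose p' : plane R := c *: p.
have c0 : 0 <= c by rewrite subr_ge0 ler_pdivrMr// mul1r.
have np' : enorm p' = enorm p - 2 * s.
  by rewrite enormZ ger0_norm// mulrBl mul1r divfK// gt_eqF.
have [|i [j ij]] := @square_cover _ s n p' s0.
  by rewrite np' (le_lt_trans _ pn)// gerBl mulr_ge0// ltW.
have [z Pz zij] : occupied (square s ((i : nat)%:Z - n%:Z) ((j : nat)%:Z - n%:Z)) w.
  by apply: contrapT => no; apply: nh; exists (i, j).
have dz := square_diam_lt s0 ij zij.
exists z; split => //.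
  have := enorm_triangle p' z origin; rewrite !enorm_sub0 np' [enorm (z - p')]enormN; lra.
have := enorm_triangle p' p z.
have -> : enorm (p - p') = 2 * s.
  have -> : p - p' = (2 * s / enorm p) *: p by rewrite /p' /c scalerBl scale1r opprB addrC subrK.
  by rewrite enormZ ger0_norm ?divfK ?gt_eqF// divr_ge0 ?enorm_ge0// mulr_ge0// ltW.
lra.
Qed.

End Dense.

End PoissonEvents.

(** * From annuli to the whole plane *)

Section FromAnnuli.
Context {R : realType}.
Variable N : set (plane R).
Hypothesis N0 : N origin.
Hypothesis Nfin : forall r : R, finite_set (N `&` [set z | enorm z < r]).
Hypothesis Nuniq : forall X, N X -> X <> origin -> unique_nearest N X.
Local Notation anc := (anc N).
Variables (b n0 : nat) (C : R).
Hypothesis b2 : (2 <= b)%N.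
Hypothesis n02 : (2 <= n0)%N.
Hypothesis C0 : 0 <= C.
Local Notation rad n := (n%:R ^+ b : R).
Hypothesis dense : forall n p, (n0 <= n)%N -> rad n <= enorm p <= rad n.+1 ->
  exists z, [/\ N z, enorm z < enorm p & enorm (p - z) <= n%:R].
Hypothesis annulus : forall n X k, (n0 <= n)%N -> N X -> rad n <= enorm X -> enorm X < rad n.+1 ->
  (forall l, (l < k)%N -> rad n <= enorm (iter l anc X)) ->
  enorm (direction X - direction (iter k anc X)) <= C / n%:R ^+ 2.

Let rad_le m n : (m <= n)%N -> rad m <= rad n.
Proof. by move=> mn; rewrite ler_pXn2r ?nnegrE ?ler_nat// (leq_trans _ b2). Qed.

Let rad_sqr n : n%:R ^+ 2 <= rad n.
Proof.
case: n => [|n]; first by rewrite expr2 mulr0 exprn_ge0.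
by rewrite ler_weXn2l// ler1n.
Qed.

(** By Bernoulli's inequality. Annuli are wider than the steps taken in them, so a path cannot skip
    one. *)
Let rad_gap n : rad n + n.+1%:R <= rad n.+1.
Proof.
have [c ->] : exists c, b = c.+2 by exists b.-2; move: b2; clear; lia.
have x0 : 0 <= n%:R :> R by [].
rewrite -natr1; move: x0; move: (n%:R : R) => x x0.
have h : 1 + c.+1%:R * x <= (x + 1) ^+ c.+1.
  elim: (c) => [|k IH]; first by rewrite expr1; lra.
  rewrite exprS -(natr1 k.+1); have k0 : 0 <= k.+1%:R * x ^+ 2 by rewrite mulr_ge0 ?sqr_ge0.
  apply: (@le_trans _ _ ((x + 1) * (1 + k.+1%:R * x))); last by rewrite ler_wpM2l// addr_ge0.
  by move: k0; rewrite expr2; nra.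
have h' : x ^+ c.+1 <= (x + 1) ^+ c.+1 by rewrite ler_pXn2r ?nnegrE ?addr_ge0// lerDl.
have h'' : x + 1 <= (x + 1) ^+ c.+1.
  apply: le_trans h; rewrite -natr1; have : 0 <= c%:R * x by rewrite mulr_ge0.
  by rewrite mulrDl mul1r; lra.
rewrite ![_ ^+ c.+2]exprS; nra.
Qed.

Let rad_index (r : R) m : rad m <= r -> exists2 n, (m <= n)%N & rad n <= r /\ r < rad n.+1.
Proof.
move=> mr; have ex : exists n, r < rad n.+1.
  exists (Num.truncn r); have h := truncnS_gt r; apply: (lt_le_trans h).
  apply: le_trans (rad_sqr _); rewrite expr2 ler_peMl// ler1n //.
exists (ex_minn ex); case: ex_minnP => n rn nmin.
  rewrite leqNgt; apply/negP => nm; have := le_lt_trans mr rn.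
  by rewrite ltNge rad_le.
split => //; case: n rn nmin => [|n] rn nmin.
  by rewrite (le_trans _ mr)// rad_le.
by rewrite leNgt; apply/negP => /nmin; rewrite ltnn.
Qed.

Let step X n : (n0 <= n)%N -> N X -> rad n <= enorm X <= rad n.+1 -> enorm (X - anc X) <= n%:R.
Proof.
move=> nn NX nX; have [z [Nz zX Xz]] := dense nn nX.
have X0 : X <> origin by move=> e; move: zX; rewrite e enorm0 ltNge enorm_ge0.
have [_ _ h] := snear_ancN N0 Nfin Nuniq NX X0.
by have [<- //|/eqP za] := eqVneq z (anc X); exact: le_trans (ltW (h z Nz zX za)) Xz.
Qed.

Let step_down X n : (n0 <= n)%N -> N X -> rad n <= enorm X -> enorm X <= rad n.+1 ->
  enorm X - n%:R <= enorm (anc X).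
Proof.
move=> nn NX h1 h2; have := @step X n nn NX; rewrite h1 h2 => /(_ isT).
by have := enorm_le_sub X (anc X); lra.
Qed.

(** Annulus by annulus: the deviation C / (n + 1)^2 is at most C (1 / n - 1 / (n + 1)), and the sum
    telescopes. *)
Let telescope m n k X : (n0 < m)%N -> (m <= n)%N -> N X -> rad n <= enorm X -> enorm X < rad n.+1 ->
  rad m <= enorm (iter k anc X) ->
  enorm (direction X - direction (iter k anc X)) <= C * (m.-1%:R^-1 - n%:R^-1).
Proof.
move=> m0 mn; elim: n mn X k => [|n IH] mn X k NX X1 X2 kX; first by move: m0 mn; clear; lia.
have nn0 : (n0 <= n)%N by move: m0 mn; clear; lia.
have n1 : 0 < n%:R :> R by rewrite ltr0n; move: n02 nn0; clear; lia.
have gap : (n.+1%:R ^+ 2)^-1 <= n%:R^-1 - n.+1%:R^-1 :> R.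
  rewrite -[n.+1%:R]natr1; move: n1; move: (n%:R : R) => x x0.
  rewrite -subr_ge0 (_ : _ - _ = (x ^+ 1 * (x + 1) ^+ 2)^-1); last by field; apply/andP; split; lra.
  by rewrite invr_ge0 mulr_ge0 ?exprn_ge0//; lra.
have mono p q : (p <= q)%N -> enorm (iter q anc X) <= enorm (iter p anc X).
  move=> /subnK <-; rewrite iterD; apply: enorm_iter_anc_le => //.
  exact: N_iter_anc.
have [ex|no] := pselect (exists l, (l <= k)%N && (enorm (iter l anc X) < rad n.+1)); last first.
  apply: (le_trans (annulus (leqW nn0) NX X1 X2 _)).
    move=> l lk; rewrite leNgt; apply/negP => h; apply: no; exists l; by rewrite (ltnW lk).
  rewrite ler_wpM2l// (le_trans gap)// lerD2r lef_pV2 ?posrE//.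
    by rewrite ler_nat; move: mn; clear; lia.
  by rewrite ltr0n; move: n02 m0; clear; lia.
have [l /andP[lk lX] lmin] := ex_minnP ex.
have l0 : (0 < l)%N by case: (l) lX => //= h; move: X1; rewrite leNgt h.
have bef i : (i < l)%N -> rad n.+1 <= enorm (iter i anc X).
  move=> il; rewrite leNgt; apply/negP => h.
  by have := lmin i; rewrite h (leq_trans (ltnW il) lk) leqNgt il => /(_ isT).
have A1 := annulus (leqW nn0) NX X1 X2 bef.
(* The first vertex l below the annulus falls in the next one. The bound for the annulus already
   includes the step to it. *)
have lX' : rad n <= enorm (iter l anc X).
  have e : iter l anc X = anc (iter l.-1 anc X) by rewrite -iterS prednK.
  have h1 : rad n.+1 <= enorm (iter l.-1 anc X) by apply: bef; rewrite prednK.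
  have h2 : enorm (iter l.-1 anc X) <= rad n.+2 by rewrite (le_trans _ (ltW X2))// (mono 0%N).
  rewrite e; apply: le_trans (step_down (leqW nn0) _ h1 h2); last exact: N_iter_anc.
  by have := rad_gap n; lra.
have nm : (m <= n)%N.
  move: mn; rewrite leq_eqVlt => /orP[/eqP e|//].
  by move: kX; rewrite leNgt e (le_lt_trans _ lX)// mono.
have := IH nm (iter l anc X) (k - l)%N; rewrite -iterD subnK// => /(_ _ lX' lX kX) A2.
apply: (le_trans (enorm_triangle (direction (iter l anc X)) _ _)).
apply: (le_trans (lerD A1 (A2 _))); first exact: N_iter_anc.
rewrite -mulrDr ler_wpM2l//; move: gap.
move: (n.+1%:R ^+ 2)^-1 n%:R^-1 n.+1%:R^-1 m.-1%:R^-1 => x1 x2 x3 x4 h; lra.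
Qed.

Lemma annuli_straight (e : R) : 0 < e -> exists rho, forall X k, N X ->
  rho <= enorm (iter k anc X) -> enorm (direction X - direction (iter k anc X)) <= e.
Proof.
move=> e0; have Ce : 0 <= C / e by rewrite divr_ge0// ltW.
pose m := (n0 + (Num.truncn (C / e)).+1).+1.
exists (rad m) => X k NX kX.
have kle : enorm (iter k anc X) <= enorm X by exact: enorm_iter_anc_le.
have [n mn [X1 X2]] := rad_index (le_trans kX kle).
have m0 : (n0 < m)%N by rewrite ltnS leq_addr.
apply: (le_trans (telescope m0 mn NX X1 X2 kX)).
apply: (@le_trans _ _ (C * m.-1%:R^-1)); first by rewrite ler_wpM2l// gerBl.
have tp : 0 < (Num.truncn (C / e)).+1%:R :> R by rewrite ltr0n.
have ct : C <= e * (Num.truncn (C / e)).+1%:R.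
  by rewrite mulrC -ler_pdivrMr// ltW// truncnS_gt.
have mp : 0 < m.-1%:R :> R by rewrite ltr0n /m /= addnS.
rewrite ler_pdivrMr// (le_trans ct)// ler_pM2l// ler_nat; exact: leq_addl.
Qed.

(** A child Y in annulus n is within n of X while |Y| >= n^b >= n^2, so it cannot be far away; the
    bounded region has finitely many points. *)
Lemma annuli_finite_children X : N X -> finite_set [set Y | [/\ N Y, Y <> origin & anc Y = X]].
Proof.
move=> NX; pose m := (n0 + (Num.truncn (enorm X)).+2).+1.
apply: (@sub_finite_set _ _ (N `&` [set z | enorm z < rad m])) => [Y [NY Y0 YX]|]; last exact: Nfin.
split => //=; rewrite ltNge; apply/negP => mY.
have [n mn [Y1 Y2]] := rad_index mY.
have nn : (n0 <= n)%N by move: mn; rewrite /m; clear; lia.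
have := step_down nn NY Y1 (ltW Y2); rewrite YX.
have := rad_sqr n; have := truncnS_gt (enorm X).
have : (Num.truncn (enorm X)).+2%:R <= n%:R :> R.
  by rewrite ler_nat; move: mn; rewrite /m; clear; lia.
have n2 : 2 <= n%:R :> R by rewrite ler_nat; move: n02 nn; clear; lia.
rewrite -[(_).+2%:R]natr1; move: (_.+1%:R) => x; rewrite expr2; nra.
Qed.

(** Take a point of [N] within n of the point of norm n^b on the ray of u: the directions differ by
    at most 4 / n as b >= 2. *)
Lemma annuli_dense_directions u : unit_circle u -> exists Z : nat -> plane R,
  [/\ forall l, N (Z l), forall l, l%:R <= enorm (Z l) & converges_to (fun l => direction (Z l)) u].
Proof.
move=> u1; pose n l := (n0 + l)%N.
have /choice[Z hZ] : forall l, exists z, [/\ N z, l%:R <= enorm z & enorm (direction z - u) <= 4 / (n l)%:R].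
  move=> l; pose p : plane R := rad (n l) *: u.
  have np : enorm p = rad (n l) by rewrite enormZ u1 mulr1 ger0_norm// exprn_ge0.
  have [|z [Nz zp pz]] := dense (p := p) (leq_addr l n0).
    by rewrite np lexx rad_le.
  have n2 : 2 <= (n l)%:R :> R by rewrite ler_nat /n; move: n02; clear; lia.
  have nl : l%:R <= (n l)%:R :> R by rewrite ler_nat /n leq_addl.
  have rs := rad_sqr (n l); have {}pz : enorm (p - z) <= (n l)%:R := pz.
  have zn : rad (n l) - (n l)%:R <= enorm z by have := enorm_le_sub p z; rewrite np; lra.
  have zh : (n l)%:R ^+ 2 / 2 <= enorm z by move: rs; rewrite expr2; nra.
  have s0 : 0 < (n l)%:R ^+ 2 / 2 :> R by rewrite divr_gt0 ?exprn_gt0//; lra.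
  exists z; split => //; first by move: rs; rewrite expr2; nra.
  have -> : u = direction p.
    have r0 : rad (n l) != 0 by rewrite expf_neq0// gt_eqF//; lra.
    by rewrite /direction np [u]surjective_pairing /p /=; congr pair; rewrite mulrAC mulfV// mul1r.
  rewrite enormN; have ph : (n l)%:R ^+ 2 / 2 <= enorm p by rewrite np; move: rs; nra.
  apply: (le_trans (direction_lip s0 ph zh)).
  have -> : 4 / (n l)%:R = 2 * (n l)%:R / ((n l)%:R ^+ 2 / 2) :> R by field; lra.
  by rewrite ler_pM2r ?invr_gt0// ler_pM2l.
exists Z; split=> [l|l|]; [by have [] := hZ l|by have [] := hZ l|].
move=> e e0; exists (Num.truncn (4 / e)).+1 => l le.
have [_ _ h] := hZ l; apply: (le_trans h).
have n1 : 0 < (n l)%:R :> R by rewrite ltr0n /n; move: n02; clear; lia.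
rewrite ler_pdivrMr// mulrC -ler_pdivrMr// (le_trans (ltW (truncnS_gt _)))// ler_nat.
by rewrite (leq_trans le)// leq_addl.
Qed.

End FromAnnuli.

Lemma ratio_cancel (R : realFieldType) (k r p m m' : R) : 0 < r -> 0 < p -> 0 < m -> 0 < m' ->
  4 * k / r / (p / (m * m')) / (2 * m') = 2 * k * m / r / p.
Proof. by move=> r0 p0 m0 m'0; field; rewrite !gt_eqF. Qed.

(** * The exceptional event of one annulus *)

Section AnnulusEvent.
Context {R : realType} d (T : measurableType d) (P : probability T R).
Variable Phi : T -> set (plane R).
Hypothesis hPhi : homogeneous_poisson P 1 Phi.
Local Notation leb2 := (@lebesgue_plane R).
Local Notation ple := (ple P).
Implicit Types (w : T) (X Y Z z p : plane R).

Variables (rin top W eta M cbar l E e : R) (K J m0 B : nat).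
Local Notation kap := (kap W eta K).
Let r (j : nat) : R := top - j%:R * M.
Let delta : R := 2 * pi / m0%:R.
Hypothesis rin0 : 0 < rin.
Hypothesis W0 : 0 < W.
Hypothesis eta0 : 0 < eta.
Hypothesis m00 : (0 < m0)%N.
Hypothesis WM : 2 * W < M.
Hypothesis rinJ : rin + W <= r J.
Hypothesis kapM : kap M <= rin / 64.
Hypothesis cbar_ge : 2 * kap M * m0%:R / rin + 1 <= cbar.
Hypothesis B_ge : delta / 2 + 4 * kap (2 * W) / rin <= B%:R * delta.
Hypothesis l0 : 0 <= l.
Hypothesis lc : l * cbar <= 1 / 2.
Hypothesis e16 : e <= 1 / 16.
Hypothesis Ee : (E + 1) * delta <= e.

Let M0 : 0 < M. Proof. by have := WM; have := W0; lra. Qed.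
Let rS j : r j.+1 = r j - M. Proof. by rewrite /r -natr1 mulrDl mul1r opprD addrA. Qed.
Let r_top : r 0%N = top. Proof. by rewrite /r mul0r subr0. Qed.
Let rJ0 : 0 < r J. Proof. by have := rinJ; have := W0; have := rin0; lra. Qed.
Let r_mono i j : (i <= j)%N -> r j <= r i. Proof. exact: r_le rS M0 _ _. Qed.
Let r_gt0 j : (j <= J)%N -> 0 < r j. Proof. by move=> /r_mono; exact: lt_le_trans. Qed.
Let delta0 : 0 < delta. Proof. by rewrite divr_gt0 ?mulr_gt0 ?pi_gt0// ltr0n. Qed.
Let kapM0 : 0 <= kap M. Proof. exact: kap_ge0 W0 eta0 _ (ltW M0). Qed.
Let top0 : 0 < top. Proof. by rewrite -r_top; exact: r_gt0. Qed.

Let start j (i : int) := polar (r j) (i%:~R * delta).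
(** All starting points of the annulus, followed by the origin: a near tie of distances from the
    origin is a near tie of norms, so one event serves both purposes. *)
Let starts (u : 'I_(J * m0).+1) : plane R :=
  if (u < J * m0)%N then start (u %/ m0) (u %% m0)%N else origin.

Let starts_le u : enorm (starts u) <= top.
Proof.
rewrite /starts; case: ifP => h; last by rewrite enorm0 ltW.
have jJ : (u %/ m0 <= J)%N by rewrite ltnW// ltn_divLR.
by rewrite enorm_polar ?(ltW (r_gt0 jJ))// -r_top; exact: r_mono.
Qed.

Let startsP j (i : int) : (j < J)%N -> exists u, start j i = starts u.
Proof.
move=> jJ; pose k := `|(i %% m0%:Z)%Z|%N.
have m0Z : (m0%:Z != 0) by rewrite eqz_nat -lt0n.
have kE : (k%:Z = i %% m0%:Z)%Z by rewrite gez0_abs// modz_ge0.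
have km : (k < m0)%N by rewrite -ltz_nat kE ltz_pmod.
have um : (j * m0 + k < J * m0)%N.
  by rewrite (leq_trans _ (leq_mul jJ (leqnn m0)))// mulSn addnC ltn_add2r.
exists (Ordinal (ltnW um : (j * m0 + k < (J * m0).+1)%N)); rewrite /starts /= um.
rewrite divnMDl// divn_small// addn0 modnMDl modn_small// /start.
rewrite -(polarDz _ (k%:~R * delta) (i %/ m0%:Z)%Z); congr polar.
rewrite {1}(divz_eq i m0%:Z) -kE intrD intrM mulrDl addrC /delta.
by congr (_ + _); have : m0%:R != 0 :> R; [rewrite pnatr_eq0 -lt0n|rewrite -[m0%:Z%:~R]/(m0%:R); move=> h; field].
Qed.

Section Good.
Variable w : T.
Let N := origin |` Phi w.
Let N0 : N origin. Proof. by left. Qed.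
Hypothesis Nfin : forall s : R, finite_set (N `&` [set z | enorm z < s]).
Hypothesis Nuniq : forall X, N X -> X <> origin -> unique_nearest N X.
Hypothesis Ninj : forall X Y, N X -> N Y -> enorm X = enorm Y -> X = Y.
Hypothesis dense : forall p, rin <= enorm p <= top ->
  exists z, [/\ N z, enorm z < enorm p & enorm (p - z) <= W].
Hypothesis not_steep : ~ steep Phi rin top W eta K w.

Section Mesh.
Variables (g h : R) (q m' m1 stop : nat) (cm : int).
Hypothesis g0 : 0 < g.
Hypothesis h0 : 0 < h.
Hypothesis qh : q%:R * h = M.
Hypothesis stopW : W <= stop%:R * h.
Hypothesis stop2W : stop%:R * h <= 2 * W.
Hypothesis stopq : (stop < q)%N.
Hypothesis m'0 : (0 < m')%N.
Hypothesis m3 : (2 < m1.+1)%N.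
Hypothesis mE : m1.+1 = (m0 * m')%N.
Hypothesis gh : 4 * (h + top * @gam R m1) <= g.
Hypothesis cm0 : 0 <= cm.
Hypothesis cm_lt : cm < m1.+1%:Z.
Hypothesis cm_le : 4 * kap M / rin <= (cm%:~R - 1) * @gam R m1.
Hypothesis no_tie_w : ~ near_tie Phi starts top g w.
Let om := bits Phi (fun c : cell J q m1 => cellset r h c) w.
Let up (j : nat) (om : {ffun cell J q m1 -> bool}) (i : int) : int :=
  upper (rad r h) stop cm q r m' B j om i.
Let lo (j : nat) (om : {ffun cell J q m1 -> bool}) (i : int) : int :=
  lower (rad r h) stop cm q r m' B j om i.
Hypothesis chains : forall j n i, (j + n <= J)%N -> (i <= m0.+1)%N ->
  (chain (up ^~ om) j n i%:Z - i%:Z)%:~R <= E /\ (i%:Z - chain (lo ^~ om) j n i%:Z)%:~R <= E.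

Let not_origin z : r J <= enorm z -> z <> origin.
Proof. by move=> h1 e1; move: h1; rewrite e1 enorm0 leNgt rJ0. Qed.

Let Phi_in z : N z -> z <> origin -> Phi w z.
Proof. by case. Qed.

Let tie_free p Y Z : base Phi starts top w p -> base Phi starts top w Y ->
  Phi w Z -> enorm Z < top -> p <> Y -> Z <> p -> Z <> Y -> g < `|enorm (p - Y) - enorm (p - Z)|.
Proof.
move=> bp bY PZ Zt pY Zp ZY; rewrite ltNge; apply/negP => le.
by apply: no_tie_w; exists p, Y, Z.
Qed.

Let base_start j i : (j < J)%N -> base Phi starts top w (start j i).
Proof. by move=> /(startsP i)[u ->]; left; exists u. Qed.

Let base_origin : base Phi starts top w origin.
Proof. by left; exists ord_max; rewrite /starts /= ltnn. Qed.

Let base_N z : N z -> enorm z < top -> base Phi starts top w z.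
Proof. by move=> [-> //|Pz] zt; right. Qed.

Let in_rangeP z : in_range J r z -> z <> origin /\ enorm z < top.
Proof. by rewrite /in_range r_top => -[/not_origin h1 h2]. Qed.

Let no_norm_tie X Y : N X -> N Y -> X <> Y -> in_range J r X -> in_range J r Y ->
  g < `|enorm X - enorm Y|.
Proof.
move=> NX NY XY /in_rangeP[X0 Xt] /in_rangeP[Y0 Yt].
have := @tie_free origin X Y base_origin (base_N NX Xt) (Phi_in NY Y0) Yt.
by rewrite !enorm_0sub; apply=> // e1; [case: X0|case: XY].
Qed.

Let no_tie_base p : base Phi starts top w p -> no_tie N J r g p.
Proof.
move=> bp Y Z NY NZ YZ /in_rangeP[Y0 Yt] /in_rangeP[Z0 Zt] Yp Zp.
apply: tie_free => //; first exact: base_N.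
- exact: Phi_in.
- by move=> e1; case: Yp.
- by move=> e1; case: YZ.
Qed.

Let generic_start j i : (j < J)%N -> generic N (start j i).
Proof.
move=> jJ; have s0 : 0 < r j by exact: r_gt0 (ltnW jJ).
have ns : enorm (start j i) = r j by rewrite enorm_polar// ltW.
have st : r j <= top by rewrite -r_top r_mono.
apply: snear_anc => //; first by move=> e1; move: s0; rewrite -ns e1 enorm0 ltxx.
move=> Y Z NY NZ; rewrite ns => Yr Zr e1; apply: contrapT => YZ.
have key U V : N U -> N V -> enorm U < r j -> enorm V < r j -> U <> V -> V <> origin ->
    enorm (start j i - U) = enorm (start j i - V) -> False.
  move=> NU NV Ur Vr UV V0 e2.
  have := @tie_free (start j i) U V (base_start i jJ) (base_N NU (lt_le_trans Ur st))
    (Phi_in NV V0) (lt_le_trans Vr st).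
  rewrite e2 subrr normr0 ltNge ltW// => no.
  have : false; last by [].
  by apply: no => e3; [move: Ur; rewrite -e3 ns ltxx|move: Vr; rewrite e3 ns ltxx|case: UV].
have [Z0|/eqP Z0] := eqVneq Z origin; last exact: (key Y Z).
by apply: (key Z Y) => // [e2|e2]; case: YZ; rewrite ?e2// Z0 e2.
Qed.

Let gam0 : 0 < @gam R m1. Proof. exact: gam_gt0. Qed.

Let delta_gam : delta = 2 * m'%:R * @gam R m1.
Proof.
have e1 : m1.+1%:R = m0%:R * m'%:R :> R by rewrite mE natrM.
rewrite /delta gamE e1; field.
by rewrite !pnatr_eq0 -!lt0n m00 m'0.
Qed.

(** The walks run on the occupation bits of w. Without near ties [start_step] applies to every
    starting point, so bounds on the discrete chains become angular bounds for the tree. *)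
Lemma annulus_good X k : N X -> r J <= enorm X -> enorm X < top ->
  (forall i, (i < k)%N -> r J <= enorm (iter i (anc N) X)) ->
  enorm (direction X - direction (iter k (anc N) X)) <= 2 * (2 * kap M + W) / rin + 2 * e.
Proof.
move=> NX XJ Xt hk.
have sparse : forall v : nat -> plane R, (forall i, (i <= K)%N -> N (v i)) ->
  (forall i j, (i < j <= K)%N -> enorm (v j) < enorm (v i)) ->
  (forall i, (i < K)%N -> enorm (v i - v i.+1) <= W) -> rin <= enorm (v K) ->
  enorm (v 0%N) <= top -> enorm (v 0%N) - enorm (v K) <= eta -> False.
  by move=> v v1 v2 v3 v4 v5 v6; apply: not_steep; exists v.
have rinJ' : rin <= r J by have := rinJ; have := W0; lra.
have omP c : om c <-> exists2 z, N z & cellset r h c z.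
  rewrite /om ffunE; split=> [/asboolP[z Pz cz]|[z Nz cz]]; first by exists z => //; right.
  apply/asboolP; exists z => //; apply: Phi_in => //; apply: not_origin.
  have /andP[c1 _] := cellset_block rS h0 qh m3 cz.
  by apply: le_trans c1; apply: r_mono; exact: ltn_ord.
have B_le : @gam R m1 + 4 * kap (stop%:R * h) / rin <= B%:R * delta.
  apply: le_trans B_ge; apply: lerD.
    rewrite delta_gam; have mm : 1 <= m'%:R :> R by rewrite ler1n.
    by have := gam0; nra.
  rewrite ler_pM2r ?invr_gt0// ler_pM2l//.
  rewrite kapE ler_pM2r// lerD2r ler_pM2r ?ltr0n// lerD2r ler_pM2r ?invr_gt0//.
have steps j i y : (j < J)%N -> at_level N (start j i) (r j.+1) y ->
    exists t, [/\ y = polar (r j.+1) t, `|t - i%:~R * delta| <= 1 / 4,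
      (lo j om i)%:~R * delta <= t & t <= (up j om i)%:~R * delta].
  apply: (@start_step _ N N0 Nfin Nuniq rin top W eta K rin0 W0 eta0 dense sparse
    J q m0 m' m1 r M h rS M0 h0 qh m3 mE m00 m'0 rinJ' _ om omP g _ no_norm_tie _ stop stopW stopq
    cm B cm0 cm_lt kapM cm_le B_le generic_start) => //; rewrite ?r_top//.
  - by move=> Y NY /in_rangeP[Y0 Yt]; apply: no_tie_base; exact: base_N.
  - by move=> j' i' jJ; apply: no_tie_base; exact: base_start.
apply: (@annulus_straight _ N N0 Nfin Nuniq Ninj rin top W eta K rin0 W0 eta0 dense sparse
  M delta r J (fun j => up j om) (fun j => lo j om) M0 delta0 rS) => //; rewrite ?r_top//.
  by apply: (le_trans kapM); rewrite ler_pM2l// lef_pV2 ?posrE// ler_nat.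
move=> j n i jn; case: i => [i|//] _ i2; rewrite -[(Posz i)%:~R]/(i%:R : R) in i2.
have im : (i <= m0)%N.
  rewrite -(ler_nat R) -(ler_pM2r delta0) (le_trans i2)// le_eqVlt; apply/orP; left; apply/eqP.
  rewrite /delta; field.
  by rewrite pnatr_eq0 -lt0n.
have [_ c1] := chains jn (leqW im); have [c2 _] := chains jn (im : (i.+1 <= m0.+1)%N).
have Ed : E * delta <= e by have := Ee; rewrite mulrDl mul1r; have := delta0; lra.
split; last by apply: le_trans Ed; rewrite ler_pM2r.
apply: le_trans Ee; rewrite ler_pM2r//.
have -> : (i%:Z + 1 = i.+1%:Z) by rewrite -addn1 PoszD.
by move: c2; rewrite -addn1 PoszD !intrB intrD; lra.
Qed.

End Mesh.
End Good.

(** The tolerance g fixes the mesh, but [cbar] does not involve g: displacements measured in units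
    of the starting grid stay bounded under refinement. *)
Let mesh_exists (g : R) : 0 < g -> exists (h : R) (q m' m1 stop : nat) (cm : int),
  [/\ [/\ 0 < h, q%:R * h = M, W <= stop%:R * h, stop%:R * h <= 2 * W & (stop < q)%N],
      [/\ (0 < m')%N, (2 < m1.+1)%N, m1.+1 = (m0 * m')%N & 4 * (h + top * @gam R m1) <= g] &
      [/\ 0 <= cm, cm < m1.+1%:Z, 4 * kap M / rin <= (cm%:~R - 1) * @gam R m1 &
          cm%:~R / (2 * m'%:R) <= cbar]].
Proof.
(* The radial and angular mesh errors get g / 8 each, so four times their sum is g. Also h <= W
   bounds the unexplored part by 2 W. *)
move=> g0; pose s := Num.min (g / 8) W.
have s0 : 0 < s by rewrite lt_min divr_gt0//=.
pose q := (Num.truncn (M / s)).+1; pose h := M / q%:R.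
have q0 : 0 < q%:R :> R by rewrite ltr0n.
have h0 : 0 < h by rewrite divr_gt0.
have hs : h <= s.
  by rewrite ler_pdivrMr// mulrC -ler_pdivrMr// ltW// truncnS_gt.
have [hg hW] : h <= g / 8 /\ h <= W by move: hs; rewrite le_min => /andP.
pose stop := (Num.truncn (W / h)).+1.
have Wh0 : 0 <= W / h by rewrite divr_ge0// ltW.
have stop1 : W <= stop%:R * h by rewrite -ler_pdivrMr// ltW// truncnS_gt.
have stop2 : stop%:R * h <= 2 * W.
  rewrite /stop -natr1 mulrDl mul1r (_ : 2 * W = W + W); last by ring.
  by rewrite lerD// -ler_pdivlMr// truncn_le.
have qh : q%:R * h = M by rewrite /h mulrC divfK// gt_eqF.
have stopq : (stop < q)%N by rewrite -(ltr_nat R) -(ltr_pM2r h0) qh (le_lt_trans stop2).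
have pi0 := pi_gt0 R.
(* The first term makes top gam at most g / 8; the extra 8 gives gam <= pi / 8, which leaves room
   for cm < m. *)
pose m' := ((Num.truncn (8 * top * pi / g)).+1 + 8)%N.
have m'0 : (0 < m')%N by rewrite /m' addnS.
have m1E : (m0 * m').-1.+1 = (m0 * m')%N by rewrite prednK// muln_gt0 m00.
have m'R : 0 < m'%:R :> R by rewrite ltr0n.
have m0R : 1 <= m0%:R :> R by rewrite ler1n.
have gamE : @gam R (m0 * m').-1 = pi / (m0%:R * m'%:R) by rewrite /gam m1E natrM.
have gam0 : 0 < @gam R (m0 * m').-1 by exact: gam_gt0.
have gamm' : @gam R (m0 * m').-1 <= pi / m'%:R.
  by rewrite gamE ler_pM2l// lef_pV2 ?posrE ?mulr_gt0 ?ltr0n// ler_peMl// ltW.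
have gam8 : @gam R (m0 * m').-1 <= pi / 8.
  apply: (le_trans gamm'); rewrite ler_pM2l// lef_pV2 ?posrE// ler_nat /m' leq_addl //.
have topg : top * @gam R (m0 * m').-1 <= g / 8.
  apply: (@le_trans _ _ (top * (pi / m'%:R))); first by rewrite ler_pM2l.
  rewrite mulrA ler_pdivrMr//.
  have := truncnS_gt (8 * top * pi / g); rewrite ltr_pdivrMr// => hh.
  have : (Num.truncn (8 * top * pi / g)).+1%:R <= m'%:R :> R by rewrite ler_nat leq_addr.
  by rewrite -(ler_pM2r g0) => hh'; lra.
pose x := 4 * kap M / rin / @gam R (m0 * m').-1.
have x0 : 0 <= x by rewrite divr_ge0 ?(ltW gam0)// divr_ge0 ?(ltW rin0)// mulr_ge0.
(* One unit covers truncation, the other the half cell between V and the centre of its cell. *)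
pose cm := (Num.truncn x).+2.
have cm1 : x <= cm%:R - 1 by rewrite /cm -natr1 addrK ltW// truncnS_gt.
have cm2 : cm%:R <= x + 2.
  by rewrite /cm -addn2 natrD lerD2r truncn_le.
have xg : x * @gam R (m0 * m').-1 = 4 * kap M / rin by rewrite /x divfK// gt_eqF.
have k16 : 4 * kap M / rin <= 1 / 16.
  by rewrite ler_pdivrMr//; have := kapM; lra.
exists h, q, m', (m0 * m').-1, stop, cm%:Z; split; split => //.
- by rewrite m1E (leq_trans _ (leq_mul m00 (_ : 8 <= m')%N))// leq_addl.
- by lra.
- rewrite ltz_nat -(ltr_nat R) -(ltr_pM2r gam0).
  have -> : (m0 * m').-1.+1%:R * @gam R (m0 * m').-1 = pi.
    by rewrite /gam mulrC divfK// pnatr_eq0.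
  apply: (@le_lt_trans _ _ ((x + 2) * @gam R (m0 * m').-1)); first by rewrite ler_pM2r.
  by have := pi_ge2 R; rewrite mulrDl xg; lra.
- by rewrite -xg ler_pM2r.
- rewrite -[(Posz cm)%:~R]/(cm%:R : R); apply: le_trans cbar_ge.
  apply: (@le_trans _ _ ((x + 2) / (2 * m'%:R))).
    by rewrite ler_pM2r// invr_gt0 mulr_gt0.
  rewrite mulrDl; apply: lerD; last first.
    by rewrite ler_pdivrMr ?mulr_gt0// mul1r ler_peMr// ler1n.
  have m0n : 0 < m0%:R :> R by lra.
  rewrite /x gamE (_ : _ / (2 * m'%:R) = 2 * kap M * m0%:R / rin / pi); last exact: ratio_cancel.
  rewrite ler_pdivrMr// ler_peMr//; last by have := pi_ge2 R; lra.
  by rewrite divr_ge0 ?(ltW rin0)// mulr_ge0// mulr_ge0.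
Qed.

Let ring_area_fin (q m1 : nat) h (c : cell J q m1) : 0 < h -> leb2 (cellset r h c) \is a fin_num.
Proof.
move=> h0; rewrite cellset_ring_cell; set s := _ + _.
have s0 : 0 <= s by rewrite addr_ge0 ?mulr_ge0 ?(ltW h0)// ltW// r_gt0//; exact: ltn_ord.
have D0 : (0 <= leb2 (ring_cell m1 s h c.2))%E by exact: integral_ge0.
rewrite ge0_fin_numE//.
apply: (@le_lt_trans _ _ (leb2 (ring_at 0%R s h))); last by rewrite area_ring// ltry.
by apply: (@le_measure _ _ _ leb2); rewrite ?inE; [exact: measurable_ring_cell|exact: measurable_ring|exact: subIsetl].
Qed.

Let tail : R := expR (- (l * E)) * expR (l * (B%:R + 1) + 2 * (l * cbar) ^+ 2) ^+ J.

(** The order of choices matters: the constant C of near ties depends on the starting points only,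
    then g makes C g at most eps, then the mesh follows. The bound [tail] for the chains is the same
    for all meshes. *)
Lemma ple_annulus (eps : R) : 0 < eps -> exists2 F : set T,
  ple F (J.+1%:R * J.+1%:R * m0.+2%:R * 2 * tail + eps) &
  forall w, ~ F w -> let N := origin |` Phi w in
  (forall s : R, finite_set (N `&` [set z | enorm z < s])) ->
  (forall X, N X -> X <> origin -> unique_nearest N X) ->
  (forall X Y, N X -> N Y -> enorm X = enorm Y -> X = Y) ->
  (forall p, rin <= enorm p <= top ->
    exists z, [/\ N z, enorm z < enorm p & enorm (p - z) <= W]) ->
  ~ steep Phi rin top W eta K w ->
  forall X k, N X -> r J <= enorm X -> enorm X < top ->
  (forall i, (i < k)%N -> r J <= enorm (iter i (anc N) X)) ->
  enorm (direction X - direction (iter k (anc N) X)) <= 2 * (2 * kap M + W) / rin + 2 * e.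
Proof.
move=> eps0; have [C C0 tieC] := ple_near_tie hPhi (ltW top0) starts_le.
pose g := Num.min 1 (eps / (C + 1)).
have C1 : 0 < C + 1 by rewrite ltr_wpDl.
have g0 : 0 < g by rewrite lt_min ltr01 divr_gt0.
have g1 : g <= 1 by rewrite ge_min lexx.
have Cg : C * g <= eps.
  apply: (@le_trans _ _ (C * (eps / (C + 1)))); first by rewrite ler_wpM2l// ge_min lexx orbT.
  by rewrite mulrA ler_pdivrMr// mulrC ler_pM2l// lerDl.
have [h [q [m' [m1 [stop [cm]]]]]] := mesh_exists g0.
move=> [[h0 qh stopW stop2W stopq] [m'0 m3 mE gh] [cm0 cm_lt cm_le cm_bar]].
pose S (c : cell J q m1) := cellset r h c.
pose up (j : nat) (om : {ffun cell J q m1 -> bool}) (i : int) : int :=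
  upper (rad r h) stop cm q r m' B j om i.
pose lo (j : nat) (om : {ffun cell J q m1 -> bool}) (i : int) : int :=
  lower (rad r h) stop cm q r m' B j om i.
(* Indexed by first circle, number of circles, starting index and side. Indices run up to m0 + 1
   because the upper chain starts one unit above the angle reached. *)
pose bad (x : 'I_J.+1 * 'I_J.+1 * 'I_m0.+2 * bool) (om : {ffun cell J q m1 -> bool}) : bool :=
  (x.1.1.1 + x.1.1.2 <= J)%N &&
  if x.2 then E < (chain (up ^~ om) x.1.1.1 x.1.1.2 (x.1.2 : nat)%:Z - (x.1.2 : nat)%:Z)%:~R
  else E < ((x.1.2 : nat)%:Z - chain (lo ^~ om) x.1.1.1 x.1.1.2 (x.1.2 : nat)%:Z)%:~R.
pose a (c : cell J q m1) : R := fine (leb2 (S c)).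
have Sa c : leb2 (S c) = (a c)%:E by rewrite /a fineK//; exact: ring_area_fin.
have a0 c : 0 <= a c by rewrite fine_ge0//; exact: integral_ge0.
have mS c : measurable (S c) by rewrite /S cellset_ring_cell; exact: measurable_ring_cell.
have tS : trivIset setT S.
  by move=> c c' _ _ [z [zc zc']]; exact: (cellset_inj rS M0 h0 qh m3 rJ0 zc zc').
pose wt c := bit_law (a c).
have wt_ge0 c b : 0 <= wt c b.
  rewrite /wt /bit_law; case: b; last exact: expR_ge0.
  by rewrite subr_ge0 -expR0 ler_expR oppr_le0.
have wt_sum c : wt c true + wt c false = 1 by rewrite /wt /bit_law subrK.
have wt_rot c c' : c.1 = c'.1 -> wt c = wt c'.
  move=> cc; rewrite /wt /a /S !cellset_ring_cell /blk /lev cc.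
  by rewrite [in LHS]area_ring_cell_rot [in RHS]area_ring_cell_rot.
have cc0 : 0 <= cm%:~R / (2 * m'%:R) :> R.
  by rewrite divr_ge0 ?mulr_ge0// ler0z.
have lcm : l * (cm%:~R / (2 * m'%:R)) <= 1 / 2.
  by apply: le_trans lc; rewrite ler_wpM2l.
have tail_ge n : (n <= J)%N -> expR (- (l * E)) *
   expR (l * (B%:R + 1) + 2 * (l * (cm%:~R / (2 * m'%:R))) ^+ 2) ^+ n <= tail.
  move=> nJ; rewrite ler_pM2l ?expR_gt0//.
  set G := expR _; set G' := expR (l * (B%:R + 1) + 2 * (l * cbar) ^+ 2).
  have GG : G <= G'.
    rewrite ler_expR lerD2l ler_pM2l//; have c0 : 0 <= cbar := le_trans cc0 cm_bar.
    by rewrite ler_pXn2r ?nnegrE ?(mulr_ge0 l0)// ler_wpM2l.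
  apply: (@le_trans _ _ (G' ^+ n)); first by rewrite lerXn2r ?nnegrE ?expR_ge0.
  apply: ler_weXn2l => //; rewrite -expR0 ler_expR; apply: addr_ge0.
    by apply: mulr_ge0 => //; exact: addr_ge0.
  by apply: mulr_ge0 => //; exact: sqr_ge0.
have tail0 : 0 <= tail by rewrite mulr_ge0 ?exprn_ge0 ?expR_ge0.
have pbad x : ple (fun w => bad x (bits Phi S w)) tail.
  apply: ple_sub (ple_bits hPhi (bad x) mS Sa tS); first by [].
  case: x => x s; case: x => x i; case: x => j k; rewrite /bad /=.
  case: (leqP (j + k) J) => jn /=; last first.
    by rewrite (le_trans _ tail0)//; rewrite (mean_cst wt_sum 0).
  have nJ : (k <= J)%N by exact: leq_trans (leq_addl _ _) jn.
  apply: le_trans (tail_ge k nJ).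
  case: s.
    exact: (upper_tail _ _ cm0 cm_lt wt_ge0 wt_sum wt_rot _ _ _ m'0 l0 lcm).
  exact: (lower_tail _ _ cm0 cm_lt wt_ge0 wt_sum wt_rot _ _ _ m'0 l0 lcm).
exists ([set w | exists x, bad x (bits Phi S w)] `|` near_tie Phi starts top g).
  apply: ple_sub (pleU (ple_exists_cst pbad) (tieC g _)) => //; last by rewrite g0.
  by rewrite !card_prod !card_ord card_bool !natrM lerD2l.
move=> w Fw Nn Nfin Nuniq Ninj dense ns X k NX X1 X2 hk.
apply: (@annulus_good w Nfin Nuniq Ninj dense ns g h q m' m1 stop cm g0 h0 qh stopW stop2W stopq m'0 m3
  mE gh cm0 cm_lt cm_le _ _ X k NX X1 X2 hk).
  by move=> tie; apply: Fw; right.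
move=> j n i jn im.
have jJ : (j < J.+1)%N by rewrite ltnS (leq_trans (leq_addr n j)).
have nJ : (n < J.+1)%N by rewrite ltnS (leq_trans (leq_addl j n)).
split; rewrite leNgt; apply/negP => lt; apply: Fw; left.
  by exists (Ordinal jJ, Ordinal nJ, Ordinal (im : (i < m0.+2)%N), true); rewrite /bad /= jn.
by exists (Ordinal jJ, Ordinal nJ, Ordinal (im : (i < m0.+2)%N), false); rewrite /bad /= jn.
Qed.

End AnnulusEvent.

(** * Choice of constants *)

(* In the annulus x^21 <= |z| <= (x + 1)^21: steps of length at most x, eta = x^-3, K = 44,
   x^13 blocks of width M ~ x^7, x^21 starting angles, l = x^-17 in the exponential moment, and
   angular deviations of E = x^19 / 16 units. *)
Section Constants.
Context {R : realType}.
Implicit Types (x c : R) (a k : nat).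

Lemma pow_absorb x c a k : 1 <= x -> c <= x -> (a < k)%N -> c * x ^+ a <= x ^+ k.
Proof.
move=> x1 cx ak; have x0 : 0 <= x by lra.
apply: (@le_trans _ _ (x ^+ a.+1)); first by rewrite exprS ler_wpM2r ?exprn_ge0.
by rewrite ler_weXn2l.
Qed.

Lemma pow_expR k : exists2 C : R, 0 <= C & forall x, 0 <= x -> x ^+ k <= C * expR x.
Proof.
case: k => [|k].
  by exists 1 => // x x0; rewrite expr0 mul1r -expR0 ler_expR.
exists (k.+1)`!%:R => // x x0.
have := expR_ge1Dxn k x0; have f0 : 0 < (k.+1)`!%:R :> R by rewrite ltr0n fact_gt0.
move: (k.+1)`!%:R f0 (expR x) (x ^+ k.+1) => f f0 y z h.
have : z / f <= y by lra.
by rewrite ler_pdivrMr// mulrC.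
Qed.

(** The thickness of an annulus; one constant D serves for all x. *)
Lemma pow_succ_gap a : exists D : nat, forall x, 1 <= x ->
  (x + 1) ^+ a.+1 - x ^+ a.+1 <= D%:R * x ^+ a /\ x ^+ a <= (x + 1) ^+ a.+1 - x ^+ a.+1.
Proof.
exists (a.+1 * 2 ^ a)%N => x x1; have x0 : 0 <= x by lra.
split; last first.
  have : x ^+ a <= (x + 1) ^+ a by rewrite lerXn2r ?nnegrE ?addr_ge0// lerDl.
  rewrite !exprS; move: (x ^+ a) ((x + 1) ^+ a) => y z yz; nra.
rewrite subrXX addrAC subrr add0r mul1r.
apply: (@le_trans _ _ (\sum_(i < a.+1) 2%:R ^+ a * x ^+ a)); last first.
  by rewrite sumr_const card_ord -[leLHS]mulr_natl natrM natrX mulrA.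
apply: ler_sum => i _.
have ia : (i <= a)%N by rewrite -ltnS.
have -> : 2%:R ^+ a * x ^+ a = (2 * x) ^+ a by rewrite exprMn.
apply: (@le_trans _ _ ((2 * x) ^+ (a.+1.-1 - i) * (2 * x) ^+ i)); last by rewrite -exprD subnK.
apply: ler_pM; rewrite ?exprn_ge0 ?addr_ge0//.
  by rewrite lerXn2r ?nnegrE ?addr_ge0 ?mulr_ge0//; lra.
by rewrite lerXn2r ?nnegrE ?mulr_ge0//; lra.
Qed.

Section Bounds.
Variables (x D M ua : R).
Hypothesis D0 : 0 <= D.
Hypothesis ua0 : 0 <= ua.
Hypothesis xM1 : x ^+ 7 <= M.
Hypothesis xMD : M <= D * x ^+ 7.
(** A ring of width at most D x^7 takes at most 45 (D x^10 + 1) + 1 steps of length x, hence c1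
    x^11. *)
Let c1 : R := 45 * D + 46.
Hypothesis x_large : 16 * (310 + 50 * c1 ^+ 2) <= x.
Local Notation eta := (x ^+ 3)^-1.
Local Notation kap := (kap x eta 44).

Let c1_ge : 46 <= c1. Proof. by rewrite /c1; have := D0; lra. Qed.

Let x_ge : 128 * c1 <= x.
Proof. have := c1_ge; have := x_large; rewrite expr2; nra. Qed.

Let x1 : 400 <= x. Proof. by have := c1_ge; have := x_ge; lra. Qed.
Let x0 : 0 < x. Proof. by have := x1; lra. Qed.
Let xk (k : nat) : 0 < x ^+ k. Proof. exact: exprn_gt0. Qed.
Let xle (a k : nat) : (a <= k)%N -> x ^+ a <= x ^+ k.
Proof. by move=> ak; rewrite ler_weXn2l//; have := x1; lra. Qed.
Let absorb c (a k : nat) : c <= x -> (a < k)%N -> c * x ^+ a <= x ^+ k.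
Proof. by move=> cx ak; apply: pow_absorb => //; have := x1; lra. Qed.

Lemma param_kap (t c : R) k : 0 <= c -> t <= c * x ^+ k -> kap t <= (45 * c + 46) * x ^+ k.+4.
Proof.
move=> cc tc; rewrite kapE invrK.
have h : t * x ^+ 3 <= c * x ^+ k.+3.
  by rewrite -[k.+3]addn3 exprD mulrA ler_pM2r.
have h1 : 1 <= x ^+ k.+3 by rewrite exprn_ege1//; have := x1; lra.
rewrite [x ^+ k.+4]exprSr mulrA ler_pM2r//.
by move: h h1; move: (t * _) (x ^+ k.+3) => y z h h1; lra.
Qed.

Lemma param_kapM : kap M <= c1 * x ^+ 11. Proof. exact: param_kap. Qed.

Lemma param_WM : 2 * x < M.
Proof.
apply: lt_le_trans xM1; apply: (@lt_le_trans _ _ (3 * x ^+ 1)); last by apply: absorb => //; have := x1; lra.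
by rewrite expr1 ltr_pM2r// ltr_nat.
Qed.

Lemma param_rin : x ^+ 21 / 2 + x <= x ^+ 21.
Proof.
have : 2 * x ^+ 1 <= x ^+ 21 by apply: absorb => //; have := x1; lra.
by rewrite expr1; lra.
Qed.

Lemma param_kap_rin : kap M <= x ^+ 21 / 2 / 64.
Proof.
apply: (le_trans param_kapM).
have : 128 * c1 * x ^+ 11 <= x ^+ 21 by apply: absorb => //; have := x_ge; have := c1_ge; lra.
lra.
Qed.

Lemma param_cbar : 2 * kap M * x ^+ 21 / (x ^+ 21 / 2) + 1 <= 5 * c1 * x ^+ 11.
Proof.
have -> : 2 * kap M * x ^+ 21 / (x ^+ 21 / 2) = 4 * kap M.
  by move: (kap M) (xk 21); move: (x ^+ 21) => y k y0; field; lra.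
have h1 : 1 <= x ^+ 11 by rewrite exprn_ege1//; have := x1; lra.
have := param_kapM; have := c1_ge; move: (kap M) (x ^+ 11) h1 => k y y1 c h; nra.
Qed.

Lemma param_B : 2 * pi / x ^+ 21 / 2 + 4 * kap (2 * x) / (x ^+ 21 / 2) <=
  (300 * x ^+ 5) * (2 * pi / x ^+ 21).
Proof.
have k2 : kap (2 * x) <= (45 * 2 + 46) * x ^+ 5 by apply: param_kap => //; rewrite expr1.
have h5 : 1 <= x ^+ 5 by rewrite exprn_ege1//; have := x1; lra.
have y0 := xk 21; have p2 := pi_ge2 R.
have -> : 2 * pi / x ^+ 21 / 2 + 4 * kap (2 * x) / (x ^+ 21 / 2) = (pi + 8 * kap (2 * x)) / x ^+ 21.
  by move: (kap _) (x ^+ 21) y0 => k y y0; field; lra.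
rewrite mulrA ler_pM2r ?invr_gt0//.
move: (kap _) (x ^+ 5) k2 h5 => k y k2 h5; nra.
Qed.

Lemma param_le1 : 1 <= x. Proof. by have := x1; lra. Qed.

Lemma param_lc : (x ^+ 17)^-1 * (5 * c1 * x ^+ 11) <= 1 / 2.
Proof.
rewrite mulrC ler_pdivrMr//.
have : 10 * c1 * x ^+ 11 <= x ^+ 17 by apply: absorb => //; have := x_ge; have := c1_ge; lra.
lra.
Qed.

Lemma param_e : (x ^+ 2)^-1 <= 1 / 16.
Proof.
rewrite div1r lef_pV2 ?posrE//; have : 16 * x ^+ 1 <= x ^+ 2 by apply: absorb => //; have := x1; lra.
by rewrite expr1; have := x1; lra.
Qed.

Lemma param_E : (x ^+ 19 / 16 + 1) * (2 * pi / x ^+ 21) <= (x ^+ 2)^-1.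
Proof.
have -> : (x ^+ 2)^-1 = x ^+ 19 / x ^+ 21.
  by field; rewrite gt_eqF.
rewrite mulrA ler_pM2r ?invr_gt0//.
have h : 16 <= x ^+ 19.
  have : 16 * x ^+ 0 <= x ^+ 19 by apply: absorb => //; have := x1; lra.
  by rewrite expr0 mulr1.
have p4 : pi < 4 :> R by have := pihalf_lt2 R; lra.
have p2 := pi_ge2 R; move: (x ^+ 19) h => y h; nra.
Qed.

(** The gain l E = x^2 / 16 beats, over x^13 rings, the drift 300 x + x^-4 and the second-order term
    50 c1^2 x. The threshold [x_large] is chosen for this. *)
Lemma param_exponent : - ((x ^+ 17)^-1 * (x ^+ 19 / 16)) + x ^+ 13 *
   ((x ^+ 17)^-1 * (300 * x ^+ 5 + 1) + 2 * ((x ^+ 17)^-1 * (5 * c1 * x ^+ 11)) ^+ 2) <= - x.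
Proof.
have xn : x != 0 by rewrite gt_eqF.
have -> : (x ^+ 17)^-1 * (x ^+ 19 / 16) = x ^+ 2 / 16 by field.
have -> : x ^+ 13 * ((x ^+ 17)^-1 * (300 * x ^+ 5 + 1) + 2 * ((x ^+ 17)^-1 * (5 * c1 * x ^+ 11)) ^+ 2) =
  300 * x + (x ^+ 4)^-1 + 50 * c1 ^+ 2 * x by field.
have h : (x ^+ 4)^-1 <= x.
  rewrite (@le_trans _ _ 1)//; last by have := x1; lra.
  by rewrite invf_le1// exprn_ege1//; have := x1; lra.
have := x_large; have := x0; have := sqr_ge0 c1; move: (c1 ^+ 2) (_^-1) h => y z h y0 x_gt0 xl.
rewrite expr2; nra.
Qed.

Lemma param_angle : 2 * (2 * kap M + x) / (x ^+ 21 / 2) + 2 * (x ^+ 2)^-1 <= (8 * c1 + 6) / x ^+ 2.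
Proof.
have xn : x != 0 by rewrite gt_eqF.
have -> : 2 * (2 * kap M + x) / (x ^+ 21 / 2) = (8 * kap M + 4 * x) / x ^+ 19 / x ^+ 2.
  by move: (kap M) => k; field.
rewrite -mulrDl ler_pM2r ?invr_gt0//.
have : (8 * kap M + 4 * x) / x ^+ 19 <= 8 * c1 + 4; last by lra.
rewrite ler_pdivrMr// [leRHS]mulrDl; apply: lerD.
  rewrite -mulrA ler_pM2l//; apply: (le_trans param_kapM); rewrite ler_pM2l; last by have := c1_ge; lra.
  exact: xle.
by rewrite ler_pM2l// -{1}(expr1 x); exact: xle.
Qed.

Lemma param_steep_gam : 8 * (44 * x) / (x ^+ 21 / 2) <= pi / x ^+ 19.
Proof.
have xn : x != 0 by rewrite gt_eqF.
have -> : 8 * (44 * x) / (x ^+ 21 / 2) = 704 / x / x ^+ 19 by field.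
rewrite ler_pM2r ?invr_gt0// ler_pdivrMr//.
by have := pi_ge2 R; have := x1; nra.
Qed.

Lemma param_steep_KW : 44 * x <= x ^+ 21 / 2 / 4.
Proof.
have : 352 * x ^+ 1 <= x ^+ 21 by apply: absorb => //; have := x1; lra.
by rewrite expr1; lra.
Qed.

(** Origin of K = 44: there are of the order of x^(24 + 19) slots, each of area O(1 / x), and 43 -
    (K + 1) = -2 is a summable exponent. *)
Lemma param_steep : ((D + 1) * x ^+ 24) * (4 * x ^+ 19) *
   ((4 * ((D + 1) * x ^+ 24 * eta) * eta + 4 * eta ^+ 2) * ua / x ^+ 19) ^+ 45 <=
   4 * (D + 1) * ((4 * (D + 1) + 4) * ua) ^+ 45 / x ^+ 2.
Proof.
have xn : x != 0 by rewrite gt_eqF.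
have Dp : 0 <= D + 1 by have := D0; lra.
have h : (4 * ((D + 1) * x ^+ 24 * eta) * eta + 4 * eta ^+ 2) * ua / x ^+ 19 <=
    (4 * (D + 1) + 4) * ua / x.
  have -> : (4 * ((D + 1) * x ^+ 24 * eta) * eta + 4 * eta ^+ 2) * ua / x ^+ 19 =
    (4 * (D + 1) + 4 / x ^+ 24) * ua / x by field.
  rewrite ler_pM2r ?invr_gt0// ler_wpM2r// lerD2l ler_pdivrMr// ler_peMr//.
  by rewrite exprn_ege1//; have := x1; lra.
have A0 : 0 <= (4 * ((D + 1) * x ^+ 24 * eta) * eta + 4 * eta ^+ 2) * ua / x ^+ 19.
  have e0 : 0 <= eta by rewrite invr_ge0 ltW.
  apply: divr_ge0; last exact: ltW.
  apply: mulr_ge0 => //; apply: addr_ge0.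
    by do !apply: mulr_ge0 => //; exact: ltW.
  by apply: mulr_ge0 => //; exact: sqr_ge0.
apply: (@le_trans _ _ (((D + 1) * x ^+ 24) * (4 * x ^+ 19) * ((4 * (D + 1) + 4) * ua / x) ^+ 45)).
  rewrite ler_wpM2l//; first by do !apply: mulr_ge0 => //; exact: ltW.
  by rewrite lerXn2r ?nnegrE//; apply: le_trans h.
move: h A0 => _ _; rewrite expr_div_n; move: (((_ + _) * ua) ^+ 45) => y.
rewrite le_eqVlt; apply/orP; left; apply/eqP.
have -> : x ^+ 45 = x ^+ 24 * x ^+ 19 * x ^+ 2 by rewrite -!exprD.
have := lt0r_neq0 (xk 24); have := lt0r_neq0 (xk 19); have := lt0r_neq0 (xk 2).
move: (x ^+ 24) (x ^+ 19) (x ^+ 2) => u v z u0 v0 z0; field; by rewrite u0 v0 z0.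
Qed.

(** The union bound has of the order of x^(13 + 13 + 21) = x^47 terms, each at most exp (- x). *)
Lemma param_chain (m : nat) : x ^+ 13 = m%:R -> forall t, t = x ^+ 21 ->
  (m.+1%:R * m.+1%:R * (t + 2) * 2 *
     (expR (- ((x ^+ 17)^-1 * (x ^+ 19 / 16))) * expR ((x ^+ 17)^-1 * (300 * x ^+ 5 + 1) +
        2 * ((x ^+ 17)^-1 * (5 * c1 * x ^+ 11)) ^+ 2) ^+ m)) <= 24 * (x ^+ 47 / expR x).
Proof.
move=> xm t ->; rewrite -expRM_natl -expRD -xm.
set E := expR _; have EE : E <= (expR x)^-1 by rewrite -expRN ler_expR; exact: param_exponent.
have h13 : 1 <= x ^+ 13 by rewrite exprn_ege1// param_le1.
have h21 : 1 <= x ^+ 21 by rewrite exprn_ege1// param_le1.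
have -> : 24 * (x ^+ 47 / expR x) = (2 * x ^+ 13) * (2 * x ^+ 13) * (3 * x ^+ 21) * 2 * (expR x)^-1.
  rewrite -[47%N]/(13 + 13 + 21)%N !exprD; ring.
have E0 : 0 <= E by exact: expR_ge0.
have eE : 0 <= (expR x)^-1 by rewrite invr_ge0 expR_ge0.
have m1 : m.+1%:R <= 2 * x ^+ 13 by rewrite -natr1 -xm; lra.
have m0 : 0 <= m.+1%:R :> R by [].
apply: ler_pM => //; first by do !apply: mulr_ge0 => //; lra.
rewrite ler_pM2r//; apply: ler_pM; [exact: mulr_ge0|lra|exact: ler_pM|lra].
Qed.

End Bounds.
End Constants.

Lemma sum_bound (R : realFieldType) (A C z u v : R) : A <= C * z ->
  24 * A + z + (u * (C * z) + v * z) <= (24 * C + 1 + (u * C + v)) * z.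
Proof. by move=> h; rewrite !mulrDl mul1r -!mulrA; lra. Qed.

(** * Almost sure properties and conclusion *)

Section AlmostSure.
Context {R : realType} d (T : measurableType d) (P : probability T R).
Variable Phi : T -> set (plane R).
Hypothesis hPhi : homogeneous_poisson P 1 Phi.
Local Notation leb2 := (@lebesgue_plane R).
Local Notation ple := (ple P).
Implicit Types (w : T) (X Y Z z p : plane R).

Lemma infinite_many A w k : infinite_set (Phi w `&` A) -> many Phi k A w.
Proof.
move=> /(infinite_set_fset k)[B BA kB].
exists (take k (finmap.enum_fset B)); split.
- by rewrite take_uniq// finmap.fset_uniq.
- by rewrite size_take_min; apply/minn_idPl.
- by move=> z /mem_take zB; apply: BA.
Qed.

(** A disc is covered by finitely many squares of area 1/4. Infinitely many points in the disc put
    at least k in one of them, with probability O(4^-k) for every k. *)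
Lemma ae_locally_finite :
  P.-negligible [set w | exists s : R, infinite_set (Phi w `&` [set z | enorm z < s])].
Proof.
pose F (n : nat) := [set w | infinite_set (Phi w `&` [set z | enorm z < n%:R])].
apply: (@negligibleS _ _ _ P (\bigcup_n F n)).
  move=> w [s h]; exists (Num.truncn s).+1 => //; rewrite /F /=; apply: contra_not h.
  apply: sub_finite_set => z [Pz zs]; split => //; exact: lt_trans (truncnS_gt s).
apply: negligible_bigcup => n; apply: ple_negligible => e e0.
pose m := (2 * n).+1; pose sq (ij : 'I_(2 * m) * 'I_(2 * m)) : set (plane R) :=
  square (1 / 2) ((ij.1 : nat)%:Z - m%:Z) ((ij.2 : nat)%:Z - m%:Z).
have h0 : 0 < 1 / 2 :> R by rewrite divr_gt0.
pose c : R := (2 * m)%:R * (2 * m)%:R.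
pose k := (Num.truncn (c / e)).+1.
have small : c * (1 / 4) ^+ k <= e.
  rewrite expr_div_n expr1n div1r ler_pdivrMr ?exprn_gt0// mulrC -ler_pdivrMr//.
  apply: (le_trans (ltW (truncnS_gt _))); rewrite -/k -natrX ler_nat ltnW// ltn_expl//.
have key ij : ple (many Phi k (sq ij)) ((1 / 4) ^+ k).
  apply: (ple_many hPhi); first exact: measurable_square.
  by rewrite area_square//; congr (_%:E); field.
apply: ple_sub (ple_exists_cst key); last by rewrite card_prod card_ord natrM.
move=> w inf; apply: contrapT => no; apply: inf.
apply: (@sub_finite_set _ _ (\bigcup_(ij in [set: 'I_(2 * m) * 'I_(2 * m)]) (Phi w `&` sq ij))).
  move=> z [Pz zn]; have [|i [j ij]] := @square_cover _ (1 / 2) m z h0.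
    by apply: (lt_trans zn); rewrite /m -natr1 natrM mul1r; lra.
  by exists (i, j).
apply: bigcup_finite => [|ij _]; first exact: finite_finset.
by apply: contrapT => inf; apply: no; exists ij; exact: infinite_many.
Qed.

(** Ties between distances from a common point: X = origin gives distinct norms, X a vertex gives a
    unique ancestor. As Z is a Poisson point, the complement is a limit of the events [near_tie]. *)
Definition distinct_distances w := forall X Y Z, [/\ (origin |` Phi w) X, (origin |` Phi w) Y & Phi w Z] ->
  X <> Y -> Z <> X -> Z <> Y -> enorm (X - Y) <> enorm (X - Z).

Lemma ae_distinct_distances : P.-negligible [set w | ~ distinct_distances w].
Proof.
pose S (u : 'I_1) : plane R := origin.
apply: (@negligibleS _ _ _ P (\bigcup_n (near_tie Phi S n%:R 0))).
  move=> w; apply: contra_notP => no X Y Z [NX NY PZ] XY ZX ZY e1; apply: no.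
  pose n := (Num.truncn (enorm X + enorm Y + enorm Z)).+1.
  have := truncnS_gt (enorm X + enorm Y + enorm Z); rewrite -/n => h.
  have := enorm_ge0 X; have := enorm_ge0 Y; have := enorm_ge0 Z => z0 y0 x0.
  have b V : (origin |` Phi w) V -> enorm V < n%:R -> base Phi S n%:R w V.
    by move=> [->|PV] Vn; [left; exists ord0|right].
  exists n => //; exists X, Y, Z; split; split => //.
  - by apply: b => //; lra.
  - by apply: b => //; lra.
  - by lra.
  - by rewrite e1 subrr normr0.
apply: negligible_bigcup => n; apply: ple_negligible => e e0.
have [|u|C C0 h] := @ple_near_tie _ _ _ P Phi hPhi 1 S n%:R; [by []|by rewrite enorm0|].
pose g := Num.min 1 (e / (C + 1)).
have C1 : 0 < C + 1 by rewrite ltr_wpDl.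
have g0 : 0 < g by rewrite lt_min ltr01 divr_gt0.
have g1 : g <= 1 by rewrite ge_min lexx.
apply: ple_sub (h g _); last by rewrite g0.
  move=> w [X [Y [Z [b [XY ZX ZY le0]]]]]; exists X, Y, Z; split => //; split => //.
  exact: le_trans le0 (ltW g0).
apply: (@le_trans _ _ (C * (e / (C + 1)))); first by rewrite ler_wpM2l// ge_min lexx orbT.
by rewrite mulrA ler_pdivrMr// mulrC ler_pM2l// lerDl.
Qed.

Lemma distinct_unique_nearest w X : distinct_distances w -> (origin |` Phi w) X ->
  X <> origin -> unique_nearest (origin |` Phi w) X.
Proof.
move=> dd NX X0 Y Z NY NZ YX ZX e1; apply: contrapT => YZ.
(* Of two distinct candidates at most one is the origin; the other takes the role of the Poisson
   point. *)
have key U V : (origin |` Phi w) U -> (origin |` Phi w) V -> enorm U < enorm X ->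
    enorm V < enorm X -> U <> V -> V <> origin -> enorm (X - U) = enorm (X - V) -> False.
  move=> NU [//|PV] UX VX UV V0; apply: dd => // e2.
  - by move: UX; rewrite e2 ltxx.
  - by move: VX; rewrite e2 ltxx.
  - by case: UV.
have [Z0|/eqP Z0] := eqVneq Z origin; last exact: (key Y Z).
by apply: (key Z Y) => // [e2|e2]; case: YZ; rewrite ?e2// Z0 e2.
Qed.

Lemma distinct_norms w X Y : distinct_distances w -> (origin |` Phi w) X ->
  (origin |` Phi w) Y -> enorm X = enorm Y -> X = Y.
Proof.
move=> dd NX NY e1; apply: contrapT => XY.
have [X0|/eqP X0] := eqVneq X origin.
  by apply: XY; move: e1; rewrite X0 enorm0 => /esym /enorm_eq0 ->.
have Y0 : Y <> origin by move=> Y0; case: X0; move: e1; rewrite Y0 enorm0 => /enorm_eq0.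
case: NY => [//|PY]; have : enorm (origin - X) <> enorm (origin - Y).
  apply: dd => //; first by split => //; left.
  - by move=> e2; case: X0.
  - by move=> e2; case: XY.
by rewrite !enorm_0sub e1.
Qed.

Definition tame w := (forall s : R, finite_set ((origin |` Phi w) `&` [set z | enorm z < s])) /\
  distinct_distances w.

(** The exceptional event collects wide chains or near ties, an empty square, and a steep sequence,
    each of probability O(n^-2). *)
Lemma annulus_events : exists (n1 : nat) (C C' : R), 0 <= C /\ forall n, (n1 <= n)%N ->
  exists2 F : set T, ple F (C' / n%:R ^+ 2) & forall w, ~ F w -> tame w ->
  let N := origin |` Phi w in
  (forall p, n%:R ^+ 21 <= enorm p <= n.+1%:R ^+ 21 ->
     exists z, [/\ N z, enorm z < enorm p & enorm (p - z) <= n%:R]) /\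
  (forall X k, N X -> n%:R ^+ 21 <= enorm X -> enorm X < n.+1%:R ^+ 21 ->
     (forall l, (l < k)%N -> n%:R ^+ 21 <= enorm (iter l (anc N) X)) ->
     enorm (direction X - direction (iter k (anc N) X)) <= C / n%:R ^+ 2).
Proof.
have [D1 gap] := @pow_succ_gap R 20.
have [C49 C49_0 exp49] := @pow_expR R 49.
pose D : R := D1.+1%:R; have D0 : 0 <= D by [].
pose C4 : R := 4 * (D + 1) * ((4 * (D + 1) + 4) * unit_area) ^+ 45.
exists (Num.truncn (16 * (310 + 50 * (45 * D + 46) ^+ 2))).+1, (8 * (45 * D + 46) + 6),
  (24 * C49 + 1 + (64 * (D + 1) ^+ 2 * C49 + C4)).
split=> [|n n1]; first by rewrite addr_ge0 ?mulr_ge0 ?addr_ge0 ?mulr_ge0.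
pose x : R := n%:R.
have xl : 16 * (310 + 50 * (45 * D + 46) ^+ 2) <= x.
  by rewrite (le_trans (ltW (truncnS_gt _)))// ler_nat.
have x1 : 1 <= x := param_le1 D0 xl.
have x0 : 0 < x by exact: lt_le_trans x1.
have x16 : 16 <= x by apply: le_trans xl; have := sqr_ge0 (45 * D + 46); lra.
have xk (k : nat) : 0 < x ^+ k by exact: exprn_gt0.
have [gap1 gap2] := gap x x1.
(* The n-th annulus is cut into n^13 rings, so [r J] is exactly the inner radius. *)
pose top : R := (x + 1) ^+ 21; pose M := (top - x ^+ 21) / x ^+ 13.
have xM1 : x ^+ 7 <= M by rewrite ler_pdivlMr// -exprD.
have D1D : D1%:R <= D by rewrite ler_nat.
have xMD : M <= D * x ^+ 7.
  rewrite ler_pdivrMr// -mulrA -exprD; apply: (le_trans gap1).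
  by rewrite ler_pM2r.
have topD : top <= D * x ^+ 21.
  have : D1%:R * x ^+ 20 <= D1%:R * x ^+ 21 by rewrite ler_wpM2l// ler_weXn2l.
  by rewrite /D -natr1 mulrDl mul1r /top; lra.
have rin0 : 0 < x ^+ 21 / 2 by rewrite divr_gt0.
have eta0 : 0 < (x ^+ 3)^-1 by rewrite invr_gt0.
have nX (k : nat) : (n ^ k)%:R = x ^+ k by rewrite natrX.
have n0 : (0 < n)%N by rewrite -(ltr_nat R).
have rJ : top - (n ^ 13)%:R * M = x ^+ 21.
  by rewrite nX /M mulrC divfK ?gt_eqF// opprB addrC subrK.
have e0 : 0 < (x ^+ 2)^-1 by rewrite invr_gt0.
have exp_le : x ^+ 47 / expR x <= C49 / x ^+ 2.
  rewrite ler_pdivrMr ?expR_gt0// mulrAC ler_pdivlMr// -exprD; exact: exp49 (ltW x0).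
have [F Fp Fgood] : exists2 F : set T, ple F (24 * (x ^+ 47 / expR x) + (x ^+ 2)^-1) &
  forall w, ~ F w -> let N := origin |` Phi w in
  (forall s : R, finite_set (N `&` [set z | enorm z < s])) ->
  (forall X, N X -> X <> origin -> unique_nearest N X) ->
  (forall X Y, N X -> N Y -> enorm X = enorm Y -> X = Y) ->
  (forall p, x ^+ 21 / 2 <= enorm p <= top ->
    exists z, [/\ N z, enorm z < enorm p & enorm (p - z) <= x]) ->
  ~ steep Phi (x ^+ 21 / 2) top x (x ^+ 3)^-1 44 w ->
  forall X k, N X -> x ^+ 21 <= enorm X -> enorm X < top ->
  (forall i, (i < k)%N -> x ^+ 21 <= enorm (iter i (anc N) X)) ->
  enorm (direction X - direction (iter k (anc N) X)) <= (8 * (45 * D + 46) + 6) / x ^+ 2.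
  have m00 : (0 < n ^ 21)%N by rewrite expn_gt0 n0.
  have B_ge : 2 * pi / (n ^ 21)%:R / 2 + 4 * kap x (x ^+ 3)^-1 44 (2 * x) / (x ^+ 21 / 2) <=
      (300 * n ^ 5)%N%:R * (2 * pi / (n ^ 21)%:R).
    by rewrite [(300 * _)%:R]natrM !nX; exact: param_B D0 xl.
  have cb : 2 * kap x (x ^+ 3)^-1 44 M * (n ^ 21)%:R / (x ^+ 21 / 2) + 1 <= 5 * (45 * D + 46) * x ^+ 11.
    by rewrite nX; exact: param_cbar.
  have rinJ : x ^+ 21 / 2 + x <= top - (n ^ 13)%:R * M by rewrite rJ; exact: param_rin xl.
  have Ee : (x ^+ 19 / 16 + 1) * (2 * pi / (n ^ 21)%:R) <= (x ^+ 2)^-1.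
    by rewrite nX; exact: param_E xl.
  have l0 : 0 <= (x ^+ 17)^-1 by rewrite invr_ge0 ltW.
  (* The last argument gives near ties the probability x^-2, of the same order as the other
     events. *)
  have [F Fp Fg] := ple_annulus hPhi rin0 x0 eta0 m00 (param_WM D0 xM1 xl) rinJ
    (param_kap_rin D0 xMD xl) cb B_ge l0 (param_lc D0 xl) (param_e D0 xl) Ee e0.
  exists F.
    apply: ple_sub Fp => //; rewrite lerD2r.
    apply: le_trans (param_chain D0 xl (esym (nX 13)) (nX 21)).
    by rewrite [(300 * _)%:R]natrM [(n ^ 5)%:R]nX -[(n ^ 21).+2]addn2 natrD.
  move=> w Fw N f1 f2 f3 f4 f5 X k NX X1 X2 hk.
  apply: le_trans (param_angle D0 xMD xl).
  by apply: (Fg w Fw f1 f2 f3 f4 f5) => //; rewrite rJ.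
(* Enough squares of side x / 4 to cover the disc of radius [top]; with this side steps have length
   at most x. *)
pose nn := (4 * (D1.+1 + 1) * n ^ 20)%N.
have s0 : 0 < x / 4 by rewrite divr_gt0.
have nnR : nn%:R = 4 * (D + 1) * x ^+ 20 by rewrite /nn natrM [(4 * _)%:R]natrM natrD nX.
have nnx : nn%:R * (x / 4) = (D + 1) * x ^+ 21 by rewrite nnR exprSr; field.
have top_lt : top < (D + 1) * x ^+ 21.
  by apply: (le_lt_trans topD); rewrite ltr_pM2r// ltrDl.
have holedp : ple (holed Phi (x / 4) nn) (64 * (D + 1) ^+ 2 * (C49 / x ^+ 2)).
  apply: ple_sub (ple_holed hPhi nn s0) => //.
  have -> : (2 * nn)%:R = 8 * (D + 1) * x ^+ 20 :> R by rewrite natrM nnR; ring.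
  have -> : (8 * (D + 1) * x ^+ 20) ^+ 2 = 64 * (D + 1) ^+ 2 * x ^+ 40 by ring.
  rewrite -[leLHS]mulrA; apply: ler_wpM2l; first by apply: mulr_ge0 => //; exact: sqr_ge0.
  apply: le_trans exp_le.
  apply: ler_pM; [exact: ltW|exact: expR_ge0|exact: ler_weXn2l|].
  (* A square has area x^2 / 16, which is at least x as x >= 16. *)
  rewrite -expRN ler_expR lerN2 expr_div_n; nra.
have m3 : (2 < (n ^ 19).-1.+1)%N.
  rewrite prednK ?expn_gt0 ?n0// -(ltr_nat R) nX; apply: (@lt_le_trans _ _ (x ^+ 1)); last exact: ler_weXn2l.
  by rewrite expr1; lra.
have mR : (n ^ 19).-1.+1%:R = x ^+ 19 by rewrite prednK ?expn_gt0 ?n0// nX.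
pose L := ((D1.+1 + 1) * n ^ 24)%N.
have LR : L%:R = (D + 1) * x ^+ 24 by rewrite /L natrM natrD nX.
have steepp : ple (steep Phi (x ^+ 21 / 2) top x (x ^+ 3)^-1 44) (C4 / x ^+ 2).
  have g3 : 8 * (44%:R * x) / (x ^+ 21 / 2) <= @gam R (n ^ 19).-1.
    by rewrite /gam mR; exact: param_steep_gam xl.
  have t3 : top < L%:R * (x ^+ 3)^-1.
    by rewrite LR -mulrA (_ : x ^+ 24 / x ^+ 3 = x ^+ 21)//; field; exact: lt0r_neq0.
  have := ple_steep hPhi rin0 x0 eta0 m3 (param_steep_KW D0 xl) g3 t3.
  by apply: ple_sub => //; rewrite LR mR; exact: (param_steep D0 (@unit_area_ge0 R) xl).
exists (F `|` (holed Phi (x / 4) nn `|` steep Phi (x ^+ 21 / 2) top x (x ^+ 3)^-1 44)).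
  apply: ple_sub (pleU Fp (pleU holedp steepp)) => //.
  exact: sum_bound exp_le.
move=> w nF [fin dd] N.
have dense p : x ^+ 21 / 2 <= enorm p <= top ->
    exists z, [/\ N z, enorm z < enorm p & enorm (p - z) <= x].
  move=> /andP[p1 p2]; have [|||z [Pz zp pz]] := @not_holed_descend _ _ _ Phi (x / 4) nn s0 w p.
  - by move=> h; apply: nF; right; left.
  - apply: le_trans p1; have h : x ^+ 1 <= x ^+ 21 by exact: ler_weXn2l.
    by rewrite expr1 in h; lra.
  - by rewrite nnx (le_lt_trans p2).
  by exists z; split => //; [right|apply: (le_trans pz); lra].
have tE : n.+1%:R ^+ 21 = top by rewrite /top natr1.
split=> [p|X k NX X1].
  rewrite tE => /andP[p1 p2]; apply: dense; rewrite p2 andbT (le_trans _ p1)//.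
  by rewrite ler_pdivrMr// ler_peMr ?(ltW (xk 21))// ler1n.
rewrite tE => X2 hk; apply: (Fgood w) => //.
- by move=> h; apply: nF; left.
- by move=> Y NY Y0; exact: distinct_unique_nearest.
- by move=> Y Z NY NZ; exact: (distinct_norms dd NY NZ).
- by move=> h; apply: nF; right; right.
Qed.

End AlmostSure.

Theorem theorem2p1 (R : realType) (d : measure_display) (T : measurableType d)
    (P : probability T R) (Phi : T -> set (plane R))
    (hPhi : homogeneous_poisson P 1 Phi) :
  {ae P, forall w : T,
    let N := origin |` Phi w in
    [/\ forall y : nat -> plane R, semi_infinite_path N y ->
          exists2 u, unit_circle u & asymptotic_direction y u,
        forall u : plane R, unit_circle u ->
          exists2 y, semi_infinite_path N y & asymptotic_direction y u
      & unit_circle `<=`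
        closure [set u : plane R | unit_circle u /\
          exists y z : nat -> plane R,
            [/\ semi_infinite_path N y, semi_infinite_path N z,
                asymptotic_direction y u, asymptotic_direction z u
              & ~ same_path y z]]]}.
Proof.
have [n1 [C [C' [C0 ann]]]] := annulus_events hPhi.
have /choice[F hF] : forall n, exists F : set T, (n1 <= n)%N ->
    ple P F (C' / n%:R ^+ 2) /\ forall w, ~ F w -> tame Phi w ->
    let N := origin |` Phi w in
    (forall p, n%:R ^+ 21 <= enorm p <= n.+1%:R ^+ 21 ->
       exists z, [/\ N z, enorm z < enorm p & enorm (p - z) <= n%:R]) /\
    (forall X k, N X -> n%:R ^+ 21 <= enorm X -> enorm X < n.+1%:R ^+ 21 ->
       (forall l, (l < k)%N -> n%:R ^+ 21 <= enorm (iter l (anc N) X)) ->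
       enorm (direction X - direction (iter k (anc N) X)) <= C / n%:R ^+ 2).
  move=> n; have [h|h] := leqP n1 n; last first.
    by exists set0.
  by have [F F1 F2] := ann n h; exists F.
(* Shifted by one to match the summand C / (n + 1)^2, and empty before the threshold. *)
pose E n := if (n1 <= n.+1)%N then F n.+1 else set0.
have bc : P.-negligible [set w | forall n0, exists2 n, (n0 <= n)%N & E n w].
  apply: (@borel_cantelli _ _ _ _ _ (Num.max 0 C')) => n; rewrite /E; case: ifP => h.
    have [Fp _] := hF _ h; apply: ple_sub Fp => //.
    by rewrite ler_pM2r ?invr_gt0 ?exprn_gt0// le_max lexx orbT.
  by apply: ple_sub (ple0 P) => //; rewrite divr_ge0 ?exprn_ge0// le_max lexx.
have neg := negligibleU (ae_locally_finite hPhi) (negligibleU (ae_distinct_distances hPhi) bc).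
apply: negligibleS neg => w /= bad; apply: contrapT => /not_orP[lf /not_orP[/contrapT dd ev]].
apply: bad => /=; set N := origin |` Phi w.
have Nfin (s : R) : finite_set (N `&` [set z | enorm z < s]).
  apply: (@sub_finite_set _ _ ([set origin] `|` (Phi w `&` [set z | enorm z < s]))).
    by move=> z [[->|Pz] zs]; [left|right].
  rewrite finite_setU; split; first exact: finite_set1.
  by apply: contrapT => inf; apply: lf; exists s.
have tw : tame Phi w by [].
have N0 : N origin by left.
have Nuniq X : N X -> X <> origin -> unique_nearest N X by exact: distinct_unique_nearest.
have [n2 hn2] : exists n2, forall n, (n2 <= n)%N -> ~ E n w.
  by apply: contrapT => no; apply: ev => n0; apply: contrapT => h; apply: no; exists n0 => n nn En; apply: h; exists n.
(* Beyond both thresholds; the 2 undoes the shift in [E] and ensures n0 >= 2. *)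
pose n0 := (n1 + n2).+2.
have good n : (n0 <= n)%N -> (n1 <= n)%N /\ ~ F n w.
  move=> nn; have h1 : (n1 <= n)%N by apply: leq_trans nn; rewrite /n0 -addn2 -addnA leq_addr.
  split => // Fw; have h2 : (n2 <= n.-1)%N.
    by rewrite -ltnS prednK; move: nn; rewrite /n0; clear; lia.
  have := hn2 _ h2; rewrite /E prednK ?h1//; move: nn; rewrite /n0; clear; lia.
have dense n p : (n0 <= n)%N -> n%:R ^+ 21 <= enorm p <= n.+1%:R ^+ 21 ->
    exists z, [/\ N z, enorm z < enorm p & enorm (p - z) <= n%:R].
  by move=> /good[h1 h2]; have [_ h] := hF _ h1; have [h3 _] := h w h2 tw; exact: h3.
have annulus n X k : (n0 <= n)%N -> N X -> n%:R ^+ 21 <= enorm X -> enorm X < n.+1%:R ^+ 21 ->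
    (forall l, (l < k)%N -> n%:R ^+ 21 <= enorm (iter l (anc N) X)) ->
    enorm (direction X - direction (iter k (anc N) X)) <= C / n%:R ^+ 2.
  by move=> /good[h1 h2]; have [_ h] := hF _ h1; have [_ h3] := h w h2 tw; exact: h3.
apply: tree_directions => //.
- exact: (annuli_straight N0 Nfin Nuniq (isT : (1 < 21)%N) (isT : (1 < n0)%N) C0 dense annulus).
- exact: (annuli_finite_children N0 Nfin Nuniq (isT : (1 < 21)%N) (isT : (1 < n0)%N) dense).
- exact: (annuli_dense_directions (isT : (1 < 21)%N) (isT : (1 < n0)%N) dense).
Qed.
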